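(* There is an absolute constant $C>0$ such that the following holds. Let $X\in\mathbb{R}^{n\times n}$ be a rank $r$ matrix with condition number $\kappa=\sigma_{\max}(X)/\sigma_{\min}(X)$ satisfying assumptions A0 (with parameter $\mu_0$) and A1 (with parameter $\mu_1$). Suppose $\Omega$ with $|\Omega|=m$ is a set of indices sampled independently and uniformly with replacement from $\{1,\dots,n\}^2$, let $p=m/n^2$, and let $X_0=\mathcal{H}_r(p^{-1}\mathcal{P}_\Omega(X))$. Consider either the Riemannian gradient descent algorithm (RGrad), or the restarted Riemannian conjugate gradient algorithm (restarted RCG) with parameters $\kappa_1,\kappa_2\ge0$ satisfying $\kappa_1\kappa_2<1/3$, started from $X_0$, and let $\varepsilon_0$ be an admissible constant for the algorithm considered (see context). Then for all $\beta>1$, the iterates of the algorithm converge to $X$ with probability at least $1-3n^{2-2\beta}-2n^{1-\beta}$ provided $$m\ge C\beta^{3/2}\max\left\{\frac{\mu_0}{\varepsilon_0^2},\frac{\mu_1(1+\varepsilon_0)}{\varepsilon_0}\right\}\kappa\, n^{3/2}r\log^{3/2}(n).$$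
   Context: Here $n\ge 9$, $1\le r\le n$, $m\le n^2$. $\|\cdot\|$ is the spectral norm of a matrix (Euclidean norm of a vector), $\|\cdot\|_F$ the Frobenius norm, $\|\cdot\|_\infty$ the maximum magnitude of the entries; $\langle\cdot,\cdot\rangle$ is the Frobenius inner product; $\sigma_{\min}(X),\sigma_{\max}(X)$ are the smallest nonzero and the largest singular values of $X$. Assumption A0: with reduced SVD $X=U\Sigma V^*$, $\|\mathcal{P}_U(e_i)\|\le\sqrt{\mu_0r/n}$ and $\|\mathcal{P}_V(e_j)\|\le\sqrt{\mu_0r/n}$ for $1\le i,j\le n$, where $\mathcal{P}_U,\mathcal{P}_V$ are the orthogonal projections onto the column and row spaces of $X$ and $e_\ell$ are the canonical basis vectors. Assumption A1: $\|X\|_\infty\le\mu_1\sqrt{r/n^2}\,\|X\|$. Sampling operator: $\mathcal{P}_\Omega(Z)$ is the entrywise product of $Z$ with $\sum_{(i,j)\in\Omega}e_ie_j^*$, where repeated indices in $\Omega$ are counted with multiplicity. Tangent space: for a rank $r$ matrix $Y$ with reduced SVD $Y=U_Y\Sigma_YV_Y^*$, the tangent space of the rank $r$ matrix manifold at $Y$ is $\{U_YZ_1^*+Z_2V_Y^*: Z_1,Z_2\in\mathbb{R}^{n\times r}\}$, and $\mathcal{P}_{T}$ denotes the orthogonal projection onto a tangent space $T$. Hard thresholding: $\mathcal{H}_r(Z)$ keeps the $r$ largest singular values in an SVD of $Z$ and sets the others to zero. RGrad: given $X_0$, for $l=0,1,\dots$ let $T_l$ be the tangent space at $X_l$ and set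 $G_l=\mathcal{P}_\Omega(X-X_l)$, $\alpha_l=\dfrac{\|\mathcal{P}_{T_l}(G_l)\|_F^2}{\langle\mathcal{P}_{T_l}(G_l),\mathcal{P}_\Omega\mathcal{P}_{T_l}(G_l)\rangle}$, $W_l=X_l+\alpha_l\mathcal{P}_{T_l}(G_l)$, $X_{l+1}=\mathcal{H}_r(W_l)$. If $\mathcal{P}_{T_l}(G_l)=0$, then $X_{l+1}=X_l$. Restarted RCG: given $X_0$, set $\beta_0=0$, $P_{-1}=0$. For $l=0,1,\dots$ let $T_l$ be the tangent space at $X_l$ and set 1. $G_l=\mathcal{P}_\Omega(X-X_l)$; 2. for $l\ge1$: if both restarting conditions $$\frac{|\langle\mathcal{P}_{T_l}(G_l),\mathcal{P}_{T_l}(P_{l-1})\rangle|}{\|\mathcal{P}_{T_l}(G_l)\|_F\|\mathcal{P}_{T_l}(P_{l-1})\|_F}\le\kappa_1,\qquad \|\mathcal{P}_{T_l}(G_l)\|_F\le\kappa_2\|\mathcal{P}_{T_l}(P_{l-1})\|_F$$ hold, then $\beta_l=-\dfrac{\langle\mathcal{P}_{T_l}(G_l),\mathcal{P}_\Omega\mathcal{P}_{T_l}(P_{l-1})\rangle}{\langle\mathcal{P}_{T_l}(P_{l-1}),\mathcal{P}_\Omega\mathcal{P}_{T_l}(P_{l-1})\rangle}$; if either is violated, or if $\mathcal{P}_{T_l}(G_l)=0$ or $\mathcal{P}_{T_l}(P_{l-1})=0$, then $\beta_l=0$; 3. $P_l=\mathcal{P}_{T_l}(G_l)+\beta_l\mathcal{P}_{T_l}(P_{l-1})$;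 4. $\alpha_l=\dfrac{\langle\mathcal{P}_{T_l}(G_l),\mathcal{P}_{T_l}(P_l)\rangle}{\langle\mathcal{P}_{T_l}(P_l),\mathcal{P}_\Omega\mathcal{P}_{T_l}(P_l)\rangle}$; 5. $X_{l+1}=\mathcal{H}_r(X_l+\alpha_lP_l)$. If $P_l=0$, then $X_{l+1}=X_l$. (The weights $\beta_l$ are unrelated to the parameter $\beta>1$ in the claim.) Admissible $\varepsilon_0$: for RGrad, a constant $0<\varepsilon_0<1/4$ with $\frac{18\varepsilon_0}{1-4\varepsilon_0}<1$. For restarted RCG, a constant $\varepsilon_0>0$ with $(1-4\varepsilon_0)-\kappa_1(1+4\varepsilon_0)>0$ and $\tau_1+\tau_2<1$, where $$\tau_1=\frac{18\varepsilon_0-10\kappa_1\varepsilon_0(1+4\varepsilon_0)}{(1-4\varepsilon_0)-\kappa_1(1+4\varepsilon_0)}+\frac{4\kappa_2\varepsilon_0+\kappa_1\kappa_2}{1-4\varepsilon_0},\qquad \tau_2=\frac{8\kappa_2\varepsilon_0+2\kappa_1\kappa_2}{1-4\varepsilon_0}.$$ *)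

(* Defs.v *)
From mathcomp Require Import all_boot all_order all_algebra.
From mathcomp Require Import all_classical all_reals all_analysis.

Set Implicit Arguments.
Unset Strict Implicit.
Unset Printing Implicit Defensive.

Import Order.TTheory GRing.Theory Num.Theory.
Import numFieldNormedType.Exports.

Local Open Scope classical_set_scope.
Local Open Scope ring_scope.

Section LinearAlgebra.
Context {R : realType}.

Definition frob_inner (p q : nat) (A B : 'M[R]_(p, q)) : R :=
  \sum_(i < p) \sum_(j < q) A i j * B i j.

(* On column vectors this is the Euclidean norm. *)
Definition frob_norm (p q : nat) (A : 'M[R]_(p, q)) : R :=
  Num.sqrt (frob_inner A A).

Definition spectral_norm (n : nat) (A : 'M[R]_n) : R :=
  sup [set frob_norm (A *m x) | x in [set x : 'cV[R]_n | frob_norm x <= 1]].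

(* The default value 0 is never used when [S] is a linear subspace, where the
   point singled out exists and is unique. *)
Definition orth_proj (p q : nat) (S : set 'M[R]_(p, q)) (Z : 'M[R]_(p, q)) :
    'M[R]_(p, q) :=
  xget 0 [set Y | S Y /\ forall W, S W -> frob_inner (Z - Y) W = 0].

Definition col_space (n : nat) (X : 'M[R]_n) : set 'cV[R]_n :=
  [set X *m y | y in [set: 'cV[R]_n]].

Definition singular_value (n : nat) (X : 'M[R]_n) (s : R) : Prop :=
  0 <= s /\ eigenvalue (X^T *m X) (s ^+ 2).

Definition sigma_max (n : nat) (X : 'M[R]_n) : R :=
  sup [set s | singular_value X s].

Definition sigma_min (n : nat) (X : 'M[R]_n) : R :=
  inf [set s | singular_value X s /\ 0 < s].

Definition cond_number (n : nat) (X : 'M[R]_n) : R :=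
  sigma_max X / sigma_min X.

(* [k = n] gives the full SVD; [k = \rank A] with positive [s] gives the
   reduced one. *)
Definition is_svd (n k : nat) (A : 'M[R]_n)
    (U : 'M[R]_(n, k)) (s : 'rV[R]_k) (V : 'M[R]_(n, k)) : Prop :=
  [/\ U^T *m U = 1%:M,
      V^T *m V = 1%:M,
      forall i, 0 <= s 0 i,
      forall i j : 'I_k, (i <= j)%N -> s 0 j <= s 0 i &
      A = U *m diag_mx s *m V^T].

Definition is_reduced_svd (n r : nat) (A : 'M[R]_n)
    (U : 'M[R]_(n, r)) (s : 'rV[R]_r) (V : 'M[R]_(n, r)) : Prop :=
  is_svd A U s V /\ forall i, 0 < s 0 i.

(* For [Y] of rank [r] every reduced SVD yields the same subspace.  For
   [\rank Y != r] there is no reduced SVD of size [r], the set is empty and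
   projecting onto it gives 0, so that the algorithms below stop at [Y]. *)
Definition tangent_space (n r : nat) (Y : 'M[R]_n) : set 'M[R]_n :=
  [set W | exists (U V : 'M[R]_(n, r)) (s : 'rV[R]_r) (Z1 Z2 : 'M[R]_(n, r)),
     is_reduced_svd Y U s V /\ W = U *m Z1^T + Z2 *m V^T].

Definition proj_tangent (n r : nat) (Y Z : 'M[R]_n) : 'M[R]_n :=
  orth_proj (tangent_space r Y) Z.

(* A relation and not a function: [Y] is a possible value of the hard
   thresholding of [Z], which depends on the SVD chosen when the [r]-th and
   [r+1]-st singular values of [Z] agree. *)
Definition is_hard_threshold (n r : nat) (Z Y : 'M[R]_n) : Prop :=
  exists (U : 'M[R]_n) (s : 'rV[R]_n) (V : 'M[R]_n),
    is_svd Z U s V /\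
    Y = U *m diag_mx (\row_(i < n) (if (i < r)%N then s 0 i else 0)) *m V^T.

Definition assumption_A0 (n r : nat) (mu0 : R) (X : 'M[R]_n) : Prop :=
  (forall i : 'I_n, frob_norm (orth_proj (col_space X) (delta_mx i 0))
                    <= Num.sqrt (mu0 * r%:R / n%:R)) /\
  (forall j : 'I_n, frob_norm (orth_proj (col_space X^T) (delta_mx j 0))
                    <= Num.sqrt (mu0 * r%:R / n%:R)).

(* [ `|X| ] is the maximum magnitude of the entries of [X]. *)
Definition assumption_A1 (n r : nat) (mu1 : R) (X : 'M[R]_n) : Prop :=
  `|X| <= mu1 * Num.sqrt (r%:R / (n ^ 2)%N%:R) * spectral_norm X.

End LinearAlgebra.

Section Sampling.
Context {R : realType}.

Definition sample (n m : nat) := {ffun 'I_m -> 'I_n * 'I_n}.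

(* The [m] indices are independent, each uniform on the [n ^ 2] pairs. *)
Definition sample_prob (n m : nat) (E : set (sample n m)) : R :=
  \sum_(Om : sample n m | `[< E Om >]) \prod_(k < m) (n ^ 2)%N%:R^-1.

Definition P_Omega (n m : nat) (Om : sample n m) (Z : 'M[R]_n) : 'M[R]_n :=
  map2_mx *%R Z (\sum_(k < m) delta_mx (Om k).1 (Om k).2).

End Sampling.

Section Algorithms.
Context {R : realType}.

Definition rgrad_run (n r m : nat) (X : 'M[R]_n) (Om : sample n m)
    (Xs : nat -> 'M[R]_n) : Prop :=
  forall l : nat,
    let PG := proj_tangent r (Xs l) (P_Omega Om (X - Xs l)) in
    let alpha := frob_norm PG ^+ 2 / frob_inner PG (P_Omega Om PG) in
    if PG == 0 then Xs l.+1 = Xs l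
    else is_hard_threshold r (Xs l + alpha *: PG) (Xs l.+1).

(* [PG] and [PP] are the projections onto the current tangent space of the
   current residual and of the previous search direction. *)
Definition restart_beta (n m : nat) (kappa1 kappa2 : R) (Om : sample n m)
    (PG PP : 'M[R]_n) : R :=
  if [&& PG != 0, PP != 0,
         `|frob_inner PG PP| / (frob_norm PG * frob_norm PP) <= kappa1 &
         frob_norm PG <= kappa2 * frob_norm PP]
  then - (frob_inner PG (P_Omega Om PP) / frob_inner PP (P_Omega Om PP))
  else 0.

Definition rcg_run (n r m : nat) (kappa1 kappa2 : R) (X : 'M[R]_n)
    (Om : sample n m) (Xs : nat -> 'M[R]_n) : Prop :=
  exists Ps : nat -> 'M[R]_n, forall l : nat,
    let PT := proj_tangent r (Xs l) in
    let PG := PT (P_Omega Om (X - Xs l)) in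
    let PP := if l is l'.+1 then PT (Ps l') else 0 in
    let beta :=
      if l is _.+1 then restart_beta kappa1 kappa2 Om PG PP else 0 in
    let alpha :=
      frob_inner PG (PT (Ps l)) /
      frob_inner (PT (Ps l)) (P_Omega Om (PT (Ps l))) in
    Ps l = PG + beta *: PP /\
    if Ps l == 0 then Xs l.+1 = Xs l
    else is_hard_threshold r (Xs l + alpha *: Ps l) (Xs l.+1).

Inductive algorithm :=
  | RGrad
  | RestartedRCG of R & R.

Definition valid_parameters (alg : algorithm) : Prop :=
  match alg with
  | RGrad => True
  | RestartedRCG kappa1 kappa2 =>
      [/\ 0 <= kappa1, 0 <= kappa2 & kappa1 * kappa2 < 1 / 3]
  end.

Definition tau1 (kappa1 kappa2 e : R) : R :=
  (18 * e - 10 * kappa1 * e * (1 + 4 * e)) /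
    ((1 - 4 * e) - kappa1 * (1 + 4 * e)) +
  (4 * kappa2 * e + kappa1 * kappa2) / (1 - 4 * e).

Definition tau2 (kappa1 kappa2 e : R) : R :=
  (8 * kappa2 * e + 2 * kappa1 * kappa2) / (1 - 4 * e).

Definition admissible (alg : algorithm) (e : R) : Prop :=
  match alg with
  | RGrad => [/\ 0 < e, e < 1 / 4 & 18 * e / (1 - 4 * e) < 1]
  | RestartedRCG kappa1 kappa2 =>
      [/\ 0 < e, 0 < (1 - 4 * e) - kappa1 * (1 + 4 * e) &
          tau1 kappa1 kappa2 e + tau2 kappa1 kappa2 e < 1]
  end.

Definition is_run (alg : algorithm) (n r m : nat) (X : 'M[R]_n)
    (Om : sample n m) (Xs : nat -> 'M[R]_n) : Prop :=
  is_hard_threshold r ((m%:R / (n ^ 2)%N%:R)^-1 *: P_Omega Om X) (Xs 0%N) /\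
  match alg with
  | RGrad => rgrad_run r X Om Xs
  | RestartedRCG kappa1 kappa2 => rcg_run r kappa1 kappa2 X Om Xs
  end.

(* Whatever SVDs are used in the hard thresholding steps, the iterates
   converge to [X].  Runs exist for every [Om], since every step is total and
   every real matrix has an SVD. *)
Definition iterates_converge (alg : algorithm) (n r m : nat) (X : 'M[R]_n) :
    set (sample n m) :=
  [set Om | forall Xs : nat -> 'M[R]_n,
     is_run alg r X Om Xs -> Xs l @[l --> \oo] --> X].

End Algorithms.

Arguments algorithm : clear implicits.
Arguments iterates_converge {R} alg n r m X.

(* Main.v *)
(* On a good sample the iteration converges linearly.  If the sampling operator
   nearly preserves inner products on the tangent space at [X] and no entry is
   sampled more than about [log n] times, then it also does so on the tangent
   space at any [Y] close enough to [X], because the two tangent projections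
   differ by a multiple of [|X - Y| / sigma_min].  The part of [X] outside the
   tangent space at [Y] is quadratically small, so one step contracts the error
   up to the previous search direction, and the errors and search directions
   together satisfy a two-term linear recursion whose companion polynomial is
   positive at 1 exactly when [tau1 + tau2 < 1].  RGrad is the case
   [kappa1 = kappa2 = 0], in which every step restarts.

   Good samples are likely by a moment bound for sums of independent random
   symmetric matrices, obtained from an exchangeable pair and the inequality
   [tr (H A^i H B^j) <= tr (H^2 (A^(i+j) + B^(i+j)))] for even [i + j].  It is
   applied with exponent [2 q], [q] about [beta log n], to the dilation of
   [p^-1 P_Omega X - X], which controls the initial guess, and to the sampled
   rank one operators on the tangent space. *)

(* The exponents 3/2 come from the size of the basin of attraction. On the tangent space at [X] the
   quadratic form of the sampling operator is about [p], but off it a matrix can be amplified by the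
   multiplicity bound [L], of order [beta log n]. A tangent space at relative distance [delta] from
   the right one thus costs cross terms of order [delta * L * sqrt p], harmless against [eps * p]
   only if [delta] is at most of order [sqrt p * eps / L]. The initial guess has a Frobenius error
   of order [sqrt r] times the spectral error [sqrt (beta log n * n / m) * mu1 * sqrt r *
   sigma_max]. Asking that it be below [delta * sigma_min] gives [m >= (beta n log n)^(3/2) * mu1 *
   kappa * r / eps] up to a constant. The near-isometry on the tangent space at [X] is cheaper: it
   asks for [m >= beta n log n * mu0 * r / eps^2] up to a constant. *)
Require Import Defs.
From mathcomp Require Import all_boot all_order all_algebra.
From mathcomp Require Import all_classical all_reals all_analysis.
From mathcomp Require Import ring lra zify.
From mathcomp.real_closed Require Import complex.
Import Order.TTheory GRing.Theory Num.Theory.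
Import numFieldNormedType.Exports.
Set Implicit Arguments.
Unset Strict Implicit.
Unset Printing Implicit Defensive.
Local Open Scope ring_scope.

Local Notation ip := frob_inner.
Local Notation nrm := frob_norm.

(** * Frobenius inner product *)

Section Frobenius.
Context {R : realType}.
Implicit Types p q k : nat.

Lemma ip_trace p q (A B : 'M[R]_(p, q)) : ip A B = \tr (A^T *m B).
Proof.
rewrite /mxtrace /frob_inner exchange_big; apply: eq_bigr => j _.
by rewrite mxE; apply: eq_bigr => i _; rewrite mxE.
Qed.

Lemma ipC p q (A B : 'M[R]_(p, q)) : ip A B = ip B A.
Proof. by apply: eq_bigr => i _; apply: eq_bigr => j _; rewrite mulrC. Qed.

Lemma ipDl p q (A B C : 'M[R]_(p, q)) : ip (A + B) C = ip A C + ip B C.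
Proof. by rewrite !ip_trace linearD mulmxDl linearD. Qed.

Lemma ipDr p q (A B C : 'M[R]_(p, q)) : ip C (A + B) = ip C A + ip C B.
Proof. by rewrite ipC ipDl !(ipC C). Qed.

Lemma ipZl p q a (A B : 'M[R]_(p, q)) : ip (a *: A) B = a * ip A B.
Proof. by rewrite !ip_trace linearZ -scalemxAl linearZ. Qed.

Lemma ipZr p q a (A B : 'M[R]_(p, q)) : ip A (a *: B) = a * ip A B.
Proof. by rewrite ipC ipZl ipC. Qed.

Lemma ipNl p q (A B : 'M[R]_(p, q)) : ip (- A) B = - ip A B.
Proof. by rewrite -scaleN1r ipZl mulN1r. Qed.

Lemma ipNr p q (A B : 'M[R]_(p, q)) : ip A (- B) = - ip A B.
Proof. by rewrite ipC ipNl ipC. Qed.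

Lemma ipBl p q (A B C : 'M[R]_(p, q)) : ip (A - B) C = ip A C - ip B C.
Proof. by rewrite ipDl ipNl. Qed.

Lemma ipBr p q (A B C : 'M[R]_(p, q)) : ip C (A - B) = ip C A - ip C B.
Proof. by rewrite ipDr ipNr. Qed.

Lemma ip0l p q (A : 'M[R]_(p, q)) : ip 0 A = 0.
Proof. by rewrite -(scale0r 0) ipZl mul0r. Qed.

Lemma ip0r p q (A : 'M[R]_(p, q)) : ip A 0 = 0.
Proof. by rewrite ipC ip0l. Qed.

Lemma ip_tr p q (A B : 'M[R]_(p, q)) : ip A^T B^T = ip A B.
Proof. by rewrite !ip_trace trmxK mxtrace_mulC -mxtrace_tr trmx_mul trmxK. Qed.

Lemma ip_mull p q k (M : 'M[R]_(k, p)) (A : 'M[R]_(p, q)) B :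
  ip (M *m A) B = ip A (M^T *m B).
Proof. by rewrite !ip_trace trmx_mul mulmxA. Qed.

Lemma ip_mulr p q k (M : 'M[R]_(q, k)) (A : 'M[R]_(p, q)) B :
  ip (A *m M) B = ip A (B *m M^T).
Proof. by rewrite -ip_tr trmx_mul ip_mull -[in RHS]ip_tr trmx_mul. Qed.

Lemma ip_suml p q (I : finType) (F : I -> 'M[R]_(p, q)) A :
  ip (\sum_i F i) A = \sum_i ip (F i) A.
Proof.
by elim/big_rec2: _ => [|i x y _ <-]; rewrite ?ip0l ?ipDl.
Qed.

Lemma ipAA_ge0 p q (A : 'M[R]_(p, q)) : 0 <= ip A A.
Proof.
by apply: sumr_ge0 => i _; apply: sumr_ge0 => j _; rewrite -expr2 sqr_ge0.
Qed.

Lemma nrm_ge0 p q (A : 'M[R]_(p, q)) : 0 <= nrm A.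
Proof. exact: sqrtr_ge0. Qed.

Lemma nrm_sq p q (A : 'M[R]_(p, q)) : nrm A ^+ 2 = ip A A.
Proof. by rewrite sqr_sqrtr // ipAA_ge0. Qed.

Lemma nrm_sqE p q (A : 'M[R]_(p, q)) :
  nrm A ^+ 2 = \sum_(i < p) \sum_(j < q) A i j ^+ 2.
Proof.
by rewrite nrm_sq; apply: eq_bigr => i _; apply: eq_bigr => j _; rewrite expr2.
Qed.

Lemma entry_le_nrm p q (A : 'M[R]_(p, q)) i j : `|A i j| <= nrm A.
Proof.
rewrite -(@ler_pXn2r _ 2) ?nnegrE ?nrm_ge0 //.
rewrite nrm_sqE real_normK ?num_real // (bigD1 i) //= (bigD1 j) //= -addrA.
rewrite lerDl addr_ge0 // sumr_ge0 // => k _; rewrite ?sqr_ge0 //.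
by apply: sumr_ge0 => l _; exact: sqr_ge0.
Qed.

Lemma nrm_eq0 p q (A : 'M[R]_(p, q)) : nrm A = 0 -> A = 0.
Proof.
move=> A0; apply/matrixP => i j; rewrite mxE; apply/eqP.
by rewrite -normr_le0 -A0 entry_le_nrm.
Qed.

Lemma nrm0 p q : nrm (0 : 'M[R]_(p, q)) = 0.
Proof. by rewrite /frob_norm ip0l sqrtr0. Qed.

Lemma nrm_gt0 p q (A : 'M[R]_(p, q)) : A != 0 -> 0 < nrm A.
Proof.
move=> A0; rewrite lt_neqAle nrm_ge0 andbT eq_sym.
by apply: contra A0 => /eqP/nrm_eq0 ->.
Qed.

Lemma nrm_tr p q (A : 'M[R]_(p, q)) : nrm A^T = nrm A.
Proof. by rewrite /frob_norm ip_tr. Qed.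

Lemma nrmZ p q a (A : 'M[R]_(p, q)) : nrm (a *: A) = `|a| * nrm A.
Proof.
by rewrite /frob_norm ipZl ipZr mulrA -expr2 sqrtrM ?sqr_ge0 // sqrtr_sqr.
Qed.

Lemma nrmN p q (A : 'M[R]_(p, q)) : nrm (- A) = nrm A.
Proof. by rewrite -scaleN1r nrmZ normrN1 mul1r. Qed.

Lemma nrmB p q (A B : 'M[R]_(p, q)) : nrm (A - B) = nrm (B - A).
Proof. by rewrite -nrmN opprB. Qed.

Lemma nrmD_sq p q (A B : 'M[R]_(p, q)) :
  nrm (A + B) ^+ 2 = nrm A ^+ 2 + 2 * ip A B + nrm B ^+ 2.
Proof. by rewrite !nrm_sq ipDl !ipDr (ipC B A); ring. Qed.

(* A symmetric bilinear form bounded on the diagonal is bounded, by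
   polarization. *)
Lemma polarization_bound p q (f : 'M[R]_(p, q) -> 'M[R]_(p, q) -> R) e :
  (forall A B C, f (A + B) C = f A C + f B C) ->
  (forall a A B, f (a *: A) B = a * f A B) ->
  (forall A B, f A B = f B A) ->
  (forall A, `|f A A| <= e * nrm A ^+ 2) ->
  forall A B, `|f A B| <= e * nrm A * nrm B.
Proof.
move=> fD fZ fC fe A B.
have f0 C : f 0 C = 0 by rewrite -(scale0r 0) fZ mul0r.
have [->|A0] := eqVneq A 0; first by rewrite f0 normr0 nrm0 mulr0 mul0r.
have [->|B0] := eqVneq B 0; first by rewrite fC f0 normr0 nrm0 mulr0.
have a0 := nrm_gt0 A0; have b0 := nrm_gt0 B0.
(* Scaling both arguments to the common norm [nrm A * nrm B] turns the sum of squares produced by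
   the parallelogram identity into the product on the right. *)
pose A' := nrm B *: A; pose B' := nrm A *: B.
have nA : nrm A' = nrm A * nrm B.
  by rewrite nrmZ ger0_norm ?nrm_ge0 // mulrC.
have nB : nrm B' = nrm A * nrm B by rewrite nrmZ ger0_norm ?nrm_ge0.
have h1 := fe (A' + B'); have h2 := fe (A' - B').
have fS u v : f (A' + u *: B') (A' + v *: B') =
    f A' A' + (u + v) * f A' B' + u * v * f B' B'.
  have fr C : f C (A' + v *: B') = f C A' + v * f C B'.
    by rewrite fC fD fZ !(fC C).
  by rewrite fD fZ !fr (fC B' A'); ring.
have e1 : f (A' + B') (A' + B') = f A' A' + 2 * f A' B' + f B' B'.
  by have := fS 1 1; rewrite scale1r => ->; ring.
have e2 : f (A' - B') (A' - B') = f A' A' - 2 * f A' B' + f B' B'.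
  by have := fS (-1) (-1); rewrite scaleN1r => ->; ring.
have n1 := nrmD_sq A' B'; have n2 := nrmD_sq A' (- B').
rewrite ipNr nrmN in n2; rewrite n1 e1 in h1; rewrite n2 e2 in h2.
have fAB : f A' B' = nrm A * nrm B * f A B.
  by rewrite /A' /B' fZ fC fZ fC; ring.
have key : `|f A' B'| <= e * (nrm A * nrm B) ^+ 2.
  move: h1 h2; rewrite nA nB !ler_norml => /andP[h1 h2] /andP[h3 h4].
  by apply/andP; split; lra.
move: key; rewrite fAB normrM ger0_norm ?mulr_ge0 ?nrm_ge0 //.
rewrite expr2 mulrCA ler_pM2l ?mulr_gt0 //.
by rewrite mulrA.
Qed.

Lemma cauchy_schwarz p q (A B : 'M[R]_(p, q)) : `|ip A B| <= nrm A * nrm B.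
Proof.
rewrite -(mul1r (nrm A)).
apply: (@polarization_bound _ _ (@frob_inner R p q)) => *.
- exact: ipDl.
- exact: ipZl.
- exact: ipC.
- by rewrite mul1r nrm_sq ger0_norm // ipAA_ge0.
Qed.

Lemma nrmD p q (A B : 'M[R]_(p, q)) : nrm (A + B) <= nrm A + nrm B.
Proof.
rewrite -(@ler_pXn2r _ 2) ?nnegrE ?addr_ge0 ?nrm_ge0 // nrmD_sq.
have := le_trans (ler_norm _) (cauchy_schwarz A B); lra.
Qed.

Lemma nrm_triB p q (A B C : 'M[R]_(p, q)) :
  nrm (A - C) <= nrm (A - B) + nrm (B - C).
Proof. by apply: le_trans (nrmD _ _); rewrite addrA subrK. Qed.

Lemma nrm_le_of_ip p q (A : 'M[R]_(p, q)) e : 0 <= e ->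
  `|ip A A| <= e * nrm A -> nrm A <= e.
Proof.
move=> e0; have [->|A0] := eqVneq A 0; first by rewrite nrm0.
rewrite -nrm_sq ger0_norm ?sqr_ge0 // expr2 ler_pM2r //.
exact: nrm_gt0.
Qed.

End Frobenius.

(** * Spectral theorem *)

Section Spectral.
Context {R : realType}.

(** Over [R[i]] the matrix is Hermitian, so its spectral diagonal is real. An entry of it is a root
    of the complex characteristic polynomial, which is the image of the real one, and roots descend
    along the embedding. *)
Lemma sym_eigenvalue n (A : 'M[R]_n.+1) : A^T = A ->
  exists a, eigenvalue A a.
Proof.
move=> symA; pose Ac : 'M[R[i]]_n.+1 := map_mx (real_complex R) A.
have herm : Ac \is hermsymmx.
  apply/is_hermitianmxP/matrixP => i j; rewrite expr0 scale1r !mxE.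
  by rewrite [RHS]conjc_real -[in LHS]symA mxE.
have /orthomx_spectralP specA := hermitian_normalmx herm.
have := hermitian_spectral_diag_real herm => /mxOverP/(_ 0 0) dreal.
set d := spectral_diag Ac in specA dreal.
have /complex_realP[x dx] := dreal.
exists x; rewrite eigenvalue_root_char -(fmorph_root (real_complex R)).
rewrite map_char_poly -eigenvalue_root_char -/Ac.
have Punit := spectral_unit Ac.
set P := spectralmx Ac in specA Punit.
apply/eigenvalueP; exists (row 0 P).
  rewrite -row_mul {1}specA !mulmxA mulmxV // mul1mx.
  by rewrite row_mul row_diag_mx -scalemxAl -rowE /= -dx.
apply/eqP => r0; move: Punit.
rewrite -row_free_unit => /row_freeP[B /(congr1 (row 0))].
rewrite row_mul r0 mul0mx => /matrixP/(_ 0 0); rewrite !mxE eqxx => /eqP.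
by rewrite eq_sym oner_eq0.
Qed.

(** [H] is the Householder reflection along [u = v - e], which exchanges [v] with the first basis
    vector [e]. For [u = 0] the identity serves. *)
Lemma orthogonal_completion n (v : 'rV[R]_n.+1) : v *m v^T = 1%:M ->
  exists2 H : 'M[R]_n.+1, H *m H^T = 1%:M & row 0 H = v.
Proof.
move=> vv; pose e : 'rV[R]_n.+1 := delta_mx 0 0.
have [u uE] : exists u, u = v - e by exists (v - e).
have ee : e *m e^T = 1%:M.
  by rewrite /e trmx_delta mul_delta_mx; apply/matrixP => i j; rewrite !mxE !ord1.
have [u0|u0] := eqVneq u 0.
  exists 1%:M; first by rewrite trmx1 mulmx1.
  by rewrite row1; move/eqP: u0; rewrite uE subr_eq0 => /eqP.
pose c := (u *m u^T) 0 0.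
have uu : u *m u^T = c%:M by rewrite [LHS]mx11_scalar.
have c0 : c != 0.
  apply: contra u0 => /eqP c0; apply/eqP/nrm_eq0/eqP.
  rewrite -sqrf_eq0 nrm_sq ip_trace mxtrace_mulC uu c0.
  by rewrite raddf0 mxtrace0.
have ve : v *m e^T = (v 0 0)%:M.
  by rewrite [LHS]mx11_scalar /e trmx_delta -colE mxE.
have ev : e *m v^T = (v 0 0)%:M by rewrite -[LHS]trmxK trmx_mul trmxK ve tr_scalar_mx.
have cE : c = 2 - 2 * v 0 0.
  rewrite /c uE linearB /= mulmxBl !mulmxBr vv ee ve ev !mxE eqxx !mulr1n; ring.
have eu : e *m u^T = (- c / 2)%:M.
  rewrite uE linearB /= mulmxBr ee ev -raddfB /= cE; congr (_%:M); by field.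
pose H : 'M[R]_n.+1 := 1%:M - (2 / c) *: (u^T *m u).
have HT : H^T = H by rewrite /H linearB /= trmx1 linearZ /= trmx_mul trmxK.
exists H; rewrite ?HT /H; last first.
  rewrite rowE -/e mulmxBr mulmx1 -scalemxAr mulmxA eu mul_scalar_mx scalerA.
  have -> : 2 / c * (- c / 2) = -1 by field.
  by rewrite scaleN1r opprK uE addrC subrK.
rewrite mulmxBl mul1mx mulmxBr mulmx1.
rewrite -scalemxAl -scalemxAr mulmxA -(mulmxA u^T) uu mul_mx_scalar.
rewrite -scalemxAl !scalerA.
have -> : 2 / c * (2 / c * c) = 2 / c + 2 / c by field.
by rewrite scalerDl opprB addrK subrK.
Qed.

(** Deflation: a unit eigenvector is completed to an orthogonal [H]; in the new basis symmetry
    clears the first row and column off the diagonal, and the induction applies to the remaining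
    block. *)
Theorem sym_spectral n (A : 'M[R]_n) : A^T = A ->
  exists (Q : 'M[R]_n) (d : 'rV[R]_n),
    Q *m Q^T = 1%:M /\ A = Q^T *m diag_mx d *m Q.
Proof.
elim: n A => [|n IHn] A symA.
  by exists 0, 0; split; apply/matrixP => - [].
have [a /eigenvalueP[w wA w0]] := sym_eigenvalue symA.
pose v := (nrm w)^-1 *: w.
have nw := nrm_gt0 w0.
have vv : v *m v^T = 1%:M.
  have : nrm v ^+ 2 = 1.
    by rewrite nrmZ ger0_norm ?invr_ge0 ?nrm_ge0 // mulVf ?expr1n // gt_eqF.
  rewrite nrm_sq ip_trace mxtrace_mulC [v *m _]mx11_scalar mxtrace_scalar.
  by rewrite mulr1n => ->.
have vA : v *m A = a *: v by rewrite -scalemxAl wA !scalerA mulrC.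
have [H HH Hv] := orthogonal_completion vv.
have HH' := mulmx1C HH.
pose B : 'M[R]_(1 + n) := H *m A *m H^T.
have symB : B^T = B by rewrite !trmx_mul trmxK symA mulmxA.
have rB : row 0 B = a *: delta_mx 0 0.
  rewrite !row_mul Hv vA -scalemxAl; congr (_ *: _).
  by rewrite -Hv -row_mul HH row1.
have AE : A = H^T *m B *m H by rewrite !mulmxA HH' mul1mx -mulmxA HH' mulmx1.
clearbody B.
have B0 k : B 0 k = a * (k == 0)%:R.
  by move/matrixP/(_ 0 k): rB; rewrite !mxE.
have Bul : ulsubmx B = a%:M.
  apply/matrixP => i j; rewrite !ord1 !mxE lshift0 B0 !eqxx mulr1n mulr1.
  by [].
have Bur : ursubmx B = 0.
  by apply/matrixP => i j; rewrite !ord1 !mxE lshift0 B0 mulr0.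
have Bdl : dlsubmx B = 0 by rewrite -[LHS]trmxK trmx_dlsub symB Bur trmx0.
have [|Q [d [QQ dE]]] := IHn (drsubmx B); first by rewrite trmx_drsub symB.
pose K : 'M[R]_(1 + n) := block_mx 1%:M 0 0 Q.
have KK : K *m K^T = 1%:M.
  rewrite /K tr_block_mx mulmx_block !trmx0 !mulmx0 !mul0mx trmx1 mulmx1 QQ.
  by rewrite !addr0 add0r -scalar_mx_block.
have BE : B = K^T *m diag_mx (row_mx a%:M d) *m K.
  rewrite -[LHS]submxK Bul Bur Bdl dE /K diag_mx_row tr_block_mx !mulmx_block.
  rewrite !trmx0 !(mulmx0, mul0mx) !(addr0, add0r) trmx1 mul1mx mulmx1.
  suff -> : diag_mx a%:M = a%:M :> 'M[R]_1 by rewrite !mul0mx.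
  by apply/matrixP => i j; rewrite !ord1 !mxE.
exists (K *m H), (row_mx a%:M d); split.
  by rewrite trmx_mul mulmxA -(mulmxA K) HH mulmx1 KK.
by rewrite AE BE trmx_mul !mulmxA.
Qed.

End Spectral.

(** * Moments of sums of random symmetric matrices *)

Section TracePowers.
Context {R : realType}.

Lemma trmxX n (A : 'M[R]_n) k : (A ^+ k)^T = A^T ^+ k.
Proof.
elim: k => [|k IHk]; first by rewrite !expr0 trmx1.
by rewrite exprS exprSr -IHk; apply: trmx_mul.
Qed.

Lemma spectral_pow n (Q A : 'M[R]_n) (d : 'rV[R]_n) k :
  Q *m Q^T = 1%:M -> A = Q^T *m diag_mx d *m Q ->
  A ^+ k = Q^T *m diag_mx (\row_i d 0 i ^+ k) *m Q.
Proof.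
move=> QQ AE; elim: k => [|k IHk].
  rewrite expr0 (_ : \row_i _ = const_mx 1); last first.
    by apply/matrixP => i j; rewrite !mxE expr0.
  by rewrite diag_const_mx mulmx1 (mulmx1C QQ).
rewrite exprS IHk {1}AE -[_ * _]/(_ *m _) !mulmxA -(mulmxA _ Q) QQ mulmx1.
rewrite -(mulmxA _ (diag_mx d)) mulmx_diag; congr (_ *m diag_mx _ *m _).
by apply/matrixP => i j; rewrite !ord1 !mxE exprS.
Qed.

Lemma trace_diag_conj p q (h : 'M[R]_(p, q)) (a : 'rV[R]_p) (b : 'rV[R]_q) :
  \tr (h^T *m diag_mx a *m h *m diag_mx b) =
  \sum_x \sum_y h x y ^+ 2 * (a 0 x * b 0 y).
Proof.
rewrite exchange_big; apply: eq_bigr => y _.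
rewrite mul_mx_diag mxE mxE mulr_suml; apply: eq_bigr => x _.
by rewrite mul_mx_diag !mxE; ring.
Qed.

(** Both factors are bounded by powers of the larger absolute value, and since the total exponent is
    even the result is one of the two terms on the right. *)
Lemma mul_pow_le (a b : R) r i j : (i + j = r.*2)%N ->
  a ^+ i * b ^+ j <= a ^+ r.*2 + b ^+ r.*2.
Proof.
move=> ij; pose c := Num.max `|a| `|b|.
have c0 : 0 <= c by rewrite le_max normr_ge0.
have h : a ^+ i * b ^+ j <= c ^+ r.*2.
  apply: le_trans (ler_norm _) _; rewrite normrM !normrX -ij exprD.
  apply: ler_pM; rewrite ?exprn_ge0 //.
    by rewrite lerXn2r ?nnegrE // le_max lexx.
  by rewrite lerXn2r ?nnegrE // le_max lexx orbT.
apply: le_trans h _; rewrite /c.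
have eN (x : R) : `|x| ^+ r.*2 = x ^+ r.*2.
  by rewrite -muln2 mulnC !exprM real_normK ?num_real.
have p0 (x : R) : 0 <= x ^+ r.*2 by rewrite -muln2 exprM sqr_ge0.
case: (leP `|a| `|b|) => _; rewrite eN ?lerDl ?lerDr //.
Qed.

(** In eigenbases of [A] and [B] each trace is a sum of [a 0 x ^+ k * b 0 y ^+ l] with weights
    [h x y ^+ 2], so [mul_pow_le] applies term by term although [A] and [B] do not commute. *)
Lemma trace_mul_pow_le n (H A B : 'M[R]_n) r i j :
  H^T = H -> A^T = A -> B^T = B -> (i + j = r.*2)%N ->
  \tr (H *m A ^+ i *m H *m B ^+ j) <=
  \tr (H *m H *m A ^+ r.*2) + \tr (H *m H *m B ^+ r.*2).
Proof.
move=> sH sA sB ij.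
have [Q [a [QQ AE]]] := sym_spectral sA.
have [P [b [PP BE]]] := sym_spectral sB.
pose h := Q *m H *m P^T.
have E k l : \tr (H *m A ^+ k *m H *m B ^+ l) =
    \sum_x \sum_y h x y ^+ 2 * (a 0 x ^+ k * b 0 y ^+ l).
  rewrite (spectral_pow _ QQ AE) (spectral_pow _ PP BE) !mulmxA mxtrace_mulC.
  have := trace_diag_conj h (\row_x a 0 x ^+ k) (\row_y b 0 y ^+ l).
  rewrite /h !trmx_mul trmxK sH !mulmxA => ->.
  by apply: eq_bigr => x _; apply: eq_bigr => y _; rewrite !mxE.
(* An exponent 0 puts both right-hand traces in the form covered by [E]. *)
have -> : \tr (H *m H *m A ^+ r.*2) = \tr (H *m A ^+ r.*2 *m H *m B ^+ 0).
  by rewrite expr0 mulmx1 -mulmxA mxtrace_mulC.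
have -> : \tr (H *m H *m B ^+ r.*2) = \tr (H *m A ^+ 0 *m H *m B ^+ r.*2).
  by rewrite expr0 mulmx1.
rewrite !E -big_split; apply: ler_sum => x _; rewrite -big_split.
apply: ler_sum => y _ /=; rewrite -mulrDr ler_wpM2l ?sqr_ge0 //.
by rewrite !expr0 mulr1 mul1r mul_pow_le.
Qed.

Lemma subXX_telescope n (A B : 'M[R]_n) q :
  A ^+ q - B ^+ q = \sum_(i < q) A ^+ i *m (A - B) *m B ^+ (q.-1 - i).
Proof.
elim: q => [|q IHq]; first by rewrite !expr0 subrr big_ord0.
rewrite big_ord_recl /= subn0 expr0 mul1mx.
have -> : A ^+ q.+1 - B ^+ q.+1 = (A - B) *m B ^+ q + A *m (A ^+ q - B ^+ q).
  by rewrite mulmxBl mulmxBr [RHS]addrC addrA subrK !exprS.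
congr (_ + _); rewrite IHq mulmx_sumr; apply: eq_bigr => i _.
by rewrite /bump leq0n add1n exprS -[A * _]/(A *m _) !mulmxA -(subn1 q) -subnDA.
Qed.

Lemma trace_pow_ge0 n (A : 'M[R]_n) r : A^T = A -> 0 <= \tr (A ^+ r.*2).
Proof.
move=> sA; rewrite -addnn exprD -[_ * _]/(_ *m _) -{1}sA -trmxX -ip_trace.
exact: ipAA_ge0.
Qed.

Lemma trace_pow n (A Q : 'M[R]_n) (d : 'rV[R]_n) k :
  Q *m Q^T = 1%:M -> A = Q^T *m diag_mx d *m Q ->
  \tr (A ^+ k) = \sum_i d 0 i ^+ k.
Proof.
move=> QQ AE; rewrite (spectral_pow _ QQ AE) mxtrace_mulC mulmxA QQ mul1mx.
by rewrite mxtrace_diag; apply: eq_bigr => i _; rewrite mxE.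
Qed.

(** For [y] a squared eigenvalue, [w * y^(p-1)] is at most [y^p] or at most [w^p], according to
    which of [y] and [w] is larger. This turns a bound of the [2p]-th moment by the [(2p-2)]-nd into
    a closed bound. *)
Lemma trace_pow_young n (A : 'M[R]_n) p (w : R) : A^T = A -> (0 < p)%N ->
  0 <= w ->
  w * \tr (A ^+ p.-1.*2) <= \tr (A ^+ p.*2) + n%:R * w ^+ p.
Proof.
move=> sA p0 w0; have [Q [d [QQ AE]]] := sym_spectral sA.
rewrite !(trace_pow _ QQ AE).
have -> : n%:R * w ^+ p = \sum_(i < n) w ^+ p.
  by rewrite big_const_ord iter_addr_0 mulr_natl.
rewrite mulr_sumr -big_split; apply: ler_sum => i _ /=.
rewrite -!mul2n !exprM.
set y := d 0 i ^+ 2; have y0 : 0 <= y by exact: sqr_ge0.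
case: p p0 => // p _ /=; have [wy|yw] := leP w y.
  rewrite -[leLHS]addr0; apply: lerD; last exact: exprn_ge0.
  by rewrite exprS; apply: ler_wpM2r; first exact: exprn_ge0.
rewrite -[leLHS]add0r; apply: lerD; first exact: exprn_ge0.
rewrite exprS; apply: ler_wpM2l => //.
by rewrite lerXn2r ?nnegrE // ltW.
Qed.

End TracePowers.

(** * Exchangeable pairs and the matrix moment inequality *)

Section MatrixMoment.
Context {R : realType} (I : finType) (m : nat).
Local Notation Omega := {ffun 'I_m -> I}.

Definition resample (w : Omega) (k : 'I_m) (i : I) : Omega :=
  [ffun l => if l == k then i else w l].

(** Swapping coordinate [k] between the two samples is an involution on pairs, so it only permutes
    the terms. This is the exchangeability of the pair. *)
Lemma sum_resample (F : Omega -> Omega -> R) k :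
  \sum_(w : Omega) \sum_(w' : Omega) F (resample w k (w' k)) (resample w' k (w k)) =
  \sum_(w : Omega) \sum_(w' : Omega) F w w'.
Proof.
rewrite !pair_big; symmetry.
pose f (x : Omega * Omega) := (resample x.1 k (x.2 k), resample x.2 k (x.1 k)).
have fK : involutive f.
  move=> [u v]; rewrite /f /=; congr pair; apply/ffunP => l; rewrite !ffunE eqxx;
    by case: eqP => [->|].
by rewrite (reindex_inj (inv_inj fK)).
Qed.

(** Written as a product over all coordinates with factors 1 away from [k], the sum over samples
    becomes a product of sums, one of which vanishes. *)
Lemma sum_coord (g : I -> R) (k : 'I_m) :
  \sum_i g i = 0 -> \sum_(w : Omega) g (w k) = 0.
Proof.
move=> g0; pose F l i := if l == k then g i else 1.
have FE (w : Omega) : g (w k) = \prod_l F l (w l).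
  rewrite (bigD1 k) //= /F eqxx big1 ?mulr1 // => l /negPf ->; by [].
under eq_bigr do rewrite FE.
rewrite -(bigA_distr_bigA F) (bigD1 k) //= /F eqxx g0 mul0r //.
Qed.

Section Centered.
Context (d : nat) (Y : I -> 'M[R]_d).
Hypothesis symY : forall i, (Y i)^T = Y i.
Hypothesis Y0 : \sum_i Y i = 0.

Definition walk (w : Omega) : 'M[R]_d := \sum_k Y (w k).

Lemma tr_walk w : (walk w)^T = walk w.
Proof. by rewrite /walk linear_sum /=; apply: eq_bigr => k _. Qed.

Lemma walk_resample w w' k :
  walk w - walk (resample w k (w' k)) = Y (w k) - Y (w' k).
Proof.
rewrite /walk -sumrB (bigD1 k) //= big1 ?addr0 ?ffunE ?eqxx // => l /negPf lk.
by rewrite ffunE lk subrr.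
Qed.

Let H k (w w' : Omega) := Y (w k) - Y (w' k).

(** The difference of odd powers telescopes into [2p - 1] terms whose exponents add up to [2p - 2],
    which is even as [trace_mul_pow_le] requires. *)
Lemma trace_increment_le k (w w' : Omega) p : (0 < p)%N ->
  \tr (H k w w' *m (walk w ^+ p.*2.-1 - walk (resample w k (w' k)) ^+ p.*2.-1))
  <= p.*2.-1%:R * (\tr (H k w w' *m H k w w' *m walk w ^+ p.-1.*2) +
    \tr (H k w w' *m H k w w' *m walk (resample w k (w' k)) ^+ p.-1.*2)).
Proof.
move=> p0; set u := resample _ _ _; set h := H _ _ _.
rewrite subXX_telescope walk_resample -/(H _ _ _) -/h mulmx_sumr.
rewrite linear_sum /= mulr_natl -[X in _ *+ X]card_ord -sumr_const.
apply: ler_sum => i _; rewrite !mulmxA; apply: trace_mul_pow_le.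
- by rewrite /h /H linearB /= !symY.
- exact: tr_walk.
- exact: tr_walk.
- by case: p p0 i => // p _ i /=; rewrite subnKC // -ltnS.
Qed.

(* [w'] is an independent copy of [w]. Exchanging the [k]-th coordinates of [w]
   and [w'] changes the walk by [H k w w'] only, so the trace of
   [Y (w k) *m walk w ^+ (2 p - 1)] is half the average of a telescoping
   difference of powers. *)
Lemma sum_trace_walk_le p : (0 < p)%N ->
  \sum_(w : Omega) \sum_(w' : Omega) \tr (walk w ^+ p.*2) <=
  p.*2.-1%:R * \sum_(w : Omega) \sum_(w' : Omega) \sum_k
    nrm (walk w ^+ p.-1 *m H k w w') ^+ 2.
Proof.
move=> p0.
have trE w k w' : \tr (H k w w' *m H k w w' *m walk w ^+ p.-1.*2) =
    nrm (walk w ^+ p.-1 *m H k w w') ^+ 2.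
  have sH : (H k w w')^T = H k w w' by rewrite /H linearB /= !symY.
  rewrite nrm_sq ip_trace trmx_mul trmxX tr_walk sH.
  rewrite -addnn exprD -[_ * _]/(_ *m _) [RHS]mxtrace_mulC !mulmxA.
  by rewrite [LHS]mxtrace_mulC !mulmxA mxtrace_mulC !mulmxA.
(* [Y (w' k)] is centred and independent of [walk w], so subtracting it changes nothing on average;
   this replaces [Y (w k)] by the increment [H k w w']. *)
have zero k : \sum_(w : Omega) \sum_(w' : Omega) \tr (Y (w' k) *m walk w ^+ p.*2.-1) = 0.
  apply: big1 => w _; apply: (@sum_coord (fun i => \tr (Y i *m _))).
  by rewrite -linear_sum -mulmx_suml Y0 mul0mx linear0.
have step k : \sum_(w : Omega) \sum_(w' : Omega) \tr (Y (w k) *m walk w ^+ p.*2.-1) <=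
    p.*2.-1%:R * \sum_(w : Omega) \sum_(w' : Omega) nrm (walk w ^+ p.-1 *m H k w w') ^+ 2.
  pose F w w' := \tr (H k w w' *m walk w ^+ p.*2.-1).
  have -> : \sum_(w : Omega) \sum_(w' : Omega) \tr (Y (w k) *m walk w ^+ p.*2.-1) =
      \sum_(w : Omega) \sum_(w' : Omega) F w w'.
    rewrite -[LHS]subr0 -[X in _ - X](zero k) -sumrB; apply: eq_bigr => w _.
    by rewrite -sumrB; apply: eq_bigr => w' _; rewrite -linearB -mulmxBl.
  have F2 : 2 * (\sum_(w : Omega) \sum_(w' : Omega) F w w') =
    \sum_(w : Omega) \sum_(w' : Omega)
      \tr (H k w w' *m (walk w ^+ p.*2.-1
                        - walk (resample w k (w' k)) ^+ p.*2.-1)).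
    rewrite mulr_natl mulr2n -[X in _ + X](sum_resample F k) -big_split.
    apply: eq_bigr => w _; rewrite -big_split; apply: eq_bigr => w' _ /=.
    rewrite mulmxBr linearB /=; congr (_ + _); rewrite /F /H !ffunE eqxx.
    by rewrite -opprB mulNmx linearN.
  rewrite -(ler_pM2l (ltr0n R 2)) F2.
  apply: le_trans (_ : \sum_(w : Omega) \sum_(w' : Omega) p.*2.-1%:R *
    (nrm (walk w ^+ p.-1 *m H k w w') ^+ 2 +
     nrm (walk (resample w k (w' k)) ^+ p.-1 *m
       H k (resample w k (w' k)) (resample w' k (w k))) ^+ 2) <= _).
    apply: ler_sum => w _; apply: ler_sum => w' _.
    apply: le_trans (trace_increment_le _ _ _ p0) _ => /=.
    rewrite -!trE; rewrite ler_wpM2l // lerD2l.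
    suff -> : H k (resample w k (w' k)) (resample w' k (w k)) = - H k w w'.
      by rewrite mulNmx mulmxN opprK.
    by rewrite /H !ffunE eqxx opprB.
  under eq_bigr do rewrite -mulr_sumr big_split /=.
  rewrite -mulr_sumr big_split /= (sum_resample
    (fun w w' => nrm (walk w ^+ p.-1 *m H k w w') ^+ 2) k).
  lra.
have -> : \sum_(w : Omega) \sum_(w' : Omega) \sum_k
      nrm (walk w ^+ p.-1 *m H k w w') ^+ 2 =
    \sum_k \sum_(w : Omega) \sum_(w' : Omega) nrm (walk w ^+ p.-1 *m H k w w') ^+ 2.
  by rewrite [RHS]exchange_big; apply: eq_bigr => w _; rewrite exchange_big.
rewrite mulr_sumr; apply: le_trans (ler_sum _ (fun k _ => step k)).
rewrite [leRHS]exchange_big; apply: ler_sum => w _.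
rewrite [leRHS]exchange_big; apply: ler_sum => w' _.
rewrite -linear_sum -mulmx_suml -/(walk w).
by rewrite -[_ *m _]exprS prednK // double_gt0.
Qed.

End Centered.

(** The proxy [v] bounds the uncentred matrices [Z], because only differences [Y (w k) - Y (w' k)]
    occur and [M] cancels in them. It may depend on the sample, which later allows a proxy
    containing the unknown norm itself, or a random hit count. *)
Theorem matrix_moment d (Z : I -> 'M[R]_d) (M : 'M[R]_d) (v : Omega -> R) p :
  (0 < p)%N -> (0 < #|I|)%N ->
  (forall i, (Z i)^T = Z i) -> \sum_i (Z i - M) = 0 ->
  (forall w, 0 <= v w) ->
  (forall (w : Omega) (x : 'rV[R]_d),
     \sum_k nrm (x *m Z (w k)) ^+ 2 <= v w * nrm x ^+ 2) ->
  \sum_(w : Omega) \tr ((\sum_k (Z (w k) - M)) ^+ p.*2) <=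
  2 * d%:R * (16 * p%:R) ^+ p * \sum_(w : Omega) v w ^+ p.
Proof.
move=> p0 I0 symZ Z0 v0 hv.
have symM : M^T = M.
  have : \sum_i (Z i - M)^T = 0 by rewrite -linear_sum /= Z0 linear0.
  have cI : #|I|%:R != 0 :> R by rewrite pnatr_eq0 -lt0n.
  move: Z0; rewrite sumrB => /eqP; rewrite subr_eq0 => /eqP ZM.
  under eq_bigr do rewrite linearB /= symZ.
  rewrite sumrB ZM => /eqP; rewrite subr_eq0 !sumr_const.
  rewrite -(scaler_nat _ M) -(scaler_nat _ M^T) => /eqP h.
  by rewrite -[RHS](scalerK cI) h scalerK.
pose Y i := Z i - M.
have symY i : (Y i)^T = Y i by rewrite /Y linearB /= symZ symM.
have h1 := sum_trace_walk_le symY Z0 p0.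
pose W (w w' : Omega) := 2 * (v w + v w').
have W0 w w' : 0 <= W w w' by rewrite mulr_ge0 // addr_ge0.
have hW (w w' : Omega) : \sum_k nrm (walk Y w ^+ p.-1 *m (Y (w k) - Y (w' k))) ^+ 2 <=
    W w w' * \tr (walk Y w ^+ p.-1.*2).
  have hx (x : 'rV[R]_d) : \sum_k nrm (x *m (Y (w k) - Y (w' k))) ^+ 2 <=
      W w w' * nrm x ^+ 2.
    apply: le_trans (_ : \sum_k 2 * (nrm (x *m Z (w k)) ^+ 2 +
        nrm (x *m Z (w' k)) ^+ 2) <= _).
      apply: ler_sum => k _; rewrite /Y opprB addrA addrNK mulmxBr.
      rewrite nrmD_sq nrmN ipNr.
      have := sqr_ge0 (nrm (x *m Z (w k) + x *m Z (w' k))); rewrite nrmD_sq.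
      by move=> ?; lra.
    rewrite -mulr_sumr big_split /= /W -mulrA ler_wpM2l // mulrDl.
    by apply: lerD; exact: hv.
  have rows q (A : 'M[R]_(q, d)) : nrm A ^+ 2 = \sum_i nrm (row i A) ^+ 2.
    rewrite nrm_sqE; apply: eq_bigr => i _; rewrite nrm_sqE big_ord1.
    by apply: eq_bigr => j _; rewrite mxE.
  have -> : \tr (walk Y w ^+ p.-1.*2) = nrm (walk Y w ^+ p.-1) ^+ 2.
    by rewrite nrm_sq ip_trace trmxX (tr_walk symY) -addnn exprD.
  rewrite rows mulr_sumr.
  under eq_bigr do rewrite rows.
  rewrite exchange_big; apply: ler_sum => i _.
  by under eq_bigr do rewrite row_mul; exact: hx.
(* [trace_pow_young] with weight [4 p W], where [2 (2p - 1) <= 4p], returns one copy of the moment,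
   which the doubled left-hand side absorbs. *)
have h2 : \sum_(w : Omega) \sum_(w' : Omega) \tr (walk Y w ^+ p.*2) <=
    \sum_(w : Omega) \sum_(w' : Omega) d%:R * (4 * p%:R * W w w') ^+ p.
  suff : 2 * \sum_(w : Omega) \sum_(w' : Omega) \tr (walk Y w ^+ p.*2) <=
      \sum_(w : Omega) \sum_(w' : Omega) \tr (walk Y w ^+ p.*2) +
      \sum_(w : Omega) \sum_(w' : Omega) d%:R * (4 * p%:R * W w w') ^+ p by lra.
  rewrite -big_split.
  apply: le_trans (ler_wpM2l (ler0n _ 2) h1) _.
  rewrite mulrA mulr_sumr; apply: ler_sum => w _; rewrite -big_split mulr_sumr.
  apply: ler_sum => w' _ /=.
  have p4 : 0 <= 4 * p%:R :> R by rewrite mulr_ge0.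
  apply: le_trans (trace_pow_young (tr_walk symY w) p0 (mulr_ge0 p4 (W0 w w'))).
  rewrite -(mulrA (4 * _)); apply: ler_pM.
  - by rewrite mulr_ge0.
  - by apply: sumr_ge0 => k _; exact: sqr_ge0.
  - rewrite -natrM -natrM ler_nat; case: (p) p0 => // q _; rewrite doubleS /=.
    by rewrite -muln2 -ltnS; lia.
  - exact: hW.
have N0 : 0 < #|{: Omega}|%:R :> R.
  by rewrite ltr0n card_ffun card_ord expn_gt0 I0.
rewrite -(ler_pM2l N0); move: h2.
have -> : \sum_(w : Omega) \sum_(w' : Omega) \tr (walk Y w ^+ p.*2) =
    #|{: Omega}|%:R * \sum_(w : Omega) \tr ((\sum_k Y (w k)) ^+ p.*2).
  by rewrite mulr_sumr; apply: eq_bigr => w _; rewrite sumr_const mulr_natl.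
move/le_trans; apply.
have -> : #|{: Omega}|%:R * (2 * d%:R * (16 * p%:R) ^+ p * \sum_w v w ^+ p) =
    \sum_(w : Omega) \sum_(w' : Omega)
      d%:R * (16 * p%:R) ^+ p * (v w ^+ p + v w' ^+ p).
  under [RHS]eq_bigr do rewrite -mulr_sumr big_split /= sumr_const.
  rewrite -mulr_sumr big_split /= sumr_const sumrMnl.
  by rewrite -mulr2n -mulrnA -[X in _ = _ * X]mulr_natl natrM; ring.
apply: ler_sum => w _; apply: ler_sum => w' _; rewrite -[leRHS]mulrA ler_wpM2l //.
(* [4 p W] is [16 p] times the mean of [v w] and [v w'], and the power of a mean is at most the sum
   of the powers. Summing over both samples gives the factor 2 of the conclusion. *)
have -> : 4 * p%:R * W w w' = 16 * p%:R * ((v w + v w') / 2).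
  by rewrite /W; field.
rewrite exprMn ler_wpM2l ?exprn_ge0 ?mulr_ge0 //.
have h x y : 0 <= x -> x <= y -> ((x + y) / 2) ^+ p <= x ^+ p + y ^+ p :> R.
  move=> x0 xy; have y0 := le_trans x0 xy.
  rewrite -[leLHS]add0r lerD ?exprn_ge0 // lerXn2r ?nnegrE //; lra.
have [vv|vv] := leP (v w) (v w'); first exact: h.
by rewrite addrC [leRHS]addrC h // ltW.
Qed.

End MatrixMoment.

(** * Concentration of the sampling operator *)

Section OperatorBound.
Context {R : realType}.

(** [s] is the largest absolute eigenvalue: its even powers appear among the nonnegative summands of
    the trace. The maximum defaults to 0, and there [0 < q] makes the left-hand power 0. *)
Lemma sym_operator_bound n (S : 'M[R]_n) : S^T = S ->
  exists s, [/\ 0 <= s,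
    forall q, (0 < q)%N -> s ^+ q.*2 <= \tr (S ^+ q.*2) &
    forall x : 'rV[R]_n, nrm (x *m S) <= s * nrm x].
Proof.
move=> sS; have [Q [d [QQ SE]]] := sym_spectral sS.
pose s := \big[Num.max/0]_i `|d 0 i|.
have s0 : 0 <= s by apply: bigmax_ge_id.
have ds i : `|d 0 i| <= s by apply: le_bigmax.
have QQ' := mulmx1C QQ.
exists s; split=> // [q q0|x].
  rewrite (trace_pow _ QQ SE).
  have e0 i : 0 <= d 0 i ^+ q.*2 by rewrite -muln2 exprM sqr_ge0.
  have hs : s = 0 \/ exists i, s = `|d 0 i|.
    rewrite /s; elim/big_ind: _ => [|x y hx hy|i _]; first by left.
      by case: (leP x y).
    by right; exists i.
  case: hs => [->|[i ->]].
    by rewrite expr0n double_eq0 eqn0Ngt q0 sumr_ge0.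
  - rewrite (bigD1 i) //= -mul2n !exprM real_normK ?num_real //.
    by rewrite lerDl sumr_ge0 // => j _; rewrite mul2n.
rewrite -(@ler_pXn2r _ 2) ?nnegrE ?mulr_ge0 ?nrm_ge0 // exprMn.
have nQ (y : 'rV[R]_n) : nrm (y *m Q) = nrm y.
  by rewrite /frob_norm ip_mulr -mulmxA QQ mulmx1.
have nQ' (y : 'rV[R]_n) : nrm (y *m Q^T) = nrm y.
  by rewrite /frob_norm ip_mulr trmxK -mulmxA QQ' mulmx1.
rewrite SE !mulmxA nQ -(nQ' x) !nrm_sqE !big_ord1 mulr_sumr.
apply: ler_sum => i _; rewrite mul_mx_diag mxE exprMn mulrC ler_wpM2r ?sqr_ge0 //.
by rewrite -(real_normK (num_real (d 0 i))) lerXn2r ?nnegrE.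
Qed.

End OperatorBound.

(** * Expectation over samples and Chernoff bounds *)

Section Expectation.
Context {R : realType} (I : finType) (m : nat).
Local Notation Omega := {ffun 'I_m -> I}.
Implicit Types f g : Omega -> R.

Definition expect f : R := (\sum_w f w) / (#|I|%:R ^+ m).

Lemma expect_le f g : (forall w, f w <= g w) -> expect f <= expect g.
Proof. by move=> fg; apply: ler_wpM2r; rewrite ?ler_sum // invr_ge0 exprn_ge0. Qed.

Lemma expectD f g : expect (fun w => f w + g w) = expect f + expect g.
Proof. by rewrite /expect big_split mulrDl. Qed.

Lemma expectZ a f : expect (fun w => a * f w) = a * expect f.
Proof. by rewrite /expect -mulr_sumr mulrA. Qed.

Lemma expect_sum (J : finType) (F : J -> Omega -> R) :
  expect (fun w => \sum_j F j w) = \sum_j expect (F j).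
Proof. by rewrite /expect exchange_big mulr_suml. Qed.

Lemma expect_cst a : (0 < #|I|)%N -> expect (fun=> a) = a.
Proof.
move=> I0; rewrite /expect sumr_const card_ffun card_ord -[a *+ _]mulr_natl natrX.
by rewrite mulrAC divff ?mul1r // expf_neq0 // pnatr_eq0 -lt0n.
Qed.

Lemma expect_prod (h : I -> R) :
  expect (fun w => \prod_k h (w k)) = ((\sum_i h i) / #|I|%:R) ^+ m.
Proof.
rewrite /expect -(bigA_distr_bigA (fun _ => h)) prodr_const card_ord.
by rewrite expr_div_n.
Qed.

Definition hits (A : pred I) (w : Omega) : nat := #|[pred k | A (w k)]|.

(** The hits are a sum of independent indicators, so the exponential factors over the draws. Each
    factor averages to [1 + a * (expR t - 1)] with [a] the density of [A], and [1 + x <= expR x]. *)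
Lemma expect_exp_hits (A : pred I) t : (0 < #|I|)%N -> 0 <= t ->
  expect (fun w => expR (t * (hits A w)%:R)) <=
  expR (m%:R * (#|A|%:R / #|I|%:R) * (expR t - 1)).
Proof.
move=> I0 t0; pose h i : R := if A i then expR t else 1.
have hE w : expR (t * (hits A w)%:R) = \prod_k h (w k).
  rewrite /h /hits -big_mkcond /= prodr_const.
  by rewrite mulrC expRM_natl; congr (_ ^+ _); apply: eq_card.
rewrite (_ : expect _ = expect (fun w => \prod_k h (w k))); last first.
  by congr (_ / _); apply: eq_bigr => w _.
rewrite expect_prod.
have cI : 0 < #|I|%:R :> R by rewrite ltr0n.
have -> : (\sum_i h i) / #|I|%:R = 1 + #|A|%:R / #|I|%:R * (expR t - 1).
  have -> : \sum_i h i = #|I|%:R + #|A|%:R * (expR t - 1).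
    have hi i : h i = 1 + (if A i then expR t - 1 else 0).
      by rewrite /h; case: ifP => _; rewrite ?addr0 // addrC subrK.
    under eq_bigr do rewrite hi.
    by rewrite big_split /= -big_mkcond !sumr_const mulr_natl.
  by rewrite mulrDl divff ?gt_eqF // mulrAC.
rewrite -(mulrA m%:R) expRM_natl lerXn2r ?nnegrE ?expR_ge0 ?expR_ge1Dx //.
rewrite addr_ge0 // mulr_ge0 ?divr_ge0 // subr_ge0.
by rewrite -expR0 ler_expR.
Qed.

(** With [K] the mean number of hits, [x ^+ p <= expR (p * x)] at [x = hits / K] reduces the moment
    to the exponential one at [t = p / K]. The hypothesis [2 p <= K] keeps [t <= 1 / 2], where
    [expR t - 1 <= 2 * t]; hence the constant [expR 2]. *)
Lemma expect_hits_pow (A : pred I) p : (0 < #|I|)%N -> (0 < p)%N ->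
  2 * p%:R <= m%:R * (#|A|%:R / #|I|%:R) :> R ->
  expect (fun w => (hits A w)%:R ^+ p) <=
  (expR 2 * (m%:R * (#|A|%:R / #|I|%:R))) ^+ p.
Proof.
move=> I0 p0; set K := m%:R * _ => hK.
have p0' : 0 < p%:R :> R by rewrite ltr0n.
have K0 : 0 < K by apply: lt_le_trans hK; rewrite mulr_gt0.
pose t := p%:R / K.
have t0 : 0 <= t by rewrite divr_ge0 // ltW.
have t2 : t <= 1 / 2 by rewrite /t ler_pdivrMr //; lra.
have et : expR t - 1 <= 2 * t.
  have h : expR t * (1 - t) <= 1.
    rewrite -[leRHS](expRxMexpNx_1 t) ler_wpM2l ?expR_ge0 //.
    exact: expR_ge1Dx.
  have e0 := expR_gt0 t.
  rewrite lerBlDr -(@ler_pM2r _ (1 - t)); last lra.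
  by apply: le_trans h _; nra.
apply: le_trans (_ : K ^+ p * expect (fun w => expR (t * (hits A w)%:R)) <= _).
  rewrite -expectZ; apply: expect_le => w.
  have hN : (hits A w)%:R = K * ((hits A w)%:R / K) :> R.
    by field; rewrite gt_eqF.
  rewrite [in leLHS]hN exprMn ler_wpM2l ?exprn_ge0 ?(ltW K0) //.
  have -> : t * (hits A w)%:R = p%:R * ((hits A w)%:R / K) by rewrite /t; ring.
  rewrite expRM_natl lerXn2r ?nnegrE ?expR_ge0 ?divr_ge0 ?(ltW K0) //.
  by apply: le_trans (expR_ge1Dx _); rewrite lerDr.
rewrite [leRHS]exprMn mulrC ler_wpM2r ?exprn_ge0 ?(ltW K0) //.
apply: le_trans (expect_exp_hits _ I0 t0) _; rewrite -expRM_natl ler_expR -/K.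
apply: le_trans (ler_wpM2l (ltW K0) et) _.
by rewrite /t mulrCA [K * _]mulrC divfK ?gt_eqF // mulrC.
Qed.


End Expectation.

Section Concentration.
Context {R : realType} (I : finType) (m : nat).
Local Notation Omega := {ffun 'I_m -> I}.
Implicit Types (B : Omega -> Prop) (f : Omega -> R).

Definition prob B : R := expect (fun w => `[< B w >]%:R).

Lemma prob_le B B' : (forall w, B w -> B' w) -> prob B <= prob B'.
Proof.
move=> h; apply: expect_le => w; rewrite ler_nat.
by case: asboolP => // /h; case: asboolP.
Qed.

Lemma prob_or B B' : prob (fun w => B w \/ B' w) <= prob B + prob B'.
Proof.
rewrite -expectD; apply: expect_le => w; rewrite -natrD ler_nat.
case: asboolP => // -[] h.
  by case: (asboolP (B w)).
by case: (asboolP (B' w)) => // _; rewrite addn1.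
Qed.

Lemma prob_exists (J : finType) (B : J -> Omega -> Prop) :
  prob (fun w => exists j, B j w) <= \sum_j prob (B j).
Proof.
rewrite -expect_sum; apply: expect_le => w; case: asboolP => [[j Bj]|_].
  by rewrite (bigD1 j) //= (asboolT Bj) lerDl sumr_ge0.
exact: sumr_ge0.
Qed.

Lemma prob_markov B f t : 0 < t -> (forall w, 0 <= f w) ->
  (forall w, B w -> t <= f w) -> prob B <= expect f / t.
Proof.
move=> t0 f0 h; rewrite mulrC -expectZ; apply: expect_le => w.
case: asboolP => [/h tf|_]; last by rewrite mulr_ge0 ?invr_ge0 // ltW.
by rewrite mulrC ler_pdivlMr // mul1r.
Qed.

Lemma mul_rank1 d (x f : 'rV[R]_d) : x *m (f^T *m f) = ip x f *: f.
Proof.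
rewrite mulmxA [x *m f^T]mx11_scalar mul_scalar_mx; congr (_ *: _).
by rewrite ip_trace mxtrace_mulC -trace_mx11 -mxtrace_tr trmx_mul trmxK.
Qed.

Lemma ip_rank1 d (x f : 'rV[R]_d) : ip x (x *m (f^T *m f)) = ip x f ^+ 2.
Proof. by rewrite mul_rank1 ipZr expr2. Qed.

(* The variance proxy of the sampled rank one matrices is itself controlled by
   the norm of their sum, so the moment inequality bounds the moment [T] by
   [K * (2 + T)]. *)
Theorem rank1_concentration d (f : I -> 'rV[R]_d) (rho eps : R) q :
  let c := #|I|%:R / m%:R in
  let K := 2 * d%:R * (32 * q%:R * (c * rho)) ^+ q in
  (0 < #|I|)%N -> (0 < m)%N -> (0 < q)%N -> 0 < eps ->
  (forall i, nrm (f i) ^+ 2 <= rho) ->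
  (forall x, \sum_i ip x (f i) ^+ 2 <= nrm x ^+ 2) ->
  K <= 1 / 2 ->
  prob (fun w => exists x : 'rV[R]_d, eps * nrm x ^+ 2 <
    `|c * \sum_k ip x (f (w k)) ^+ 2 - \sum_i ip x (f i) ^+ 2|) <=
  4 * K / eps ^+ q.*2.
Proof.
move=> c K I0 m0 q0 eps0 hrho hsub K2.
have m0' : 0 < m%:R :> R by rewrite ltr0n.
have I0' : 0 < #|I|%:R :> R by rewrite ltr0n.
have c0 : 0 < c by rewrite divr_gt0.
have rho0 : 0 <= rho.
  by have /card_gt0P[i _] := I0; apply: le_trans (hrho i); exact: sqr_ge0.
pose Z i := c *: ((f i)^T *m f i).
pose G := \sum_i (f i)^T *m f i.
pose M := m%:R^-1 *: G.
pose S (w : Omega) := \sum_k (Z (w k) - M).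
have symZ i : (Z i)^T = Z i by rewrite linearZ /= trmx_mul trmxK.
have symG : G^T = G.
  by rewrite linear_sum /=; apply: eq_bigr => i _; rewrite trmx_mul trmxK.
have Z0 : \sum_i (Z i - M) = 0.
  rewrite sumrB -scaler_sumr -/G sumr_const -scaler_nat scalerA.
  by rewrite /c subrr.
have SE w : S w = c *: (\sum_k (f (w k))^T *m f (w k)) - G.
  rewrite /S sumrB -scaler_sumr sumr_const card_ord -scaler_nat scalerA.
  by rewrite divff ?gt_eqF // scale1r.
have symS w : (S w)^T = S w.
  rewrite SE linearB /= symG linearZ linear_sum /=; congr (_ *: _ - _).
  by apply: eq_bigr => k _; rewrite trmx_mul trmxK.
have ipG (x : 'rV[R]_d) : ip x (x *m G) = \sum_i ip x (f i) ^+ 2.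
  rewrite ipC mulmx_sumr ip_suml; apply: eq_bigr => i _.
  by rewrite ipC ip_rank1.
have ipS w (x : 'rV[R]_d) : ip x (x *m S w) =
    c * \sum_k ip x (f (w k)) ^+ 2 - \sum_i ip x (f i) ^+ 2.
  rewrite SE mulmxBr ipBr ipG -scalemxAr ipZr; congr (_ * _ - _).
  rewrite ipC mulmx_sumr ip_suml; apply: eq_bigr => i _.
  by rewrite ipC ip_rank1.
have [s sP'] := choice (fun w => sym_operator_bound (symS w)).
have sP w : [/\ 0 <= s w,
    forall k, (0 < k)%N -> s w ^+ k.*2 <= \tr (S w ^+ k.*2) &
    forall x : 'rV[R]_d, nrm (x *m S w) <= s w * nrm x] := sP' w.
have s0 w : 0 <= s w by have [h _ _] := sP w.
have sx w (x : 'rV[R]_d) : `|ip x (x *m S w)| <= s w * nrm x ^+ 2.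
  apply: le_trans (cauchy_schwarz _ _) _; rewrite mulrC expr2 mulrA.
  have [_ _ h] := sP w.
  apply: ler_wpM2r; first exact: nrm_ge0. exact: h.
(* One factor [f] of each rank one matrix is bounded through [rho]. What remains,
   [c * \sum_k ip x (f (w k)) ^+ 2], is its mean plus [ip x (x *m S w)], hence at most
   [(1 + s w) * nrm x ^+ 2]. *)
pose v w := c * rho * (1 + s w).
have cr0 : 0 <= c * rho by rewrite mulr_ge0 // ltW.
have v0 w : 0 <= v w by rewrite mulr_ge0 // addr_ge0.
have hv (w : Omega) (x : 'rV[R]_d) : \sum_k nrm (x *m Z (w k)) ^+ 2 <= v w * nrm x ^+ 2.
  apply: le_trans (_ : c * rho * (c * \sum_k ip x (f (w k)) ^+ 2) <= _).
    rewrite !mulr_sumr; apply: ler_sum => k _.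
    rewrite /Z -scalemxAr mul_rank1 scalerA nrmZ exprMn real_normK ?num_real //.
    have h := hrho (w k); set a := ip _ _.
    have -> : c * rho * (c * a ^+ 2) = (c * a) ^+ 2 * rho by ring.
    by rewrite ler_wpM2l ?sqr_ge0.
  rewrite /v -[leRHS]mulrA ler_wpM2l // mulrDl mul1r.
  have -> : c * \sum_k ip x (f (w k)) ^+ 2 =
      \sum_i ip x (f i) ^+ 2 + ip x (x *m S w) by rewrite ipS addrC subrK.
  by apply: lerD => //; apply: le_trans (ler_norm _) (sx w x).
have := matrix_moment q0 I0 symZ Z0 v0 hv.
rewrite -(ler_pM2r (_ : 0 < (#|I|%:R ^+ m)^-1)) ?invr_gt0 ?exprn_gt0 //.
rewrite -[leRHS]mulrA -/(expect _) -/(expect _) -/S.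
set T := expect _ => hT.
(* Half of [1 + s] is at most the larger of 1 and [s], and [s ^+ q <= 1 + s ^+ q.*2] brings back the
   moment being estimated. *)
have Tv : expect (fun w => v w ^+ q) <= (2 * (c * rho)) ^+ q * (2 + T).
  rewrite -[X in _ * (X + _)](@expect_cst R I m 2 I0) -expectD -expectZ.
  apply: expect_le => w; rewrite /v.
  have -> : c * rho * (1 + s w) = 2 * (c * rho) * ((1 + s w) / 2) by field.
  rewrite [leLHS]exprMn ler_wpM2l ?exprn_ge0 ?mulr_ge0 //.
  have [_ /(_ q q0) sq _] := sP w.
  apply: le_trans (_ : 1 + s w ^+ q <= _).
    have [s1|s1] := leP (s w) 1.
      rewrite -[leLHS]addr0 lerD ?exprn_ge0 // exprn_ile1 ?divr_ge0 ?addr_ge0 //.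
      by rewrite ler_pdivrMr //; lra.
    rewrite -[leLHS]add0r lerD // lerXn2r ?nnegrE ?divr_ge0 ?addr_ge0 //.
    by rewrite ler_pdivrMr //; lra.
  have : s w ^+ q <= 1 + s w ^+ q.*2.
    rewrite -muln2 exprM; have := sqr_ge0 (s w ^+ q - 1); nra.
  lra.
have TK : T <= K * (2 + T).
  apply: le_trans hT _; apply: le_trans (ler_wpM2l _ Tv) _.
    by rewrite mulr_ge0 ?exprn_ge0 ?mulr_ge0.
  have E : (32 * q%:R * (c * rho)) ^+ q = (16 * q%:R) ^+ q * (2 * (c * rho)) ^+ q.
    by rewrite -exprMn; congr (_ ^+ _); ring.
  by rewrite /K E !mulrA.
have T0 : 0 <= T.
  rewrite -(@expect_cst R I m 0 I0); apply: expect_le => w.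
  exact: trace_pow_ge0 (symS w).
(* As [K <= 1 / 2], the inequality [T <= K * (2 + T)] solves to [T <= 4 * K]. *)
apply: le_trans (_ : T / eps ^+ q.*2 <= _); last first.
  by rewrite ler_wpM2r ?invr_ge0 ?exprn_ge0 ?(ltW eps0) //; nra.
apply: prob_markov => [|w|w [x]]; first by rewrite exprn_gt0.
  exact: trace_pow_ge0 (symS w).
rewrite -ipS => /lt_le_trans/(_ (sx w x)) h.
have [_ /(_ q q0) sq _] := sP w; apply: le_trans sq.
rewrite lerXn2r ?nnegrE ?(ltW eps0) //.
have [x0|x0] := eqVneq (nrm x ^+ 2) 0; first by rewrite x0 !mulr0 ltxx in h.
rewrite ltr_pM2r in h; first exact: ltW.
by rewrite lt_neqAle eq_sym x0 sqr_ge0.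
Qed.

End Concentration.

(** * Symmetric dilation and the sampled matrix *)

Section Dilation.
Context {R : realType} (n : nat).
Implicit Types A B : 'M[R]_n.

Definition dilation A : 'M[R]_(n + n) := block_mx 0 A A^T 0.

Lemma dilationD A B : dilation (A + B) = dilation A + dilation B.
Proof. by rewrite /dilation add_block_mx !addr0 linearD. Qed.

Lemma dilation0 : dilation 0 = 0.
Proof. by rewrite /dilation trmx0 block_mx0. Qed.

Lemma dilationN A : dilation (- A) = - dilation A.
Proof. by rewrite /dilation opp_block_mx !oppr0 linearN. Qed.

Lemma dilation_sum (I : finType) (F : I -> 'M[R]_n) :
  dilation (\sum_i F i) = \sum_i dilation (F i).
Proof. exact: (big_morph _ dilationD dilation0). Qed.

Lemma tr_dilation A : (dilation A)^T = dilation A.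
Proof. by rewrite /dilation tr_block_mx !trmx0 trmxK. Qed.

Lemma nrm_row_mx (a b : 'rV[R]_n) : nrm (row_mx a b) ^+ 2 = nrm a ^+ 2 + nrm b ^+ 2.
Proof.
rewrite !nrm_sqE !big_ord1 big_split_ord /=.
by congr (_ + _); apply: eq_bigr => i _; rewrite ?row_mxEl ?row_mxEr.
Qed.

Lemma nrm_mul_dilation (a b : 'rV[R]_n) A :
  nrm (row_mx a b *m dilation A) ^+ 2 = nrm (a *m A) ^+ 2 + nrm (b *m A^T) ^+ 2.
Proof.
by rewrite /dilation mul_row_block !mulmx0 addr0 add0r nrm_row_mx addrC.
Qed.

Lemma nrm_mul_delta (a : 'rV[R]_n) c (i j : 'I_n) :
  nrm (a *m (c *: delta_mx i j)) ^+ 2 = c ^+ 2 * a 0 i ^+ 2.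
Proof.
rewrite -scalemxAr nrmZ exprMn real_normK ?num_real //; congr (_ * _).
rewrite nrm_sqE big_ord1 (bigD1 j) //= big1 => [|k kj].
  rewrite addr0 mxE (bigD1 i) //= big1 => [|l li].
    by rewrite addr0 mxE !eqxx mulr1.
  by rewrite mxE (negPf li) mulr0.
rewrite mxE big1 ?expr0n // => l _.
by rewrite mxE (negPf kj) andbF mulr0.
Qed.

End Dilation.

Section Sampling.
Context {R : realType} (n m : nat).
Local Notation pairs := ('I_n * 'I_n)%type.
Local Notation Omega := {ffun 'I_m -> pairs}.

Lemma card_pairs : #|{: pairs}| = (n * n)%N.
Proof. by rewrite card_prod !card_ord. Qed.

Lemma P_OmegaE (w : Omega) (X : 'M[R]_n) :
  P_Omega w X = \sum_k X (w k).1 (w k).2 *: delta_mx (w k).1 (w k).2.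
Proof.
apply/matrixP => i j; rewrite mxE !summxE mulr_sumr; apply: eq_bigr => k _.
rewrite !mxE; case: eqP => [->|_] /=; last by rewrite !mulr0.
by case: eqP => [->|_] /=; rewrite ?mulr0.
Qed.

Lemma matrix_sum_pairs (X : 'M[R]_n) :
  X = \sum_(ij : pairs) X ij.1 ij.2 *: delta_mx ij.1 ij.2.
Proof. by rewrite {1}(matrix_sum_delta X) pair_big. Qed.

(** Rows are tagged [true] and columns [false], so that both form one family of [2 n] sets over
    which a single maximum is taken. *)
Definition on_line (b : bool * 'I_n) : pred pairs :=
  fun ij => (if b.1 then ij.1 else ij.2) == b.2.

Lemma card_on_line b : #|on_line b| = n.
Proof.
case: b => -[] i; rewrite -[RHS]card_ord.
  have inj : injective (fun j : 'I_n => (i, j)) by move=> x y [].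
  rewrite -(fintype.card_image inj).
  apply: eq_card => -[x y]; rewrite unfold_in /=.
  by apply/eqP/fintype.imageP => [<-|[z _ []]//]; exists y.
have inj : injective (fun j : 'I_n => (j, i)) by move=> x y [].
  rewrite -(fintype.card_image inj).
apply: eq_card => -[x y]; rewrite unfold_in /=.
by apply/eqP/fintype.imageP => [<-|[z _ []]//]; exists x.
Qed.

Lemma sum_hits (w : Omega) b (g : 'I_n -> R) :
  \sum_k g (if b then (w k).1 else (w k).2) =
  \sum_i (hits (on_line (b, i)) w)%:R * g i.
Proof.
rewrite (partition_big (fun k => if b then (w k).1 else (w k).2) predT) //=.
apply: eq_bigr => i _; rewrite /hits -sum1_card natr_sum mulr_suml.
by apply: eq_big => [k|k /eqP ->]; rewrite ?mul1r.
Qed.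

(** A dilated entry acts on a pair [a], [b] only through [a 0 i] and [b 0 j], so the variance proxy
    is [(c * xi) ^+ 2] times the largest number of draws in a row or column. A line is hit [m / n]
    times on average, whence the condition [2 q <= m / n] of [expect_hits_pow]. The factor [8 n^2]
    is [2 (n + n)] from the dimension times [2 n] lines. *)
Theorem sampling_concentration (X : 'M[R]_n) (xi t : R) q :
  let c := (n * n)%:R / m%:R in
  (0 < n)%N -> (0 < m)%N -> (0 < q)%N -> 0 < t ->
  (forall i j, `|X i j| <= xi) -> 2 * q%:R <= m%:R / n%:R :> R ->
  prob (fun w : Omega => exists x : 'rV[R]_n,
    t * nrm x < nrm (x *m (c *: P_Omega w X - X))) <=
  8 * n%:R ^+ 2 * (16 * q%:R * ((c * xi) ^+ 2 * (expR 2 * (m%:R / n%:R)))) ^+ q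
    / t ^+ q.*2.
Proof.
move=> c n0 m0 q0 t0 hxi hq.
have n0' : 0 < n%:R :> R by rewrite ltr0n.
have m0' : 0 < m%:R :> R by rewrite ltr0n.
have c0 : 0 <= c by rewrite divr_ge0.
have I0 : (0 < #|{: pairs}|)%N by rewrite card_pairs muln_gt0 n0.
pose D (w : Omega) := c *: P_Omega w X - X.
pose A (ij : pairs) := (c * X ij.1 ij.2) *: (delta_mx ij.1 ij.2 : 'M[R]_n).
pose Z ij := dilation (A ij).
pose M := dilation (m%:R^-1 *: X).
have Z0 : \sum_ij (Z ij - M) = 0.
  under eq_bigr do rewrite -dilationN -dilationD.
  rewrite -dilation_sum sumrB sumr_const card_pairs -scaler_nat scalerA.
  under eq_bigr do rewrite /A -scalerA.
  by rewrite -scaler_sumr -matrix_sum_pairs subrr dilation0.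
have SE (w : Omega) : \sum_k (Z (w k) - M) = dilation (D w).
  under eq_bigr do rewrite -dilationN -dilationD.
  rewrite -dilation_sum sumrB sumr_const card_ord -scaler_nat scalerA.
  rewrite divff ?gt_eqF // scale1r /D P_OmegaE scaler_sumr.
  by under [in RHS]eq_bigr do rewrite scalerA.
pose V (w : Omega) : R := \big[Num.max/0]_b (hits (on_line b) w)%:R.
have V0 w : 0 <= V w by apply: bigmax_ge_id.
have hV b w : (hits (on_line b) w)%:R <= V w by apply: le_bigmax.
pose v w := (c * xi) ^+ 2 * V w.
have v0 w : 0 <= v w by rewrite mulr_ge0 ?sqr_ge0.
have hv (w : Omega) (x : 'rV[R]_(n + n)) :
    \sum_k nrm (x *m Z (w k)) ^+ 2 <= v w * nrm x ^+ 2.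
  rewrite -(hsubmxK x); set a := lsubmx x; set b := rsubmx x.
  apply: le_trans (_ : (c * xi) ^+ 2 * (\sum_k a 0 (w k).1 ^+ 2 +
      \sum_k b 0 (w k).2 ^+ 2) <= _).
    rewrite -big_split mulr_sumr; apply: ler_sum => k _ /=.
    have AT c' i j : (c' *: delta_mx i j : 'M[R]_n)^T = c' *: delta_mx j i.
      by apply/matrixP => i' j'; rewrite !mxE andbC.
    rewrite nrm_mul_dilation /A AT !nrm_mul_delta -mulrDr.
    rewrite ler_wpM2r ?addr_ge0 ?sqr_ge0 // !exprMn ler_wpM2l ?sqr_ge0 //.
    rewrite -(real_normK (num_real (X _ _))) lerXn2r ?nnegrE //.
    by apply: le_trans (hxi (w k).1 (w k).2).
  rewrite /v -mulrA ler_wpM2l ?sqr_ge0 // nrm_row_mx !nrm_sqE !big_ord1.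
  rewrite (sum_hits w true (fun i => a 0 i ^+ 2)).
  rewrite (sum_hits w false (fun i => b 0 i ^+ 2)).
  rewrite mulrDr !mulr_sumr.
  by apply: lerD; apply: ler_sum => i _; rewrite ler_wpM2r ?sqr_ge0.
have symZ ij : (Z ij)^T = Z ij by exact: tr_dilation.
have := matrix_moment q0 I0 symZ Z0 v0 hv.
rewrite -(ler_pM2r (_ : 0 < (#|{: pairs}|%:R ^+ m)^-1)); last first.
  by rewrite invr_gt0 exprn_gt0 // ltr0n.
rewrite -[leRHS]mulrA -/(expect _) -/(expect _).
set T := expect _ => hT.
have Vq w : V w ^+ q <= \sum_b (hits (on_line b) w)%:R ^+ q.
  have hs : V w = 0 \/ exists b, V w = (hits (on_line b) w)%:R.
    rewrite /V; elim/big_ind: _ => [|x y hx hy|b _]; first by left.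
      by case: (leP x y).
    by right; exists b.
  case: hs => [->|[b ->]].
    by rewrite expr0n eqn0Ngt q0 sumr_ge0 // => b _; rewrite exprn_ge0.
  by rewrite (bigD1 b) //= lerDl sumr_ge0 // => j _; rewrite exprn_ge0.
have cl b : #|on_line b|%:R / #|{: pairs}|%:R = n%:R^-1 :> R.
  rewrite card_on_line card_pairs natrM invfM mulrA divff ?mul1r //.
  by rewrite gt_eqF.
have EV : expect (fun w => v w ^+ q) <= ((c * xi) ^+ 2) ^+ q * ((2 * n)%:R *
    (expR 2 * (m%:R / n%:R)) ^+ q).
  apply: le_trans (_ : expect (fun w => ((c * xi) ^+ 2) ^+ q *
      \sum_b (hits (on_line b) w)%:R ^+ q) <= _).
    apply: expect_le => w; rewrite /v [leLHS]exprMn.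
    by rewrite ler_wpM2l // (exprn_ge0 q (sqr_ge0 _)).
  rewrite expectZ expect_sum ler_wpM2l ?(exprn_ge0 q (sqr_ge0 _)) //.
  have -> : (2 * n)%:R * (expR 2 * (m%:R / n%:R)) ^+ q =
      \sum_(b : bool * 'I_n) (expR 2 * (m%:R / n%:R)) ^+ q :> R.
    by rewrite sumr_const card_prod card_bool card_ord mulr_natl.
  apply: ler_sum => b _; rewrite -(cl b); apply: expect_hits_pow => //.
  by rewrite cl.
apply: le_trans (_ : T / t ^+ q.*2 <= _); last first.
  rewrite ler_wpM2r ?invr_ge0 ?exprn_ge0 ?(ltW t0) //.
  apply: le_trans hT _; apply: le_trans (ler_wpM2l _ EV) _.
    by rewrite mulr_ge0 ?exprn_ge0 ?mulr_ge0.
  have E (a b b' : R) : (a * (b * b')) ^+ q = a ^+ q * (b ^+ q * b' ^+ q).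
    by rewrite !exprMn.
  rewrite (E (16 * q%:R) ((c * xi) ^+ 2)) natrD natrM.
  rewrite le_eqVlt; apply/orP; left; apply/eqP.
  set u := _ ^+ q; set u' := (expR _ * _) ^+ q; set u'' := _ ^+ q.
  by ring.
apply: prob_markov => [|w|w [x]]; first by rewrite exprn_gt0.
  by rewrite SE; exact: trace_pow_ge0 (tr_dilation _).
rewrite SE => h.
have [s [s0 /(_ q q0) sq sx]] := sym_operator_bound (tr_dilation (D w)).
apply: le_trans sq; rewrite lerXn2r ?nnegrE ?(ltW t0) //.
(* Padding [x] with a zero block recovers the action of [D w] from that of its dilation. *)
have {}sx : nrm (row_mx x 0 *m dilation (D w)) ^+ 2 <=
    (s * nrm (row_mx x (0 : 'rV[R]_n))) ^+ 2.
  by rewrite lerXn2r ?nnegrE ?mulr_ge0 ?nrm_ge0.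
move: sx; rewrite exprMn nrm_mul_dilation nrm_row_mx mul0mx !nrm0 expr0n !addr0.
rewrite -exprMn ler_pXn2r ?nnegrE ?mulr_ge0 ?nrm_ge0 // => /(lt_le_trans h).
have [x0|x0] := eqVneq (nrm x) 0; first by rewrite x0 !mulr0 ltxx.
rewrite ltr_pM2r; first exact: ltW.
by rewrite lt_neqAle eq_sym x0 nrm_ge0.
Qed.

(** A Chernoff bound at exponent 1/2 for each of the [n^2] cells: the mean [m / n^2] is at most 1
    and [expR (1 / 2) - 1 <= 1]. *)
Theorem multiplicity_bound (L : R) : (0 < n)%N -> (m <= n ^ 2)%N ->
  prob (fun w : Omega => exists i j : 'I_n,
    L < (\sum_k delta_mx (w k).1 (w k).2 : 'M[R]_n) i j) <=
  n%:R ^+ 2 * expR (1 - L / 2).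
Proof.
move=> n0 mn.
have n0' : 0 < n%:R :> R by rewrite ltr0n.
have I0 : (0 < #|{: pairs}|)%N by rewrite card_pairs muln_gt0 n0.
apply: le_trans (_ : prob (fun w : Omega => exists ij : pairs,
    L < (hits (pred1 ij) w)%:R) <= _).
  apply: prob_le => w [i [j h]]; exists (i, j).
  move: h; rewrite summxE /hits -sum1_card natr_sum.
  rewrite [in X in _ -> X]big_mkcond /=.
  congr (_ < _); apply: eq_bigr => k _; rewrite mxE unfold_in /=.
  by case: (w k) => a b /=; rewrite xpair_eqE !(eq_sym _ i) !(eq_sym _ j); case: andb.
apply: le_trans (prob_exists _) _.
have -> : n%:R ^+ 2 * expR (1 - L / 2) =
    \sum_(ij : pairs) expR (1 - L / 2) :> R.
  by rewrite sumr_const card_pairs -[RHS]mulr_natl natrM.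
apply: ler_sum => ij _.
apply: le_trans (_ : expect (fun w : Omega =>
    expR (1 / 2 * (hits (pred1 ij) w)%:R)) / expR (L / 2) <= _).
  apply: prob_markov => [|w|w h]; rewrite ?expR_gt0 ?expR_ge0 //.
  by rewrite ler_expR; lra.
rewrite expRD expRN ler_wpM2r ?invr_ge0 ?expR_ge0 //.
apply: le_trans (@expect_exp_hits R _ m (pred1 ij) (1 / 2) I0 _) _; first lra.
rewrite ler_expR card1 card_pairs mulrA mulr1.
have h : m%:R / (n * n)%:R <= 1 :> R.
  by rewrite ler_pdivrMr ?ltr0n ?muln_gt0 ?n0 // mul1r ler_nat mulnn.
have e2 : 0 <= expR (1 / 2 : R) - 1 <= 1.
  have := expR_ge1Dx (1 / 2 : R); have := expR_ge1Dx (- (1 / 2) : R).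
  have := expRxMexpNx_1 (1 / 2 : R); have := expR_gt0 (1 / 2 : R).
  by move=> *; apply/andP; split; nra.
case/andP: e2 => e20 e21.
by apply: le_trans (ler_wpM2r e20 h) _; rewrite [leLHS]mul1r.
Qed.

End Sampling.

(** * Tangent spaces and their perturbation *)

Section Projections.
Context {R : realType}.

Definition orthoproj n (P : 'M[R]_n) := P^T = P /\ P *m P = P.

Lemma orthoprojC n (P : 'M[R]_n) : orthoproj P -> orthoproj (1%:M - P).
Proof.
case=> sP PP; split; first by rewrite linearB /= trmx1 sP.
by rewrite mulmxBl mul1mx mulmxBr mulmx1 PP subrr subr0.
Qed.

Lemma ip_orthoproj n q (P : 'M[R]_n) (A : 'M[R]_(n, q)) : orthoproj P ->
  ip (P *m A) A = nrm (P *m A) ^+ 2.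
Proof. by case=> sP PP; rewrite nrm_sq ip_mull sP ip_mull sP mulmxA PP. Qed.

Lemma nrm_orthoproj_split n q (P : 'M[R]_n) (A : 'M[R]_(n, q)) : orthoproj P ->
  nrm A ^+ 2 = nrm (P *m A) ^+ 2 + nrm ((1%:M - P) *m A) ^+ 2.
Proof.
move=> hP; rewrite -(ip_orthoproj _ hP) -(ip_orthoproj _ (orthoprojC hP)).
by rewrite -ipDl -mulmxDl addrC subrK mul1mx nrm_sq.
Qed.

Lemma nrm_orthoproj_mull n q (P : 'M[R]_n) (A : 'M[R]_(n, q)) : orthoproj P ->
  nrm (P *m A) <= nrm A.
Proof.
move=> hP; rewrite -(@ler_pXn2r _ 2) ?nnegrE ?nrm_ge0 //.
by rewrite (nrm_orthoproj_split A hP) lerDl sqr_ge0.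
Qed.

Lemma nrm_orthoproj_mulr n q (P : 'M[R]_n) (A : 'M[R]_(q, n)) : orthoproj P ->
  nrm (A *m P) <= nrm A.
Proof.
by move=> hP; rewrite -nrm_tr trmx_mul -[leRHS]nrm_tr hP.1 nrm_orthoproj_mull.
Qed.

Lemma nrmM p q k (A : 'M[R]_(p, q)) (B : 'M[R]_(q, k)) :
  nrm (A *m B) <= nrm A * nrm B.
Proof.
rewrite -(@ler_pXn2r _ 2) ?nnegrE ?mulr_ge0 ?nrm_ge0 // exprMn.
rewrite nrm_sqE (nrm_sqE A) mulr_suml; apply: ler_sum => i _.
rewrite -[nrm B]nrm_tr nrm_sqE mulr_sumr; apply: ler_sum => j _.
have e1 : (A *m B) i j = ip (row i A) (row j B^T).
  by rewrite mxE /frob_inner big_ord1; apply: eq_bigr => l _; rewrite !mxE.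
have rowE q' (v : 'rV[R]_q') : \sum_l v 0 l ^+ 2 = nrm v ^+ 2.
  by rewrite nrm_sqE big_ord1.
have -> : \sum_l A i l ^+ 2 = nrm (row i A) ^+ 2.
  by rewrite -rowE; apply: eq_bigr => l _; rewrite mxE.
have -> : \sum_l B^T j l ^+ 2 = nrm (row j B^T) ^+ 2.
  by rewrite -rowE; apply: eq_bigr => l _; rewrite [in RHS]mxE.
rewrite e1 -exprMn -real_normK ?num_real // lerXn2r ?nnegrE ?mulr_ge0 ?nrm_ge0 //.
exact: cauchy_schwarz.
Qed.

(** In a full rank factorization [P = C *m D], idempotence cancels to [D *m C = 1], and the trace is
    cyclic. *)
Lemma mxtrace_idempotent n (P : 'M[R]_n) : P *m P = P -> \tr P = (\rank P)%:R.
Proof.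
move=> PP; have CR := mulmx_base P.
have /row_fullP[B BC] := col_base_full P.
have /row_freeP[B' RB] := row_base_free P.
move: CR BC RB; move: (col_base P) (row_base P) => C D CD BC DB.
suff DC : D *m C = 1%:M by rewrite -{1}CD mxtrace_mulC DC mxtrace1.
have : C *m D *m (C *m D) = C *m D by rewrite CD PP.
move/(congr1 (fun A => B *m A *m B')) => /=.
by rewrite !mulmxA BC !mul1mx -!mulmxA DB mulmx1.
Qed.

(** Makes the choice in [orth_proj] computable. For uniqueness, the difference of another candidate
    and [T Z] is fixed by [T] and orthogonal to itself. *)
Lemma orth_projE p q (S : set 'M[R]_(p, q)) (T : 'M[R]_(p, q) -> 'M[R]_(p, q)) Z :
  (forall Z, S (T Z)) -> (forall W, S W -> T W = W) ->
  (forall A B, T (A - B) = T A - T B) ->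
  (forall Z W, ip (Z - T Z) (T W) = 0) -> orth_proj S Z = T Z.
Proof.
move=> ST TS TB Tip; apply: xget_unique.
  by split=> // W /TS <-; exact: Tip.
move=> Y [SY hY]; apply/eqP; rewrite -subr_eq0; apply/eqP/nrm_eq0/eqP.
have TN : T (Y - T Z) = Y - T Z by rewrite TB (TS _ SY) (TS _ (ST Z)).
rewrite -sqrf_eq0 nrm_sq -{2}TN; apply/eqP.
have := hY (T (Y - T Z)) (ST _); have := Tip Z (Y - T Z).
by rewrite !ipBl => h1 h2; lra.
Qed.

End Projections.

(** * Pseudoinverses and the perturbation of ranges *)

Section Pinv.
Context {R : realType} (n : nat).
Implicit Types X Y G H B : 'M[R]_n.

(* [G] is the Moore-Penrose inverse of [X], and [sigma] bounds the nonzero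
   singular values of [X] from below. *)
Definition is_pinv X G (sigma : R) : Prop :=
  [/\ X *m G *m X = X, G *m X *m G = G, (X *m G)^T = X *m G, (G *m X)^T = G *m X &
      forall B, nrm (B *m G) <= nrm B / sigma /\ nrm (G *m B) <= nrm B / sigma].

Lemma is_pinv_tr X G s : is_pinv X G s -> is_pinv X^T G^T s.
Proof.
case=> h1 h2 h3 h4 h5; split.
- by rewrite -!trmx_mul mulmxA h1.
- by rewrite -!trmx_mul mulmxA h2.
- by rewrite -trmx_mul h4.
- by rewrite -trmx_mul h3.
- move=> B; have [a b] := h5 B^T.
  by rewrite -nrm_tr trmx_mul trmxK -[nrm B]nrm_tr -[nrm (_ *m B)]nrm_tr trmx_mul trmxK.
Qed.

Lemma pinv_left X G s : is_pinv X G s -> orthoproj (X *m G).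
Proof. by case=> h1 h2 h3 h4 h5; split; rewrite // mulmxA h1. Qed.

Lemma pinv_right X G s : is_pinv X G s -> orthoproj (G *m X).
Proof. by case=> h1 h2 h3 h4 h5; split; rewrite // mulmxA h2. Qed.

Section Perturbation.
Variables (X Y G H : 'M[R]_n) (s s' : R).
Hypotheses (hX : is_pinv X G s) (hY : is_pinv Y H s').

(** [1 - Y *m H] annihilates [Y], so [X *m G] may be replaced by [(X - Y) *m G], and multiplication
    by [G] costs [1 / s]. *)
Lemma pinv_cross : nrm ((1%:M - Y *m H) *m (X *m G)) <= nrm (X - Y) / s.
Proof.
have -> : (1%:M - Y *m H) *m (X *m G) = (1%:M - Y *m H) *m ((X - Y) *m G).
  have YY : (1%:M - Y *m H) *m Y = 0.
    by rewrite mulmxBl mul1mx; case: hY => -> *; rewrite subrr.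
  by rewrite (mulmxBl X Y G) mulmxBr (mulmxA _ Y G) YY mul0mx subr0.
apply: le_trans (nrm_orthoproj_mull _ (orthoprojC (pinv_left hY))) _.
by case: hX => _ _ _ _ /(_ (X - Y))[].
Qed.

(** In [X *m G *m X] the left complement turns the first [X] into [X - Y] and the right complement
    the last one. Two small factors separated by [G] make the bound quadratic. *)
Lemma tangent_residual :
  nrm ((1%:M - Y *m H) *m X *m (1%:M - H *m Y)) <= nrm (X - Y) ^+ 2 / s.
Proof.
have -> : (1%:M - Y *m H) *m X *m (1%:M - H *m Y) =
    (1%:M - Y *m H) *m ((X - Y) *m G *m (X - Y)) *m (1%:M - H *m Y).
  have YY : (1%:M - Y *m H) *m Y = 0.
    by rewrite mulmxBl mul1mx; case: hY => -> *; rewrite subrr.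
  have YY' : Y *m (1%:M - H *m Y) = 0.
    by rewrite mulmxBr mulmx1 mulmxA; case: hY => -> *; rewrite subrr.
  have ea : (1%:M - Y *m H) *m (X - Y) = (1%:M - Y *m H) *m X.
    by rewrite mulmxBr YY subr0.
  have eb : (X - Y) *m (1%:M - H *m Y) = X *m (1%:M - H *m Y).
    by rewrite mulmxBl YY' subr0.
  have XGX : X *m G *m X = X by case: hX.
  transitivity ((1%:M - Y *m H) *m X *m G *m (X *m (1%:M - H *m Y))).
    by rewrite -{1}XGX !mulmxA.
  by rewrite -ea -eb !mulmxA.
apply: le_trans (nrm_orthoproj_mulr _ (orthoprojC (pinv_right hY))) _.
apply: le_trans (nrm_orthoproj_mull _ (orthoprojC (pinv_left hY))) _.
apply: le_trans (nrmM _ _) _.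
rewrite expr2 mulrAC ler_wpM2r ?nrm_ge0 //.
by case: hX => _ _ _ _ /(_ (X - Y))[].
Qed.

End Perturbation.

(** A difference [P - P'] of projections equals [(1 - P') P] minus the transpose of [(1 - P) P'],
    and [pinv_cross] bounds both terms, once with each matrix in the role of [X]. *)
Lemma pinv_left_diff X Y G H s s' : is_pinv X G s -> is_pinv Y H s' ->
  nrm (X *m G - Y *m H) <= nrm (X - Y) / s + nrm (X - Y) / s'.
Proof.
move=> hX hY; have h1 := pinv_cross hX hY; have h2 := pinv_cross hY hX.
have -> : X *m G - Y *m H = (1%:M - Y *m H) *m (X *m G) -
    ((1%:M - X *m G) *m (Y *m H))^T.
  have [sX _] := orthoprojC (pinv_left hX); have [sY _] := pinv_left hY.
  rewrite trmx_mul sX sY mulmxBl mulmxBr mul1mx mulmx1.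
  by rewrite opprB addrA subrK.
apply: le_trans (nrmD _ _) _; rewrite nrmN nrm_tr.
by rewrite nrmB in h2; exact: lerD.
Qed.

Lemma pinv_right_diff X Y G H s s' : is_pinv X G s -> is_pinv Y H s' ->
  nrm (G *m X - H *m Y) <= nrm (X - Y) / s + nrm (X - Y) / s'.
Proof.
move=> hX hY; have := pinv_left_diff (is_pinv_tr hX) (is_pinv_tr hY).
by rewrite -!trmx_mul -!linearB /= !nrm_tr.
Qed.

End Pinv.

Section TangentProjection.
Context {R : realType} (n : nat).
Implicit Types P Q Z : 'M[R]_n.

(** For [P] and [Q] the projections onto the column and row spaces of a matrix, this is the
    projection onto its tangent space ([proj_tangentE]). Written by complements, its
    self-adjointness and idempotence reduce to those of [1 - P] and [1 - Q]. *)
Definition tanp P Q Z := Z - (1%:M - P) *m Z *m (1%:M - Q).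

Lemma tanpD P Q Z Z' : tanp P Q (Z + Z') = tanp P Q Z + tanp P Q Z'.
Proof. by rewrite /tanp (mulmxDr _ Z) (mulmxDl (_ *m Z)) opprD addrACA. Qed.

Lemma tanpZ P Q a Z : tanp P Q (a *: Z) = a *: tanp P Q Z.
Proof. by rewrite /tanp -scalemxAr -scalemxAl scalerBr. Qed.

Lemma tanpN P Q Z : tanp P Q (- Z) = - tanp P Q Z.
Proof. by rewrite -scaleN1r tanpZ scaleN1r. Qed.

Lemma tanpB P Q Z Z' : tanp P Q (Z - Z') = tanp P Q Z - tanp P Q Z'.
Proof. by rewrite tanpD tanpN. Qed.

Lemma tanpE P Q Z : tanp P Q Z = P *m Z + (1%:M - P) *m Z *m Q.
Proof.
have -> : P *m Z = Z - (1%:M - P) *m Z.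
  by rewrite mulmxBl mul1mx opprB addrC subrK.
by rewrite /tanp mulmxBr mulmx1 opprB addrA addrAC.
Qed.

Section Ortho.
Variables (P Q : 'M[R]_n).
Hypotheses (hP : orthoproj P) (hQ : orthoproj Q).

Lemma tanpK Z : tanp P Q (tanp P Q Z) = tanp P Q Z.
Proof.
have [_ P2] := orthoprojC hP; have [_ Q2] := orthoprojC hQ.
rewrite {2}/tanp tanpB -[RHS]subr0; congr (_ - _).
by rewrite /tanp !mulmxA P2 -!mulmxA Q2 subrr.
Qed.

Lemma ip_tanp Z W : ip (tanp P Q Z) W = ip Z (tanp P Q W).
Proof.
have [sP _] := orthoprojC hP; have [sQ _] := orthoprojC hQ.
by rewrite /tanp ipBl ipBr ip_mulr sQ ip_mull sP mulmxA.
Qed.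

Lemma ip_tanp_res Z W : ip (Z - tanp P Q Z) (tanp P Q W) = 0.
Proof. by rewrite -ip_tanp tanpB tanpK subrr ip0l. Qed.

Lemma nrm_tanp_split Z :
  nrm Z ^+ 2 = nrm (tanp P Q Z) ^+ 2 + nrm (Z - tanp P Q Z) ^+ 2.
Proof.
by have := nrmD_sq (Z - tanp P Q Z) (tanp P Q Z); rewrite subrK ip_tanp_res => ->;
  ring.
Qed.

Lemma nrm_tanp Z : nrm (tanp P Q Z) <= nrm Z.
Proof.
rewrite -(@ler_pXn2r _ 2) ?nnegrE ?nrm_ge0 //.
by rewrite (nrm_tanp_split Z) lerDl sqr_ge0.
Qed.

(** [tanpE] splits the image into two orthogonal parts of rank at most one, whose norms are at most
    the incoherence quantities [nrm (P *m e)] and [nrm (Q *m e')]. *)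
Lemma nrm_tanp_delta (rho : R) (i j : 'I_n) :
  nrm (P *m delta_mx i 0 : 'cV_n) ^+ 2 <= rho ->
  nrm (Q *m delta_mx j 0 : 'cV_n) ^+ 2 <= rho ->
  nrm (tanp P Q (delta_mx i j)) ^+ 2 <= 2 * rho.
Proof.
move=> hi hj; rewrite tanpE.
set e : 'cV[R]_n := delta_mx i 0; set e' : 'cV[R]_n := delta_mx j 0.
have dE : delta_mx i j = e *m e'^T by rewrite trmx_delta mul_delta_mx.
have ne (k : 'I_n) : nrm (delta_mx k 0 : 'cV[R]_n) = 1.
  rewrite /frob_norm /frob_inner (bigD1 k) //= big_ord1 mxE !eqxx mulr1.
  rewrite big1 ?addr0 ?sqrtr1 // => l lk; rewrite big_ord1 mxE (negPf lk) mul0r //.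
have ip0 : ip (P *m delta_mx i j) ((1%:M - P) *m delta_mx i j *m Q) = 0.
  rewrite ip_mull -!mulmxA mulmxA hP.1 mulmxBr mulmx1 hP.2 subrr mul0mx.
  by rewrite ip0r.
rewrite nrmD_sq ip0 mulr0 addr0 dE.
have b1 : nrm (P *m (e *m e'^T)) <= nrm (P *m e).
  by rewrite mulmxA; apply: le_trans (nrmM _ _) _; rewrite nrm_tr ne mulr1.
have b2 : nrm ((1%:M - P) *m (e *m e'^T) *m Q) <= nrm (Q *m e').
  rewrite mulmxA -[X in _ *m X]hQ.1 -(mulmxA _ e'^T) -trmx_mul.
  apply: le_trans (nrmM _ _) _; rewrite nrm_tr ler_piMl ?nrm_ge0 //.
  by apply: le_trans (nrm_orthoproj_mull _ (orthoprojC hP)) _; rewrite ne.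
have b1' : nrm (P *m (e *m e'^T)) ^+ 2 <= nrm (P *m e) ^+ 2.
  by rewrite lerXn2r ?nnegrE ?nrm_ge0.
have b2' : nrm ((1%:M - P) *m (e *m e'^T) *m Q) ^+ 2 <= nrm (Q *m e') ^+ 2.
  by rewrite lerXn2r ?nnegrE ?nrm_ge0.
lra.
Qed.

End Ortho.

(** Exchanging one projection at a time leaves in each term a single difference next to a
    contraction, [1 - Q] or [1 - P']. *)
Lemma tanp_diff P Q P' Q' d Z :
  orthoproj P' -> orthoproj Q -> nrm (P - P') <= d -> nrm (Q - Q') <= d ->
  nrm (tanp P Q Z - tanp P' Q' Z) <= 2 * d * nrm Z.
Proof.
move=> hP' hQ dP dQ.
have -> : tanp P Q Z - tanp P' Q' Z =
    (P - P') *m Z *m (1%:M - Q) + (1%:M - P') *m Z *m (Q - Q').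
  rewrite /tanp !mulmxBl !mulmxBr !mulmx1 !mul1mx.
  rewrite ?mulmxBl.
  apply/matrixP => i j; rewrite !mxE; ring.
apply: le_trans (nrmD _ _) _.
have h1 : nrm ((P - P') *m Z *m (1%:M - Q)) <= d * nrm Z.
  apply: le_trans (nrm_orthoproj_mulr _ (orthoprojC hQ)) _.
  by apply: le_trans (nrmM _ _) _; rewrite ler_wpM2r ?nrm_ge0.
have h2 : nrm ((1%:M - P') *m Z *m (Q - Q')) <= d * nrm Z.
  rewrite -mulmxA; apply: le_trans (nrm_orthoproj_mull _ (orthoprojC hP')) _.
  by apply: le_trans (nrmM _ _) _; rewrite mulrC ler_wpM2r ?nrm_ge0.
lra.
Qed.

End TangentProjection.

(** * Singular values and truncation *)

Section GramSpectrum.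
Context {R : realType} (n : nat) (X O : 'M[R]_n) (d : 'rV[R]_n).
Hypotheses (OO : O *m O^T = 1%:M) (XX : X^T *m X = O^T *m diag_mx d *m O).

Let OO' : O^T *m O = 1%:M := mulmx1C OO.

Lemma nrm_mul_orthogonal q (B : 'M[R]_(q, n)) : nrm (B *m O^T) = nrm B.
Proof. by rewrite /frob_norm ip_mulr trmxK -mulmxA OO' mulmx1. Qed.

Lemma gram_form q (B : 'M[R]_(n, q)) (e : 'rV[R]_n) :
  ip B (O^T *m diag_mx e *m O *m B) = \sum_i e 0 i * nrm (row i (O *m B)) ^+ 2.
Proof.
rewrite -!mulmxA ipC ip_mull trmxK; rewrite /frob_inner; apply: eq_bigr => i _.
rewrite nrm_sqE big_ord1 mulr_sumr; apply: eq_bigr => j _.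
by rewrite mul_diag_mx !mxE; ring.
Qed.

Lemma nrm_gram q (B : 'M[R]_(n, q)) :
  nrm (X *m B) ^+ 2 = \sum_i d 0 i * nrm (row i (O *m B)) ^+ 2.
Proof. by rewrite nrm_sq ip_mull mulmxA XX gram_form. Qed.

Lemma nrm_rows q (B : 'M[R]_(n, q)) :
  nrm B ^+ 2 = \sum_i nrm (row i (O *m B)) ^+ 2.
Proof.
have <- : nrm (O *m B) = nrm B.
  by rewrite -nrm_tr trmx_mul nrm_mul_orthogonal nrm_tr.
rewrite nrm_sqE; apply: eq_bigr => i _; rewrite nrm_sqE big_ord1.
by apply: eq_bigr => j _; rewrite [in RHS]mxE.
Qed.

Lemma gram_ge0 i : 0 <= d 0 i.
Proof.
have : d 0 i = nrm (X *m O^T *m delta_mx i 0 : 'cV_n) ^+ 2.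
  rewrite -mulmxA nrm_gram mulmxA OO mul1mx (bigD1 i) //= big1 => [|j ji].
    rewrite addr0 nrm_sqE big_ord1 big_ord1 !mxE !eqxx expr1n mulr1 //.
  by rewrite nrm_sqE big_ord1 big_ord1 !mxE (negPf ji) expr0n mulr0.
by move=> ->; exact: sqr_ge0.
Qed.

Lemma singular_valueP s :
  singular_value X s <-> 0 <= s /\ exists i, d 0 i = s ^+ 2.
Proof.
split=> -[s0 h]; split=> //.
  move/eigenvalueP: h => [v vX v0].
  have h j : (v *m O^T) 0 j * (d 0 j - s ^+ 2) = 0.
    have := congr1 (fun u => (u *m O^T) 0 j) vX.
    rewrite XX !mulmxA -(mulmxA _ O O^T) OO mulmx1 mul_mx_diag -scalemxAl !mxE => e.
    by rewrite mulrBr [X in _ - X]mulrC e subrr.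
  have [j vj] : exists j, (v *m O^T) 0 j != 0.
    apply: contrapT => /forallNP hj; move/eqP: v0; apply.
    rewrite -[v]mulmx1 -OO' mulmxA (_ : v *m O^T = 0) ?mul0mx //.
    by apply/rowP => j; rewrite [RHS]mxE; apply: contrapT => /eqP/(hj j).
  exists j; move/eqP: (h j); rewrite mulf_eq0 (negPf vj) subr_eq0 => /eqP.
  by [].
case: h => i di; apply/eigenvalueP; exists (row i O).
  rewrite -row_mul XX !mulmxA OO mul1mx row_mul row_diag_mx di.
  by rewrite -scalemxAl -rowE.
apply/eqP => r0; have /matrixP/(_ i i) := OO.
rewrite !mxE eqxx big1 => [/eqP|j _]; first by rewrite eq_sym oner_eq0.
by move/rowP/(_ j): r0; rewrite !mxE => ->; rewrite mul0r.
Qed.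

Lemma singular_value_sqrt i : singular_value X (Num.sqrt (d 0 i)).
Proof.
apply/singular_valueP; rewrite sqrtr_ge0; split=> //.
by exists i; rewrite sqr_sqrtr // gram_ge0.
Qed.

Lemma singular_values_bounded :
  has_ubound [set s | singular_value X s].
Proof.
exists (\big[Num.max/0]_i Num.sqrt (d 0 i)) => s /singular_valueP[s0 [i di]].
by rewrite -(ger0_norm s0) -sqrtr_sqr -di le_bigmax.
Qed.

Lemma sqrt_le_sigma_max i : Num.sqrt (d 0 i) <= sigma_max X.
Proof.
by apply: ub_le_sup; [exact: singular_values_bounded | exact: singular_value_sqrt].
Qed.

Lemma sigma_min_le i : d 0 i != 0 -> sigma_min X <= Num.sqrt (d 0 i).
Proof.
move=> di; apply: ge_inf; first by exists 0 => s [_ /ltW].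
split; first exact: singular_value_sqrt.
by rewrite sqrtr_gt0 lt_neqAle eq_sym di gram_ge0.
Qed.

Lemma sigma_min_sq_le i : d 0 i != 0 -> 0 <= sigma_min X ->
  sigma_min X ^+ 2 <= d 0 i.
Proof.
move=> di s0; rewrite -[leRHS]sqr_sqrtr ?gram_ge0 //.
by rewrite lerXn2r ?nnegrE ?sqrtr_ge0 // sigma_min_le.
Qed.

(** The infimum runs over finitely many values: the least positive square root of an entry of [d] is
    a positive lower bound. *)
Lemma sigma_min_gt0 i : d 0 i != 0 -> 0 < sigma_min X.
Proof.
move=> di; pose e := \big[Num.min/Num.sqrt (d 0 i)]_(j | d 0 j != 0) Num.sqrt (d 0 j).
have s0 j : d 0 j != 0 -> 0 < Num.sqrt (d 0 j).
  by move=> dj; rewrite sqrtr_gt0 lt_neqAle eq_sym dj gram_ge0.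
apply: (@lt_le_trans _ _ e).
  rewrite /e; elim/big_ind: _ => [|x y hx hy|j dj]; rewrite ?s0 //.
  by rewrite lt_min hx.
rewrite /sigma_min; apply: lb_le_inf.
  by exists (Num.sqrt (d 0 i)); split; [exact: singular_value_sqrt | exact: s0].
move=> s [/singular_valueP[s0' [j dj]] sp].
rewrite -(ger0_norm s0') -sqrtr_sqr -dj bigmin_le_cond //.
by rewrite dj expf_neq0 // gt_eqF.
Qed.

(** The Moore-Penrose inverse as pseudoinverse of the Gram matrix times [X^T]. Since [0^-1 = 0],
    inverting [d] entrywise inverts the Gram matrix on its range and vanishes on its kernel. *)
Definition gram_pinv : 'M[R]_n := O^T *m diag_mx (\row_i (d 0 i)^-1) *m O *m X^T.

Lemma gram_pinv_right :
  gram_pinv *m X = O^T *m diag_mx (\row_i (d 0 i != 0)%:R) *m O.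
Proof.
rewrite /gram_pinv -(mulmxA _ X^T) XX !mulmxA -(mulmxA _ O O^T) OO mulmx1.
rewrite -(mulmxA _ (diag_mx _) (diag_mx _)) mulmx_diag; congr (_ *m diag_mx _ *m _).
apply/rowP => i; rewrite !mxE; have [->|di] := eqVneq (d 0 i) 0.
  by rewrite mulr0.
by rewrite mulVf.
Qed.

(** The difference has Frobenius norm 0: along each eigenvector of the Gram matrix either [d 0 i]
    vanishes or [gram_pinv *m X] acts as the identity. *)
Lemma gram_kernel : X *m (gram_pinv *m X) = X.
Proof.
apply/eqP; rewrite -subr_eq0; apply/eqP.
have -> : X *m (gram_pinv *m X) - X = X *m (gram_pinv *m X - 1%:M).
  by rewrite mulmxBr mulmx1.
apply/nrm_eq0/eqP.
rewrite -sqrf_eq0 nrm_gram gram_pinv_right big1 // => i _.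
have [->|di] := eqVneq (d 0 i) 0; first by rewrite mul0r.
rewrite mulmxBr !mulmxA OO mul1mx mulmx1 linearB /= row_mul row_diag_mx mxE di.
by rewrite -scalemxAl scale1r -rowE subrr nrm0 expr0n mulr0.
Qed.

Hypothesis X0 : (0 < \rank X)%N.

Lemma gram_neq0 : exists i, d 0 i != 0.
Proof.
apply: contrapT => /forallNP h.
have d0 : d = 0 by apply/rowP => i; rewrite mxE; apply: contrapT => /eqP/(h i).
have X00 : X = 0.
  apply/nrm_eq0/eqP; rewrite -sqrf_eq0 -[X]mulmx1 nrm_gram big1 // => i _.
  by rewrite d0 mxE mul0r.
by move: X0; rewrite X00 mxrank0.
Qed.

Lemma sigma_min_pos : 0 < sigma_min X.
Proof. by have [i /sigma_min_gt0] := gram_neq0. Qed.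

Lemma sigma_min_max : sigma_min X <= sigma_max X.
Proof.
have [i di] := gram_neq0.
by apply: le_trans (sigma_min_le di) (sqrt_le_sigma_max i).
Qed.

Lemma nrm_mul_le_sigma_max q (B : 'M[R]_(n, q)) :
  nrm (X *m B) <= sigma_max X * nrm B.
Proof.
have s0 : 0 <= sigma_max X by apply: le_trans sigma_min_max; exact: ltW sigma_min_pos.
rewrite -(@ler_pXn2r _ 2) ?nnegrE ?mulr_ge0 ?nrm_ge0 // exprMn.
rewrite nrm_gram nrm_rows mulr_sumr; apply: ler_sum => i _.
rewrite ler_wpM2r ?sqr_ge0 // -[leLHS]sqr_sqrtr ?gram_ge0 //.
by rewrite lerXn2r ?nnegrE ?sqrtr_ge0 // sqrt_le_sigma_max.
Qed.

Lemma spectral_norm_le_sigma_max : spectral_norm X <= sigma_max X.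
Proof.
apply: ge_sup; first by exists (nrm (X *m (0 : 'cV_n))), 0; rewrite //= nrm0.
move=> _ [x /= x1 <-]; apply: le_trans (nrm_mul_le_sigma_max x) _.
rewrite ler_piMr //; apply: le_trans sigma_min_max; exact: ltW sigma_min_pos.
Qed.

Lemma spectral_norm_ge0 : 0 <= spectral_norm X.
Proof.
apply: ub_le_sup; last by exists 0; rewrite /= ?mulmx0 nrm0.
exists (sigma_max X) => _ [x /= x1 <-]; apply: le_trans (nrm_mul_le_sigma_max x) _.
rewrite ler_piMr //; apply: le_trans sigma_min_max; exact: ltW sigma_min_pos.
Qed.

(** With [E] the pseudoinverse of the Gram matrix, the Penrose identities reduce to diagonal ones,
    and both norm bounds come from the quadratic form of [E], whose eigenvalues are at most
    [(sigma_min X ^+ 2)^-1]. *)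
Lemma gram_is_pinv : is_pinv X gram_pinv (sigma_min X).
Proof.
have s0 := sigma_min_pos.
have symD e : (O^T *m diag_mx e *m O)^T = O^T *m diag_mx e *m O.
  by rewrite !trmx_mul trmxK tr_diag_mx mulmxA.
have [E EE] : exists E, E = O^T *m diag_mx (\row_i (d 0 i)^-1) *m O by eexists.
have GE : gram_pinv = E *m X^T by rewrite EE.
have symE : E^T = E by rewrite EE symD.
have EGX : gram_pinv *m X *m E = E.
  rewrite gram_pinv_right EE !mulmxA -(mulmxA _ O O^T) OO mulmx1.
  rewrite -(mulmxA _ (diag_mx _) (diag_mx _)) mulmx_diag.
  congr (_ *m diag_mx _ *m _); apply/rowP => i; rewrite !mxE.
  by have [->|di] := eqVneq (d 0 i) 0; rewrite ?invr0 ?mulr0 // mul1r.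
have XGX : X *m gram_pinv *m X = X by rewrite -mulmxA gram_kernel.
have GXG : gram_pinv *m X *m gram_pinv = gram_pinv by rewrite {2}GE mulmxA EGX.
have symP : (X *m gram_pinv)^T = X *m gram_pinv.
  by rewrite GE !trmx_mul trmxK symE mulmxA.
have symQ : (gram_pinv *m X)^T = gram_pinv *m X by rewrite gram_pinv_right symD.
have hinv i : (d 0 i)^-1 <= (sigma_min X ^+ 2)^-1.
  have [->|di] := eqVneq (d 0 i) 0.
    by rewrite invr0 invr_ge0 sqr_ge0.
  rewrite lef_pV2 ?posrE ?exprn_gt0 // ?sigma_min_sq_le ?(ltW s0) //.
  by rewrite lt_neqAle eq_sym di gram_ge0.
have form q (B : 'M[R]_(n, q)) : ip B (E *m B) <= (nrm B / sigma_min X) ^+ 2.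
  rewrite EE gram_form expr_div_n nrm_rows mulr_suml; apply: ler_sum => i _.
  by rewrite mulrC mxE ler_wpM2l ?sqr_ge0.
split=> // B; split.
  rewrite -(@ler_pXn2r _ 2) ?nnegrE ?divr_ge0 ?nrm_ge0 ?(ltW s0) //.
  have -> : nrm (B *m gram_pinv) ^+ 2 = ip B^T (E *m B^T).
    rewrite -nrm_tr trmx_mul nrm_sq ip_mull trmxK mulmxA.
    have -> : gram_pinv *m gram_pinv^T = E.
      by rewrite {2}GE trmx_mul trmxK symE mulmxA EGX.
    by [].
  by rewrite -(nrm_tr B); exact: form.
rewrite -(@ler_pXn2r _ 2) ?nnegrE ?divr_ge0 ?nrm_ge0 ?(ltW s0) //.
set C := X^T *m B.
have -> : nrm (gram_pinv *m B) ^+ 2 = ip C (E *m (E *m C)).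
  by rewrite nrm_sq GE -(mulmxA E) (ip_mull E) symE.
(* One factor [E] is estimated by its largest eigenvalue; the form left over is that of the
   projection [X *m gram_pinv], at most [nrm B ^+ 2]. *)
have h1 : ip C (E *m (E *m C)) <= ip C (E *m C) / sigma_min X ^+ 2.
  have -> : E *m (E *m C) =
      O^T *m diag_mx (\row_i ((d 0 i)^-1 ^+ 2)) *m O *m C.
    rewrite mulmxA; congr (_ *m _).
    rewrite EE !mulmxA -(mulmxA _ O O^T) OO mulmx1.
    rewrite -(mulmxA _ (diag_mx _) (diag_mx _)) mulmx_diag.
    by congr (_ *m diag_mx _ *m _); apply/rowP => i; rewrite !mxE expr2.
  rewrite EE !gram_form mulr_suml; apply: ler_sum => i _; rewrite !mxE.
  rewrite expr2 mulrAC ler_wpM2l ?hinv //.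
  by rewrite mulr_ge0 ?sqr_ge0 ?invr_ge0 ?gram_ge0.
apply: le_trans h1 _; rewrite expr_div_n ler_wpM2r ?invr_ge0 ?sqr_ge0 //.
have -> : ip C (E *m C) = ip B (X *m gram_pinv *m B).
  by rewrite /C ip_mull trmxK GE !mulmxA.
rewrite ipC ip_orthoproj; last by split; rewrite // mulmxA XGX.
rewrite lerXn2r ?nnegrE ?nrm_ge0 // nrm_orthoproj_mull //.
by split; rewrite // mulmxA XGX.
Qed.

Lemma trace_gram_right : \tr (gram_pinv *m X) = (\rank X)%:R.
Proof.
have [_ idem] := pinv_right gram_is_pinv.
rewrite mxtrace_idempotent //; congr _%:R; apply/eqP; rewrite eqn_leq.
by rewrite mxrankM_maxr -{1}gram_kernel mxrankM_maxr.
Qed.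

Lemma card_gram_neq0 : \sum_i (d 0 i != 0)%:R = (\rank X)%:R :> R.
Proof.
rewrite -trace_gram_right gram_pinv_right mxtrace_mulC mulmxA OO mul1mx.
by rewrite mxtrace_diag; apply: eq_bigr => i _; rewrite mxE.
Qed.

(* Weights of the [i]-th right singular direction outside the range of [Q]. *)
Definition defect (Q : 'M[R]_n) i := nrm (row i (O *m (1%:M - Q))) ^+ 2.

Lemma defect_ge0 Q i : 0 <= defect Q i. Proof. exact: sqr_ge0. Qed.

Lemma defect_le1 Q i : orthoproj Q -> defect Q i <= 1.
Proof.
move=> hQ; rewrite /defect row_mul.
have Oi : nrm (row i O) ^+ 2 = 1.
  have /matrixP/(_ i i) := OO; rewrite !mxE eqxx mulr1n => <-.
  by rewrite nrm_sqE big_ord1; apply: eq_bigr => j _; rewrite !mxE expr2.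
rewrite -[leRHS]Oi lerXn2r ?nnegrE ?nrm_ge0 //.
exact: nrm_orthoproj_mulr (orthoprojC hQ).
Qed.

Lemma sum_defect Q : orthoproj Q -> \sum_i defect Q i = n%:R - \tr Q.
Proof.
move=> hQ; have hC := orthoprojC hQ.
rewrite -nrm_rows nrm_sq ip_trace hC.1 hC.2 linearB /= mxtrace1 //.
Qed.

(** On the complement of [Q] the matrix [Y] vanishes and [X - Y] acts as [X]. This one lower bound
    yields both the best approximation property ([eckart_young]) and the stability of the last kept
    singular value ([hard_threshold_svd]). *)
Lemma nrm_defect Q Y : orthoproj Q -> Y *m Q = Y ->
  \sum_i d 0 i * defect Q i <= nrm (X - Y) ^+ 2.
Proof.
move=> hQ YQ; rewrite -nrm_gram.
have -> : X *m (1%:M - Q) = (X - Y) *m (1%:M - Q).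
  by rewrite mulmxBl (mulmxBr Y) mulmx1 YQ subrr subr0.
rewrite lerXn2r ?nnegrE ?nrm_ge0 //.
exact: nrm_orthoproj_mulr (orthoprojC hQ).
Qed.

End GramSpectrum.

Section ReducedSVD.
Context {R : realType} (n : nat).

Lemma orthoproj_isometry r (U : 'M[R]_(n, r)) :
  U^T *m U = 1%:M -> orthoproj (U *m U^T).
Proof.
move=> UU; split; first by rewrite trmx_mul trmxK.
by rewrite mulmxA -(mulmxA U) UU mulmx1.
Qed.

Lemma nrm_mul_isometry_tr r q (U : 'M[R]_(n, r)) (B : 'M[R]_(q, r)) :
  U^T *m U = 1%:M -> nrm (B *m U^T) = nrm B.
Proof. by move=> UU; rewrite /frob_norm ip_mulr trmxK -mulmxA UU mulmx1. Qed.

Lemma nrm_mul_isometry r q (U : 'M[R]_(n, r)) (B : 'M[R]_(q, n)) :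
  U^T *m U = 1%:M -> nrm (B *m U) <= nrm B.
Proof.
move=> UU; rewrite -(nrm_mul_isometry_tr (B *m U) UU) -mulmxA.
exact: nrm_orthoproj_mulr (orthoproj_isometry UU).
Qed.

Lemma nrm_mul_diag r q (B : 'M[R]_(q, r)) (e : 'rV[R]_r) c :
  0 <= c -> (forall i, `|e 0 i| <= c) -> nrm (B *m diag_mx e) <= c * nrm B.
Proof.
move=> c0 ec; rewrite -(@ler_pXn2r _ 2) ?nnegrE ?mulr_ge0 ?nrm_ge0 // exprMn.
rewrite !nrm_sqE mulr_sumr; apply: ler_sum => i _; rewrite mulr_sumr.
apply: ler_sum => j _; rewrite mul_mx_diag mxE exprMn mulrC.
by rewrite ler_wpM2r ?sqr_ge0 // -real_normK ?num_real // lerXn2r ?nnegrE.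
Qed.

Lemma nrm_mul_svd_pinv r (U V : 'M[R]_(n, r)) (e : 'rV[R]_r) c (B : 'M[R]_n) :
  U^T *m U = 1%:M -> V^T *m V = 1%:M -> 0 <= c -> (forall i, `|e 0 i| <= c) ->
  nrm (B *m (V *m diag_mx e *m U^T)) <= c * nrm B.
Proof.
move=> UU VV c0 ec; rewrite !mulmxA nrm_mul_isometry_tr //.
apply: le_trans (nrm_mul_diag _ c0 ec) _.
by rewrite ler_wpM2l // nrm_mul_isometry.
Qed.

Lemma svd_pinv r (Y : 'M[R]_n) (U V : 'M[R]_(n, r)) (s : 'rV[R]_r) (sigma : R) :
  U^T *m U = 1%:M -> V^T *m V = 1%:M -> Y = U *m diag_mx s *m V^T ->
  0 < sigma -> (forall i, sigma <= s 0 i) ->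
  exists G, [/\ is_pinv Y G sigma, Y *m G = U *m U^T & G *m Y = V *m V^T].
Proof.
move=> UU VV YE s0 hs; pose e : 'rV[R]_r := \row_i (s 0 i)^-1.
have sp i : 0 < s 0 i by exact: lt_le_trans (hs i).
have se : diag_mx s *m diag_mx e = 1%:M.
  rewrite mulmx_diag -diag_const_mx; congr diag_mx; apply/rowP => i.
  by rewrite !mxE divff // gt_eqF.
have es := mulmx1C se.
have ec i : `|e 0 i| <= sigma^-1.
  by rewrite mxE ger0_norm ?invr_ge0 ?(ltW (sp i)) // lef_pV2 ?posrE.
have ci : 0 <= sigma^-1 by rewrite invr_ge0 ltW.
pose G := V *m diag_mx e *m U^T; exists G.
have YG : Y *m G = U *m U^T.
  rewrite YE /G !mulmxA -(mulmxA _ V^T V) VV mulmx1 -(mulmxA U (diag_mx s)) se.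
  by rewrite mulmx1.
have GY : G *m Y = V *m V^T.
  rewrite YE /G !mulmxA -(mulmxA _ U^T U) UU mulmx1 -(mulmxA V (diag_mx e)) es.
  by rewrite mulmx1.
split=> //; split.
- by rewrite YG YE !mulmxA -(mulmxA U) UU mulmx1.
- by rewrite GY /G !mulmxA -(mulmxA V V^T V) VV mulmx1.
- by rewrite YG trmx_mul trmxK.
- by rewrite GY trmx_mul trmxK.
- move=> B; split; first by rewrite mulrC; exact: nrm_mul_svd_pinv.
  rewrite -nrm_tr trmx_mul mulrC -(nrm_tr B).
  have -> : G^T = U *m diag_mx e *m V^T.
    by rewrite /G !trmx_mul trmxK tr_diag_mx mulmxA.
  exact: nrm_mul_svd_pinv.
Qed.

Lemma proj_tangentE r (Y : 'M[R]_n) (U V : 'M[R]_(n, r)) (s : 'rV[R]_r) Z :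
  is_reduced_svd Y U s V ->
  proj_tangent r Y Z = tanp (U *m U^T) (V *m V^T) Z.
Proof.
move=> hsvd; have [[UU VV _ _ YE] sp] := hsvd.
have hP := orthoproj_isometry UU; have hQ := orthoproj_isometry VV.
apply: orth_projE.
- move=> {}Z; exists U, V, s, (Z^T *m U), ((1%:M - U *m U^T) *m Z *m V).
  by split=> //; rewrite tanpE trmx_mul trmxK !mulmxA.
(* A tangent vector may come with another reduced SVD of [Y]. Since [U'] is [Y *m V'] times the
   inverse of [diag_mx s'], it lies in the column space given by [U]; likewise for [V'] and the row
   space. *)
- move=> W [U' [V' [s' [Z1 [Z2 [[[UU' VV' _ _ YE'] sp'] ->]]]]]].
  have dinv : diag_mx s' *m diag_mx (\row_i (s' 0 i)^-1) = 1%:M.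
    rewrite mulmx_diag -diag_const_mx; congr diag_mx; apply/rowP => i.
    by rewrite !mxE divff // gt_eqF.
  have PY : U *m U^T *m Y = Y by rewrite YE !mulmxA -(mulmxA U) UU mulmx1.
  have QY : V *m V^T *m Y^T = Y^T.
    by rewrite YE !trmx_mul trmxK !mulmxA -(mulmxA V) VV mulmx1.
  have PU : (1%:M - U *m U^T) *m U' = 0.
    have -> : U' = Y *m V' *m diag_mx (\row_i (s' 0 i)^-1).
      by rewrite YE' -(mulmxA _ V'^T) VV' mulmx1 -mulmxA dinv mulmx1.
    by rewrite !mulmxA mulmxBl mul1mx PY subrr !mul0mx.
  have QV : V'^T *m (1%:M - V *m V^T) = 0.
    apply: trmx_inj; rewrite trmx_mul trmxK trmx0 (orthoprojC hQ).1.
    have -> : V' = Y^T *m U' *m diag_mx (\row_i (s' 0 i)^-1).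
      rewrite YE' !trmx_mul trmxK -!mulmxA (mulmxA U'^T) UU' mul1mx.
      by rewrite tr_diag_mx dinv mulmx1.
    by rewrite !mulmxA mulmxBl mul1mx QY subrr !mul0mx.
  rewrite /tanp (mulmxDr (1%:M - U *m U^T)) (mulmxA _ U') PU mul0mx add0r.
  by rewrite -!mulmxA QV !mulmx0 subr0.
- exact: tanpB.
- move=> {}Z W; exact: ip_tanp_res.
Qed.

Lemma proj_tangent_default r (Y : 'M[R]_n) Z :
  (forall U s V, ~ @is_reduced_svd R n r Y U s V) -> proj_tangent r Y Z = 0.
Proof.
by move=> h; apply: xgetPN => W [[U [V [s [Z1 [Z2 [/h]]]]]]].
Qed.

(** Runs carry no rank information, so the case without a reduced SVD of size [r] is included: there
    both sides are 0. *)
Lemma proj_tangentK r (Y : 'M[R]_n) Z :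
  proj_tangent r Y (proj_tangent r Y Z) = proj_tangent r Y Z.
Proof.
have [[U [s [V h]]]|h] := pselect (exists U s V, @is_reduced_svd R n r Y U s V).
  rewrite !(proj_tangentE _ h); have [[UU VV _ _ _] _] := h.
  by rewrite tanpK //; exact: orthoproj_isometry.
by rewrite !proj_tangent_default // => U s V hs; apply: h; exists U, s, V.
Qed.

Lemma orth_proj_col_space (X G : 'M[R]_n) sigma (e : 'cV[R]_n) :
  is_pinv X G sigma -> orth_proj (col_space X) e = X *m G *m e.
Proof.
move=> hX; have hP := pinv_left hX; apply: (@orth_projE _ _ _ _ (mulmx (X *m G))).
- by move=> Z; exists (G *m Z); rewrite //= mulmxA.
- by move=> _ [y _ <-]; rewrite mulmxA; case: hX => ->.
- by move=> A B; rewrite mulmxBr.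
- move=> Z W; rewrite ipC ip_mull hP.1 mulmxBr (mulmxA _ (X *m G) Z) hP.2.
  by rewrite subrr ip0r.
Qed.

End ReducedSVD.

(** * Best rank [r] approximation *)

Section HardThreshold.
Context {R : realType} (n r : nat).
Hypothesis rn : (r <= n)%N.

Lemma sum_ord_lt : \sum_(i < n) (i < r)%:R = r%:R :> R.
Proof.
rewrite (eq_bigr (fun i : 'I_n => if (i < r)%N then 1 else 0)); last first.
  by move=> i _; case: ifP.
by rewrite -big_mkcond (big_ord_narrow rn) /= sumr_const card_ord.
Qed.

Lemma truncation_proj (V : 'M[R]_n) : V^T *m V = 1%:M ->
  let Q := V *m diag_mx (\row_(i < n) (i < r)%:R) *m V^T in
  [/\ orthoproj Q, \tr Q = r%:R & forall (U : 'M[R]_n) (s : 'rV[R]_n),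
    let Y := U *m diag_mx (\row_(i < n) (if (i < r)%N then s 0 i else 0)) *m V^T in
    Y *m Q = Y].
Proof.
move=> VV Q; split.
- split; first by rewrite !trmx_mul trmxK tr_diag_mx mulmxA.
  rewrite /Q !mulmxA -(mulmxA _ V^T V) VV mulmx1 -(mulmxA V (diag_mx _)).
  rewrite mulmx_diag; congr (_ *m diag_mx _ *m _); apply/rowP => i.
  by rewrite !mxE; case: ltnP; rewrite ?mulr0 ?mulr1.
- rewrite /Q mxtrace_mulC mulmxA VV mul1mx mxtrace_diag -sum_ord_lt.
  by apply: eq_bigr => i _; rewrite mxE.
- move=> U s /=; rewrite /Q !mulmxA -(mulmxA _ V^T V) VV mulmx1.
  rewrite -(mulmxA U (diag_mx _)) mulmx_diag.
  congr (_ *m diag_mx _ *m _); apply/rowP => i.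
  by rewrite !mxE; case: ltnP; rewrite ?mulr0 ?mulr1.
Qed.

Lemma nrm_svd (U V : 'M[R]_n) (e : 'rV[R]_n) :
  U^T *m U = 1%:M -> V^T *m V = 1%:M ->
  nrm (U *m diag_mx e *m V^T) ^+ 2 = \sum_i e 0 i ^+ 2.
Proof.
move=> UU VV; rewrite nrm_mul_isometry_tr //.
have -> : nrm (U *m diag_mx e) = nrm (diag_mx e).
  by rewrite /frob_norm ip_mull mulmxA UU mul1mx.
rewrite nrm_sqE; apply: eq_bigr => i _; rewrite (bigD1 i) //= big1 => [|j ji].
  by rewrite addr0 mxE eqxx.
by rewrite mxE eq_sym (negPf ji) mulr0n expr0n.
Qed.

(** Among weights in [[0, 1]] of total [n - r], the weighted sum is least when they sit on the
    [n - r] smallest values. *)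
Lemma sorted_tail_le (s : 'rV[R]_n) (c : 'I_n -> R) :
  (forall i, 0 <= s 0 i) -> (forall i j : 'I_n, (i <= j)%N -> s 0 j <= s 0 i) ->
  (forall i, 0 <= c i <= 1) -> \sum_i c i = n%:R - r%:R ->
  \sum_(i < n) (s 0 i - (if (i < r)%N then s 0 i else 0)) ^+ 2 <=
  \sum_i s 0 i ^+ 2 * c i.
Proof.
move=> s0 ss c01 sc.
have [nr|rltn] := leqP n r.
  rewrite big1 => [|i _]; last by rewrite (leq_trans (ltn_ord i)) // subrr expr0n.
  by apply: sumr_ge0 => i _; rewrite mulr_ge0 ?sqr_ge0 //; case/andP: (c01 i).
(* [t] is the [(r+1)]-st squared value, the threshold between kept and dropped ones. As the weights
   [b] have the same total as [c], the terms [t * (c i - b i)] sum to 0, and they bound the terms of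
   the difference from below. *)
pose t := s 0 (Ordinal rltn) ^+ 2.
pose b (i : 'I_n) : R := 1 - (i < r)%:R.
have sb : \sum_i b i = n%:R - r%:R.
  by rewrite sumrB sum_ord_lt sumr_const card_ord.
rewrite -subr_ge0 -sumrB.
have e0 : \sum_i t * (c i - b i) = 0 by rewrite -mulr_sumr sumrB sc sb subrr mulr0.
rewrite -[leLHS]e0.
apply: ler_sum => i _; have /andP[c0 c1] := c01 i; rewrite /b.
have [ir|ri] := ltnP i r.
  have : t <= s 0 i ^+ 2 by rewrite lerXn2r ?nnegrE ?s0 ?ss //= ltnW.
  by rewrite subrr; nra.
have : s 0 i ^+ 2 <= t by rewrite lerXn2r ?nnegrE ?s0 ?ss.
by rewrite subr0; nra.
Qed.

(** [nrm_defect] bounds [nrm (Z - X) ^+ 2] below by the squared singular values of [Z] with weights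
    in [[0, 1]] of total [n - r], and [sorted_tail_le] compares this with the discarded tail. *)
Theorem eckart_young (Z Y X Q : 'M[R]_n) :
  is_hard_threshold r Z Y -> orthoproj Q -> X *m Q = X -> \tr Q = r%:R ->
  nrm (Z - Y) <= nrm (Z - X).
Proof.
move=> [U [s [V [[UU VV s0 ss ZE] YE]]]] hQ XQ trQ.
rewrite -(@ler_pXn2r _ 2) ?nnegrE ?nrm_ge0 //.
have OO : V^T *m V^T^T = 1%:M by rewrite trmxK.
have ZZ : Z^T *m Z = V^T^T *m diag_mx (\row_i s 0 i ^+ 2) *m V^T.
  rewrite ZE !trmx_mul !trmxK tr_diag_mx !mulmxA -(mulmxA _ U^T U) UU mulmx1.
  rewrite -(mulmxA V (diag_mx s) (diag_mx s)) mulmx_diag; congr (_ *m diag_mx _ *m _).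
apply: le_trans (nrm_defect ZZ hQ XQ).
have -> : Z - Y = U *m diag_mx
    (\row_(i < n) (s 0 i - (if (i < r)%N then s 0 i else 0))) *m V^T.
  rewrite ZE YE -mulmxBl -mulmxBr -linearB /=; congr (_ *m diag_mx _ *m _).
  by apply/rowP => i; rewrite !mxE.
rewrite nrm_svd //.
under eq_bigr do rewrite mxE.
under [leRHS]eq_bigr do rewrite mxE.
apply: sorted_tail_le => // [i|]; last by rewrite (sum_defect OO) // trQ.
by rewrite defect_ge0 (defect_le1 OO).
Qed.

Lemma hard_threshold_rank (Z Y : 'M[R]_n) :
  is_hard_threshold r Z Y -> (\rank Y <= r)%N.
Proof.
move=> [U [s [V [[UU VV _ _ _] YE]]]].
have [[_ QQ] trQ /(_ U s) YQ] := truncation_proj VV.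
rewrite YE -YQ; apply: leq_trans (mxrankM_maxr _ _) _.
by move: trQ; rewrite mxtrace_idempotent // => /eqP; rewrite eqr_nat => /eqP ->.
Qed.

End HardThreshold.

Section HardThresholdRank.
Context {R : realType} (n r : nat) (X O : 'M[R]_n) (d : 'rV[R]_n).
Hypothesis rn : (r <= n)%N.
Hypotheses (OO : O *m O^T = 1%:M) (XX : X^T *m X = O^T *m diag_mx d *m O).
Hypotheses (r0 : (0 < r)%N) (rkX : \rank X = r).

(** Keeps the tangent spaces along the iteration non-degenerate. The last kept singular value is the
    distance from [Y] to its truncation [Y'] of rank at most [r - 1], while [X] is at least
    [sigma_min X] away from [Y']; the triangle inequality concludes. *)
Lemma hard_threshold_svd (Z Y : 'M[R]_n) :
  is_hard_threshold r Z Y -> nrm (X - Y) < sigma_min X ->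
  exists (U V : 'M[R]_(n, r)) (s : 'rV[R]_r),
    is_reduced_svd Y U s V /\
    forall i, sigma_min X - nrm (X - Y) <= s 0 i.
Proof.
move=> [U [s [V [[UU VV s0 ss ZE] YE]]]] hlt.
pose w := widen_ord rn.
pose U' : 'M[R]_(n, r) := \matrix_(i, j) U i (w j).
pose V' : 'M[R]_(n, r) := \matrix_(i, j) V i (w j).
pose s' : 'rV[R]_r := \row_j s 0 (w j).
have iso (A : 'M[R]_n) : A^T *m A = 1%:M ->
    (\matrix_(i, j) A i (w j) : 'M[R]_(n, r))^T *m \matrix_(i, j) A i (w j) = 1%:M.
  move=> AA; apply/matrixP => i j.
  have /matrixP/(_ (w i) (w j)) := AA; rewrite !mxE => e.
  rewrite -[RHS]/((w i == w j)%:R) -e; apply: eq_bigr => k _; rewrite !mxE //.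
have YE' : Y = U' *m diag_mx s' *m V'^T.
  rewrite YE; apply/matrixP => i j; rewrite !mxE.
  under eq_bigr do rewrite mul_mx_diag !mxE.
  under [RHS]eq_bigr do rewrite mul_mx_diag !mxE.
  rewrite (bigID (fun k : 'I_n => (k < r)%N)) /= [X in _ + X]big1 ?addr0.
    rewrite (big_ord_narrow rn) /=; apply: eq_bigr => k _.
    by rewrite ltn_ord.
  by move=> k /negPf ->; rewrite mulr0 mul0r.
have rlast : (r.-1 < n)%N by rewrite prednK.
pose l := Ordinal rlast.
have hl : sigma_min X - nrm (X - Y) <= s 0 l.
  have rn' : (r.-1 <= n)%N by rewrite ltnW.
  have [hQ trQ /(_ U s) YQ] := truncation_proj rn' VV.
  set Q := _ *m _ in hQ trQ YQ; set Y' := U *m _ *m _ in YQ.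
  have sp : 0 <= sigma_min X by apply: le_trans (ltW hlt); exact: nrm_ge0.
  have hY' : nrm (Y - Y') = s 0 l.
    have -> : Y - Y' = U *m diag_mx (\row_i (s 0 i * (i == l)%:R)) *m V^T.
      rewrite YE /Y' -mulmxBl -mulmxBr -linearB /=; congr (_ *m diag_mx _ *m _).
      apply/rowP => i; rewrite !mxE; have [->|il] := eqVneq i l.
        by rewrite /= ltnn prednK // leqnn subr0 mulr1.
      have -> : (i < r.-1)%N = (i < r)%N.
        move: il; rewrite -val_eqE /= => il; apply/idP/idP; first by lia.
        by move=> h; lia.
      by rewrite subrr mulr0.
    apply/eqP; rewrite -(@eqrXn2 _ 2) ?nrm_ge0 ?s0 // nrm_svd //.
    rewrite (bigD1 l) //= mxE eqxx mulr1 big1 ?addr0 // => i il.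
    by rewrite mxE (negPf il) mulr0 expr0n.
  have key : sigma_min X <= nrm (X - Y').
    rewrite -(@ler_pXn2r _ 2) ?nnegrE ?nrm_ge0 //.
    apply: le_trans (nrm_defect XX hQ YQ).
    (* The defects add up to [n - r + 1], and the [n - r] directions in the kernel of [X] carry at
       most 1 each, so at least 1 falls on the others. *)
    have h1 : 1 <= \sum_i (d 0 i != 0)%:R * defect O Q i.
      have hs := sum_defect OO hQ.
      have hc : \sum_i (1 - (d 0 i != 0)%:R) = n%:R - r%:R :> R.
        by rewrite sumrB sumr_const card_ord (card_gram_neq0 OO XX) ?rkX.
      have : \sum_i (defect O Q i - (1 - (d 0 i != 0)%:R)) <=
          \sum_i (d 0 i != 0)%:R * defect O Q i.
        apply: ler_sum => i _; have := defect_le1 OO i hQ.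
        have := defect_ge0 O Q i; case: (d 0 i != 0) => /=; lra.
      rewrite sumrB hs hc trQ; apply: le_trans.
      have rE : r%:R = r.-1%:R + 1 :> R by rewrite natr1 prednK.
      by rewrite rE; lra.
    have := ler_wpM2l (sqr_ge0 (sigma_min X)) h1; rewrite mulr1 => /le_trans; apply.
    rewrite mulr_sumr; apply: ler_sum => i _; rewrite mulrA.
    rewrite ler_wpM2r ?defect_ge0 //.
    have [->|di] := eqVneq (d 0 i) 0; first by rewrite mulr0.
    by rewrite mulr1; exact: (sigma_min_sq_le OO XX di sp).
  by have := nrm_triB X Y Y'; rewrite hY'; lra.
have hs i : sigma_min X - nrm (X - Y) <= s' 0 i.
  by apply: le_trans hl _; rewrite mxE ss //= -ltnS prednK.
exists U', V', s'; split=> //; split; last first.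
  by move=> i; apply: lt_le_trans (hs i); rewrite subr_gt0.
split; rewrite ?iso //.
  by move=> i; rewrite mxE.
by move=> i j ij; rewrite !mxE ss.
Qed.

End HardThresholdRank.

(** * One step of the iteration *)

Section Initialization.
Context {R : realType} (n r : nat).

(** [M] only sees [P *m E], with [P] the projection onto its column space. Row by row,
    [nrm (P *m E)] is at most [t * nrm P], and [nrm P ^+ 2] is the trace of [P], the rank of [M]. *)
Lemma ip_low_rank (E M : 'M[R]_n) (t : R) k : 0 <= t -> (\rank M <= k)%N ->
  (forall x : 'rV[R]_n, nrm (x *m E) <= t * nrm x) ->
  `|ip E M| <= Num.sqrt k%:R * t * nrm M.
Proof.
move=> t0 rkM hE; have [M0|M0] := posnP (\rank M).
  by move/eqP: M0; rewrite mxrank_eq0 => /eqP ->; rewrite ip0r nrm0 mulr0 normr0.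
have symMM : (M^T *m M)^T = M^T *m M by rewrite trmx_mul trmxK.
have [K [d [OO MM]]] := sym_spectral symMM.
have hM := gram_is_pinv OO MM M0.
set G := gram_pinv _ _ _ in hM; pose P := M *m G.
have hP : orthoproj P := pinv_left hM.
have PM : P *m M = M by case: hM.
have trP : \tr P = (\rank M)%:R by rewrite mxtrace_mulC; exact: trace_gram_right.
have -> : ip E M = ip (P *m E) M by rewrite ip_mull hP.1 PM.
apply: le_trans (cauchy_schwarz _ _) _; rewrite ler_wpM2r ?nrm_ge0 //.
rewrite -(@ler_pXn2r _ 2) ?nnegrE ?mulr_ge0 ?nrm_ge0 ?sqrtr_ge0 //.
rewrite exprMn (sqr_sqrtr (ler0n _ k)).
have rows q q' (A : 'M[R]_(q, q')) : nrm A ^+ 2 = \sum_i nrm (row i A) ^+ 2.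
  rewrite nrm_sqE; apply: eq_bigr => i _; rewrite nrm_sqE big_ord1.
  by apply: eq_bigr => j _; rewrite [in RHS]mxE.
apply: (@le_trans _ _ (t ^+ 2 * nrm P ^+ 2)).
  rewrite (rows _ _ (P *m E)) (rows _ _ P) mulr_sumr; apply: ler_sum => i _.
  by rewrite row_mul -exprMn lerXn2r ?nnegrE ?mulr_ge0 ?nrm_ge0.
rewrite mulrC ler_wpM2r ?sqr_ge0 // nrm_sq ip_trace hP.1 hP.2 trP.
by rewrite ler_nat.
Qed.

(* [Y] is closer to [W] than [X] is, hence
   [nrm (Y - X) ^+ 2 <= 2 * ip (W - X) (Y - X)], and [Y - X] has rank at most
   [2 r]. *)
Lemma init_bound (X Q W Y : 'M[R]_n) (t : R) : (r <= n)%N -> 0 <= t ->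
  orthoproj Q -> X *m Q = X -> \tr Q = r%:R -> is_hard_threshold r W Y ->
  (\rank X <= r)%N ->
  (forall x : 'rV[R]_n, nrm (x *m (W - X)) <= t * nrm x) ->
  nrm (X - Y) <= 2 * (Num.sqrt (2 * r%:R) * t).
Proof.
move=> rn t0 hQ XQ trQ hY rkX hW.
have h1 := eckart_young rn hY hQ XQ trQ.
have rkM : (\rank (Y - X)%R <= 2 * r)%N.
  rewrite mul2n -addnn; apply: leq_trans (mxrank_add _ _) _; rewrite mxrank_opp.
  exact: leq_add (hard_threshold_rank rn hY) rkX.
have := ip_low_rank t0 rkM hW; rewrite natrM => h2.
have h3 : nrm (Y - X) ^+ 2 <= 2 * ip (W - X) (Y - X).
  have e : W - Y = (W - X) - (Y - X) by rewrite opprB addrA subrK.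
  have : nrm (W - Y) ^+ 2 <= nrm (W - X) ^+ 2 by rewrite lerXn2r ?nnegrE ?nrm_ge0.
  rewrite e nrmD_sq nrmN ipNr; lra.
rewrite nrmB; have [->|n0] := eqVneq (nrm (Y - X)) 0.
  by rewrite !mulr_ge0 // sqrtr_ge0.
have np : 0 < nrm (Y - X) by rewrite lt_neqAle eq_sym n0 nrm_ge0.
rewrite -(ler_pM2r np) -expr2; apply: le_trans h3 _.
by have := ler_norm (ip (W - X) (Y - X)); lra.
Qed.

End Initialization.

Section SamplingOperator.
Context {R : realType} (n m : nat) (Om : sample n m).
Local Notation POm := (@P_Omega R n m Om).

Lemma P_OmegaD A B : POm (A + B) = POm A + POm B.
Proof. by apply/matrixP => i j; rewrite !mxE mulrDl. Qed.

Lemma P_OmegaZ a A : POm (a *: A) = a *: POm A.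
Proof. by apply/matrixP => i j; rewrite !mxE mulrA. Qed.

Lemma ip_P_Omega A B : ip (POm A) B = ip A (POm B).
Proof.
apply: eq_bigr => i _; apply: eq_bigr => j _; rewrite ![map2_mx _ _ _ _ _]mxE.
by rewrite -mulrA [X in _ * X]mulrC.
Qed.

(** Entrywise this is [u ^+ 2 <= L * u] for a multiplicity [u] between 0 and [L]. *)
Lemma nrm_P_Omega_sq (L : R) Z :
  (forall i j : 'I_n, (\sum_k delta_mx (Om k).1 (Om k).2 : 'M[R]_n) i j <= L) ->
  nrm (POm Z) ^+ 2 <= L * ip Z (POm Z).
Proof.
move=> hL; rewrite nrm_sq mulr_sumr; apply: ler_sum => i _; rewrite mulr_sumr.
apply: ler_sum => j _; have := hL i j; rewrite /P_Omega ![map2_mx _ _ _ _ _]mxE.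
set u := (X in X <= L) => uL.
have u0 : 0 <= u.
  by rewrite /u summxE; apply: sumr_ge0 => k _; rewrite mxE ler0n.
have -> : Z i j * u * (Z i j * u) = u * (u * Z i j ^+ 2) by ring.
have -> : L * (Z i j * (Z i j * u)) = L * (u * Z i j ^+ 2) by ring.
by rewrite ler_wpM2r // mulr_ge0 ?sqr_ge0.
Qed.

Lemma ip_P_OmegaE Z : ip Z (POm Z) = \sum_k Z (Om k).1 (Om k).2 ^+ 2.
Proof.
rewrite P_OmegaE ipC ip_suml; apply: eq_bigr => k _; rewrite ipZl.
rewrite /frob_inner (bigD1 (Om k).1) //= [X in _ * (_ + X)]big1 => [|i /negPf ik].
  rewrite (bigD1 (Om k).2) //= [X in _ * (_ + X + _)]big1 => [|j /negPf jk].
    by rewrite mxE !eqxx mul1r !addr0 expr2.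
  by rewrite mxE jk andbF mul0r.
by apply: big1 => j _; rewrite mxE ik mul0r.
Qed.

End SamplingOperator.

Section Local.
Context {R : realType} (n m : nat) (Om : sample n m).
Local Notation POm := (@P_Omega R n m Om).
Variables (X G Y H : 'M[R]_n) (sigma sigma' p L eps s delta : R).
Hypotheses (hX : is_pinv X G sigma) (hY : is_pinv Y H sigma').
Hypotheses (sigma0 : 0 < sigma) (sigma2 : sigma <= 2 * sigma').
Hypotheses (s0 : 0 < s) (s1 : s <= 1) (sp : p = s ^+ 2).
Hypotheses (eps0 : 0 < eps) (eps1 : eps <= 1 / 8) (L1 : 1 <= L).
Local Notation T := (tanp (X *m G) (G *m X)).
Local Notation Tl := (tanp (Y *m H) (H *m Y)).
Hypothesis rip : forall Z,
  `|ip (T Z) (POm (T Z)) - p * nrm (T Z) ^+ 2| <= eps * p * nrm (T Z) ^+ 2.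
Hypothesis hL : forall Z, nrm (POm Z) ^+ 2 <= L * ip Z (POm Z).
Hypotheses (delta0 : 0 <= delta) (deltaL : delta * L <= s * eps / 20).
Hypothesis close : nrm (X - Y) <= delta * sigma.

Let L0 : 0 < L. Proof. exact: lt_le_trans ltr01 L1. Qed.
Let p0 : 0 < p. Proof. by rewrite sp exprn_gt0. Qed.
Let delta_le : delta <= s * eps / 20.
Proof. by apply: le_trans deltaL; rewrite ler_peMr. Qed.
Let delta_eps : delta <= eps / 20.
Proof. by have := ler_piMl (ltW eps0) s1; have := delta_le; lra. Qed.

Let hP := pinv_left hX.
Let hQ := pinv_right hX.
Let hPl := pinv_left hY.
Let hQl := pinv_right hY.

Lemma abs_scale_le (alpha ea : R) : `|p * alpha - 1| <= ea -> p * `|alpha| <= 1 + ea.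
Proof.
move=> ha; rewrite -[X in X * _](ger0_norm (ltW p0)) -normrM.
have := ler_normD (p * alpha - 1) 1; rewrite subrK normr1; lra.
Qed.

Lemma nrm_P_Omega_le Z : nrm (POm Z) <= L * nrm Z.
Proof.
have := hL Z; have := le_trans (ler_norm _) (cauchy_schwarz Z (POm Z)).
have := nrm_ge0 (POm Z); have := nrm_ge0 Z => z0 u0 h1 h2.
have [u|u] := eqVneq (nrm (POm Z)) 0; first by rewrite u mulr_ge0 // ltW.
have up : 0 < nrm (POm Z) by rewrite lt_neqAle eq_sym u.
rewrite -(ler_pM2r up) -expr2; apply: le_trans h2 _.
by rewrite -mulrA ler_wpM2l // ltW.
Qed.

(** Because [sigma' >= sigma / 2], each projection differs by at most [delta + 2 * delta], and
    [tanp_diff] doubles this. *)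
Lemma tangent_close Z : nrm (Tl Z - T (Tl Z)) <= 6 * delta * nrm (Tl Z).
Proof.
have dd : nrm (X - Y) / sigma + nrm (X - Y) / sigma' <= 3 * delta.
  have s'0 : 0 < sigma' by move: sigma0 sigma2; lra.
  have h1 : nrm (X - Y) / sigma <= delta by rewrite ler_pdivrMr.
  have h2 : nrm (X - Y) / sigma' <= 2 * delta.
    rewrite ler_pdivrMr //; apply: le_trans close _.
    by rewrite [2 * _]mulrC -mulrA ler_wpM2l.
  lra.
have h := @tanp_diff R n (Y *m H) (H *m Y) (X *m G) (G *m X) (3 * delta) (Tl Z) hP hQl.
rewrite -{1}(tanpK hPl hQl Z).
have -> : 6 * delta = 2 * (3 * delta) by ring.
apply: h; rewrite nrmB.
  exact: le_trans (pinv_left_diff hX hY) dd.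
exact: le_trans (pinv_right_diff hX hY) dd.
Qed.

Lemma le_of_sqr_le (u a : R) : 0 <= u -> 0 <= a -> u ^+ 2 <= a ^+ 2 -> u <= a.
Proof. by move=> u0 a0; rewrite ler_pXn2r ?nnegrE. Qed.

(** [W] is split into its part [V] in the tangent space at [X], where [rip] holds, and a remainder
    of relative size [6 * delta]. Cross term and remainder together cost less than one more [eps],
    so the constant 4 leaves room. *)
Lemma tangent_rip Z :
  `|ip (Tl Z) (POm (Tl Z)) - p * nrm (Tl Z) ^+ 2| <= 4 * eps * p * nrm (Tl Z) ^+ 2.
Proof.
have dW := tangent_close Z; set W := Tl Z in dW *; set V := T W in dW.
set D := W - V in dW; have WE : W = V + D by rewrite addrC subrK.
have split : nrm W ^+ 2 = nrm V ^+ 2 + nrm D ^+ 2 by exact: nrm_tanp_split.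
have hV := rip W; rewrite -/V in hV.
have E : ip W (POm W) = ip V (POm V) + 2 * ip D (POm V) + ip D (POm D).
  rewrite {1 2}WE P_OmegaD ipDl !ipDr -[ip V (POm D)]ip_P_Omega.
  by rewrite (ipC (POm V) D); ring.
have cD := cauchy_schwarz D (POm V).
have cDD := le_trans (ler_norm _) (cauchy_schwarz D (POm D)).
have dD : 0 <= ip D (POm D).
  have := hL D; have := sqr_ge0 (nrm (POm D)) => h1 /(le_trans h1).
  by rewrite pmulr_rge0.
have hV2 := hL V; have hD := nrm_P_Omega_le D.
set z := nrm W in dW split *; set d := nrm D in dW split cD cDD hD.
set v := nrm V in split hV; set u := nrm (POm V) in cD hV2.
have z0 : 0 <= z := nrm_ge0 W; have d0 : 0 <= d := nrm_ge0 D.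
have v0 : 0 <= v := nrm_ge0 V; have u0 : 0 <= u := nrm_ge0 (POm V).
clearbody z d v u.
have v2 : v ^+ 2 <= z ^+ 2 by rewrite split lerDl sqr_ge0.
have ep : 0 < eps * p by exact: mulr_gt0.
(* This bound is of order [s] and not [p], which is why the assumption on [delta * L] contains a
   factor [s]. [L] stands in for its square root, as [1 <= L]. *)
have u_le : u <= 11 / 10 * (L * s * z).
  apply: le_of_sqr_le => //; first by rewrite !mulr_ge0 // ltW.
  apply: le_trans hV2 _; move: hV; rewrite ler_norml => /andP[_ hV].
  have h1 : ip V (POm V) <= 9 / 8 * (p * z ^+ 2).
    have : eps * p * v ^+ 2 <= 1 / 8 * (p * z ^+ 2).
      rewrite -mulrA; apply: ler_pM => //; first exact: ltW.
        by rewrite mulr_ge0 ?sqr_ge0 // ltW.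
      by rewrite ler_wpM2l // ltW.
    have : p * v ^+ 2 <= p * z ^+ 2 by rewrite ler_wpM2l // ltW.
    lra.
  apply: le_trans (ler_wpM2l (ltW L0) h1) _.
  have pz : 0 <= p * z ^+ 2 by rewrite mulr_ge0 ?sqr_ge0 // ltW.
  have -> : (11 / 10 * (L * s * z)) ^+ 2 = 121 / 100 * (L * (L * (p * z ^+ 2))).
    by rewrite sp; field.
  have : L * (p * z ^+ 2) <= L * (L * (p * z ^+ 2)).
    by rewrite ler_wpM2l ?(ltW L0) // ler_peMl.
  have : 0 <= L * (p * z ^+ 2) by rewrite mulr_ge0 // ltW.
  lra.
have t1 : `|ip D (POm V)| <= 33 / 100 * (eps * p * z ^+ 2).
  apply: le_trans cD _.
  apply: le_trans (ler_pM d0 u0 dW u_le) _.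
  have -> : 6 * delta * z * (11 / 10 * (L * s * z)) =
      66 / 10 * (delta * L) * (s * z ^+ 2) by field.
  have -> : 33 / 100 * (eps * p * z ^+ 2) =
      66 / 10 * (s * eps / 20) * (s * z ^+ 2) by rewrite sp; field.
  rewrite ler_wpM2r ?mulr_ge0 ?sqr_ge0 ?(ltW s0) //.
  by rewrite ler_wpM2l.
have dd : d ^+ 2 <= 36 * delta ^+ 2 * z ^+ 2.
  have -> : 36 * delta ^+ 2 * z ^+ 2 = (6 * delta * z) ^+ 2 by ring.
  by rewrite lerXn2r ?nnegrE // !mulr_ge0.
have de : delta * (delta * L) <= 1 / 400 * (eps * p).
  apply: le_trans (ler_pM delta0 _ delta_le deltaL) _.
    by rewrite mulr_ge0 // ltW.
  have -> : s * eps / 20 * (s * eps / 20) = 1 / 400 * (eps * p) * eps.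
    by rewrite sp; field.
  have q : 0 <= 1 / 400 * (eps * p) by apply: mulr_ge0 (ltW ep); lra.
  by rewrite ler_piMr //; move: eps1; lra.
have t2 : ip D (POm D) <= 9 / 100 * (eps * p * z ^+ 2).
  apply: le_trans cDD _; apply: le_trans (ler_wpM2l d0 hD) _.
  have -> : d * (L * d) = L * d ^+ 2 by ring.
  apply: le_trans (ler_wpM2l (ltW L0) dd) _.
  have -> : L * (36 * delta ^+ 2 * z ^+ 2) = 36 * (delta * (delta * L)) * z ^+ 2.
    by ring.
  have -> : 9 / 100 * (eps * p * z ^+ 2) = 36 * (1 / 400 * (eps * p)) * z ^+ 2.
    by field.
  by rewrite ler_wpM2r ?sqr_ge0 // ler_wpM2l.
have t3 : p * d ^+ 2 <= 9 / 100 * (eps * p * z ^+ 2).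
  apply: le_trans (ler_wpM2l (ltW p0) dd) _.
  have -> : p * (36 * delta ^+ 2 * z ^+ 2) = 36 * (delta * delta * p) * z ^+ 2.
    by ring.
  have -> : 9 / 100 * (eps * p * z ^+ 2) = 36 * (1 / 400 * (eps * p)) * z ^+ 2.
    by field.
  rewrite ler_wpM2r ?sqr_ge0 // ler_wpM2l //; apply: le_trans de.
  rewrite -mulrA ler_wpM2l // ler_wpM2l //; apply: le_trans L1.
  by rewrite sp expr_le1 // ltW.
have t4 : eps * p * v ^+ 2 <= eps * p * z ^+ 2 by rewrite ler_wpM2l // ltW.
have t5 : 0 <= eps * p * z ^+ 2 by rewrite mulr_ge0 ?sqr_ge0 // ltW.
have t6 : 0 <= p * d ^+ 2 by rewrite mulr_ge0 ?sqr_ge0 // ltW.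
have t7 : p * z ^+ 2 = p * v ^+ 2 + p * d ^+ 2 by rewrite split mulrDr.
move: hV t1; rewrite E t7 !ler_norml => /andP[a1 a2] /andP[a3 a4].
have -> : 4 * eps * p * z ^+ 2 = 4 * (eps * p * z ^+ 2) by ring.
by apply/andP; split; lra.
Qed.

Lemma nrm_P_Omega_tangent Z : nrm (POm (Tl Z)) <= 13 / 10 * (L * s * nrm (Tl Z)).
Proof.
have hr := tangent_rip Z; set W := Tl Z in hr *.
have z0 := nrm_ge0 W; have z2 := sqr_ge0 (nrm W).
apply: le_of_sqr_le; rewrite ?nrm_ge0 //; first by rewrite !mulr_ge0 // ltW.
apply: le_trans (hL W) _.
have pz : 0 <= p * nrm W ^+ 2 by rewrite mulr_ge0 // ltW.
have h1 : ip W (POm W) <= 3 / 2 * (p * nrm W ^+ 2).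
  have : 4 * eps * p * nrm W ^+ 2 <= 1 / 2 * (p * nrm W ^+ 2).
    by rewrite -mulrA ler_wpM2r //; move: eps1; lra.
  by move: hr; rewrite ler_norml => /andP[_]; lra.
apply: le_trans (ler_wpM2l (ltW L0) h1) _.
have -> : (13 / 10 * (L * s * nrm W)) ^+ 2 = 169 / 100 * (L * (L * (p * nrm W ^+ 2))).
  by rewrite sp; field.
have : L * (p * nrm W ^+ 2) <= L * (L * (p * nrm W ^+ 2)).
  by rewrite ler_wpM2l ?(ltW L0) // ler_peMl.
have : 0 <= L * (p * nrm W ^+ 2) by rewrite mulr_ge0 // ltW.
lra.
Qed.

Lemma tangent_rip2 A B :
  `|ip (Tl A) (POm (Tl B)) - p * ip (Tl A) (Tl B)| <=
  4 * eps * p * nrm (Tl A) * nrm (Tl B).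
Proof.
pose f A B := ip (Tl A) (POm (Tl B)) - p * ip (Tl A) (Tl B).
have := @polarization_bound R n n f (4 * eps * p).
move=> h; have := h _ _ _ _ (Tl A) (Tl B); rewrite /f !(tanpK hPl hQl).
apply; rewrite /f {h}.
- by move=> A' B' C; rewrite tanpD !ipDl; ring.
- by move=> a A' B'; rewrite tanpZ !ipZl; ring.
- by move=> A' B'; rewrite -ip_P_Omega ipC (ipC (Tl A')).
- move=> A'; rewrite -nrm_sq; apply: le_trans (tangent_rip A') _.
  rewrite ler_wpM2l ?lerXn2r ?nnegrE ?nrm_ge0 //; last exact: nrm_tanp.
  by rewrite !mulr_ge0 // ltW.
Qed.

Local Notation D := (X - Y).
Local Notation g := (Tl (POm D)).

(** [Y] lies in its own tangent space, so the normal part of [X - Y] is that of [X]; one factor of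
    its quadratic bound is spent on [delta * sigma]. *)
Lemma residual_le : nrm (D - Tl D) <= delta * nrm D.
Proof.
have -> : D - Tl D = (1%:M - Y *m H) *m X *m (1%:M - H *m Y).
  have YH0 : (1%:M - Y *m H) *m Y = 0.
    by rewrite mulmxBl mul1mx; case: hY => -> *; rewrite subrr.
  by rewrite /tanp opprB addrC subrK (mulmxBr _ X Y) YH0 subr0.
apply: le_trans (tangent_residual hX hY) _.
by rewrite expr2 mulrAC ler_wpM2r ?nrm_ge0 // ler_pdivrMr.
Qed.

(** Tested against itself, the error meets [tangent_rip2] and the normal part [N] of [D], which
    contribute 4 and at most 1/10. *)
Lemma gradient_error : nrm (g - p *: Tl D) <= 41 / 10 * (eps * p * nrm D).
Proof.
set E := g - p *: Tl D.
have TE : Tl E = E by rewrite /E (tanpB _ _ g) tanpZ !(tanpK hPl hQl).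
apply: nrm_le_of_ip; first by rewrite !mulr_ge0 ?nrm_ge0 // ltW.
set N := D - Tl D.
have DE : D = Tl D + N by rewrite [RHS]addrC subrK.
have -> : ip E E = (ip (Tl E) (POm (Tl D)) - p * ip (Tl E) (Tl D)) +
    ip (POm (Tl E)) N.
  rewrite {2}/E ipBr ipZr -ip_tanp // TE ip_P_Omega {1}DE P_OmegaD ipDr; ring.
have h1 := tangent_rip2 E D.
have h2 := cauchy_schwarz (POm (Tl E)) N.
have h3 := nrm_P_Omega_tangent E.
rewrite TE in h1 h2 h3 *.
have h4 : nrm (POm E) * nrm N <= 1 / 10 * (eps * p * nrm D) * nrm E.
  apply: le_trans (ler_pM (nrm_ge0 _) (nrm_ge0 _) h3 residual_le) _.
  have -> : 13 / 10 * (L * s * nrm E) * (delta * nrm D) =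
    13 / 10 * (delta * L) * (s * nrm E * nrm D) by ring.
  apply: le_trans (_ : 13 / 10 * (s * eps / 20) * (s * nrm E * nrm D) <= _).
    by rewrite ler_wpM2r ?mulr_ge0 ?nrm_ge0 ?(ltW s0) // ler_wpM2l.
  have q : 0 <= eps * p * nrm D * nrm E by rewrite !mulr_ge0 ?nrm_ge0 // ltW.
  have -> : 13 / 10 * (s * eps / 20) * (s * nrm E * nrm D) =
    13 / 200 * (eps * p * nrm D * nrm E) by rewrite sp; field.
  rewrite -[1 / 10 * _ * _]mulrA; lra.
have h5 : 4 * eps * p * nrm E * nrm (Tl D) <= 4 * (eps * p * nrm D) * nrm E.
  have -> : 4 * (eps * p * nrm D) * nrm E = 4 * eps * p * nrm E * nrm D by ring.
  apply: ler_wpM2l; last exact: nrm_tanp hPl hQl D.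
  by rewrite !mulr_ge0 ?nrm_ge0 // ltW.
apply: le_trans (ler_normD _ _) _; lra.
Qed.

Lemma gradient_le : nrm g <= p * (1 + 5 * eps) * nrm D.
Proof.
have h := gradient_error; have h2 := nrmD (g - p *: Tl D) (p *: Tl D).
rewrite subrK nrmZ ger0_norm ?(ltW p0) // in h2.
have h3 := ler_wpM2l (ltW p0) (nrm_tanp hPl hQl D).
have q : 0 <= eps * p * nrm D by rewrite !mulr_ge0 ?nrm_ge0 // ltW.
lra.
Qed.

(** Three errors add up: the normal part of [D], the wrong step length on the tangent part, and the
    gradient error scaled by [alpha]. They are rounded up to [5 * eps] so that twice the factor, at
    the step error [4 * eps / Dn] of [search_direction], is exactly the first fraction of [tau1]. *)
Lemma gradient_step (alpha ea : R) : `|p * alpha - 1| <= ea ->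
  nrm (D - alpha *: g) <= (ea + 5 * eps * (1 + ea)) * nrm D.
Proof.
move=> ha; have ea0 : 0 <= ea by apply: le_trans ha.
have -> : D - alpha *: g = (D - Tl D) + ((1 - p * alpha) *: Tl D -
    alpha *: (g - p *: Tl D)).
  by move: g (Tl D) => b a; apply/matrixP => i j; rewrite !mxE; ring.
have d0 := nrm_ge0 D.
apply: le_trans (nrmD _ _) _.
apply: le_trans (lerD residual_le (nrmD _ _)) _.
rewrite nrmN !nrmZ distrC.
have h1 : `|p * alpha - 1| * nrm (Tl D) <= ea * nrm D.
  by apply: ler_pM; rewrite ?nrm_ge0 ?nrm_tanp.
have ap := abs_scale_le ha.
have h2 : `|alpha| * nrm (g - p *: Tl D) <= 41 / 10 * eps * (1 + ea) * nrm D.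
  apply: le_trans (ler_wpM2l (normr_ge0 _) gradient_error) _.
  have -> : `|alpha| * (41 / 10 * (eps * p * nrm D)) =
    41 / 10 * eps * nrm D * (p * `|alpha|) by ring.
  have -> : 41 / 10 * eps * (1 + ea) * nrm D = 41 / 10 * eps * nrm D * (1 + ea).
    by ring.
  by rewrite ler_wpM2l // !mulr_ge0 // ltW.
have h3 : delta * nrm D <= eps / 20 * nrm D by rewrite ler_wpM2r.
have h4 : 0 <= eps * nrm D by rewrite mulr_ge0 // ltW.
have h5 : 0 <= eps * ea * nrm D by rewrite !mulr_ge0 // ltW.
lra.
Qed.

End Local.

Section SearchDirection.
Context {R : realType}.

(** By conjugacy the denominator of the step length is [ip g (P_Omega Om S)], so the step error is a
    single near-isometry error, of size [nrm g * nrm S] against [nrm S ^+ 2]. The restart tests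
    bound the weight by [E] and keep [nrm g] comparable to [nrm S]. *)
Theorem search_direction n m (Om : sample n m) (P Q g q : 'M[R]_n)
    (p eps k1 k2 : R) :
  let T := tanp P Q in
  let Dn := (1 - 4 * eps) - k1 * (1 + 4 * eps) in
  let E := (4 * k2 * eps + k1 * k2) / (1 - 4 * eps) in
  let S := g + restart_beta k1 k2 Om g q *: q in
  0 < p -> 0 < eps -> eps <= 1 / 8 -> 0 <= k1 -> 0 <= k2 -> 0 < Dn ->
  (forall A B, `|ip (T A) (P_Omega Om (T B)) - p * ip (T A) (T B)| <=
     4 * eps * p * nrm (T A) * nrm (T B)) ->
  T g = g -> T q = q ->
  [/\ `|restart_beta k1 k2 Om g q| <= E,
      S = 0 -> g = 0 &
      S != 0 -> `|p * (ip g S / ip S (P_Omega Om S)) - 1| <= 4 * eps / Dn].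
Proof.
move=> T Dn E S p0 e0 e1 k10 k20 Dn0 rip Tg Tq.
have f0 : 0 < 1 - 4 * eps by lra.
(* Positivity of [Dn] forces this; it serves to pass from [k1 + 4 * eps] to [1 + 4 * eps]. *)
have k11 : k1 <= 1 by rewrite /Dn in Dn0; nra.
have E0 : 0 <= E.
  by rewrite /E divr_ge0 ?(ltW f0) // addr_ge0 ?mulr_ge0 // ltW.
have hgg := rip g g; have hgq := rip g q; have hqq := rip q q.
rewrite Tg Tq -?nrm_sq in hgg hgq hqq.
have G0 := nrm_ge0 g; have Q0 := nrm_ge0 q.
set b := restart_beta _ _ _ _ _ in S *.
have TS : T S = S.
  have Tg' : tanp P Q g = g := Tg; have Tq' : tanp P Q q = q := Tq.
  by rewrite /T /S tanpD tanpZ Tg' Tq'.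
have hgS := rip g S; have hSS := rip S S.
rewrite Tg TS -?nrm_sq in hgS hSS.
have SE : S = g + b *: q by [].
clearbody S.
have [bE gS adj] : [/\ `|b| <= E, nrm g ^+ 2 * Dn <= ip g S * (1 - 4 * eps) &
    ip S (P_Omega Om S) = ip g (P_Omega Om S)].
  move: SE; rewrite /b /restart_beta; case: ifP => [hc|_] SE.
    case/and4P: hc => g0 q0; have gp := nrm_gt0 g0; have qp := nrm_gt0 q0.
    rewrite ler_pdivrMr ?mulr_gt0 // => hk1 hk2.
    set y := ip q (P_Omega Om q) in hqq SE *.
    set x := ip g (P_Omega Om q) in hgq SE *.
    set c := ip g q in hgq hk1.
    have y0 : p * (1 - 4 * eps) * nrm q ^+ 2 <= y.
      by move: hqq; rewrite ler_norml => /andP[h _]; lra.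
    have yp : 0 < y by apply: lt_le_trans y0; rewrite !mulr_gt0 ?exprn_gt0.
    have hx : `|x| <= p * (k1 + 4 * eps) * (nrm g * nrm q).
      have := ler_normD (x - p * c) (p * c); rewrite subrK.
      rewrite normrM (ger0_norm (ltW p0)); have := ler_wpM2l (ltW p0) hk1; lra.
    have hb : `|- (x / y)| * nrm q * (1 - 4 * eps) <= (k1 + 4 * eps) * nrm g.
      rewrite normrN normrM normfV (gtr0_norm yp).
      have -> : `|x| / y * nrm q * (1 - 4 * eps) = `|x| * nrm q * (1 - 4 * eps) / y.
        by field; rewrite gt_eqF.
      rewrite ler_pdivrMr //.
      have kg : 0 <= (k1 + 4 * eps) * nrm g.
        by rewrite mulr_ge0 // ?addr_ge0 // mulr_ge0 // ltW.
      apply: le_trans (ler_wpM2l kg y0).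
      have fq : 0 <= nrm q * (1 - 4 * eps) by rewrite mulr_ge0 // ltW.
      have := ler_wpM2r fq hx; lra.
    split.
    - rewrite /E ler_pdivlMr // -(ler_pM2r qp).
      have : (k1 + 4 * eps) * nrm g <= (k1 + 4 * eps) * (k2 * nrm q).
        by rewrite ler_wpM2l // addr_ge0 // mulr_ge0 // ltW.
      move: hb; lra.
    - rewrite SE ipDr ipZr -nrm_sq -/c.
      have h1 : - (x / y) * c >= - (`|- (x / y)| * (k1 * (nrm g * nrm q))).
        rewrite lerNl -mulNr; apply: le_trans (ler_norm _) _.
        by rewrite normrM normrN ler_wpM2l.
      have h2 : `|- (x / y)| * (k1 * (nrm g * nrm q)) * (1 - 4 * eps) <=
          k1 * (k1 + 4 * eps) * nrm g ^+ 2.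
        have := ler_wpM2l (mulr_ge0 k10 G0) hb; rewrite expr2; lra.
      have h3 : k1 * (k1 + 4 * eps) * nrm g ^+ 2 <= k1 * (1 + 4 * eps) * nrm g ^+ 2.
        by rewrite ler_wpM2r ?sqr_ge0 // ler_wpM2l // lerD2r.
      have h4 := ler_wpM2r (ltW f0) h1.
      rewrite /Dn; lra.
    - (* [beta] is chosen so that [S] is conjugate to [q]. *)
      rewrite {1}SE ipDl ipZl.
      suff -> : ip q (P_Omega Om S) = 0 by rewrite mulr0 addr0.
      rewrite SE P_OmegaD P_OmegaZ ipDr ipZr -ip_P_Omega ipC -/x -/y.
      by rewrite mulNr divfK ?subrr // gt_eqF.
  split; first by rewrite normr0.
    rewrite SE scale0r addr0 -nrm_sq ler_wpM2l ?sqr_ge0 // /Dn.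
    have h : 0 <= k1 * (1 + 4 * eps) by rewrite mulr_ge0 //; lra.
    by move: h; lra.
  by rewrite {1}SE scale0r addr0.
split=> // [S0|S0].
  move: gS; rewrite S0 ip0r mul0r pmulr_lle0 // => h.
  apply/nrm_eq0/eqP; rewrite -sqrf_eq0; apply/eqP/le_anti.
  by rewrite h sqr_ge0.
have N0 := nrm_gt0 S0.
have y0 : p * (1 - 4 * eps) * nrm S ^+ 2 <= ip S (P_Omega Om S).
  by move: hSS; rewrite ler_norml => /andP[h _]; lra.
have yp : 0 < ip S (P_Omega Om S).
  by apply: lt_le_trans y0; rewrite !mulr_gt0 ?exprn_gt0.
have -> : p * (ip g S / ip S (P_Omega Om S)) - 1 =
    - (ip g (P_Omega Om S) - p * ip g S) / ip S (P_Omega Om S).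
  by rewrite -adj; field; rewrite gt_eqF.
rewrite normrM normrN normfV (gtr0_norm yp) ler_pdivrMr //.
apply: le_trans hgS _; apply: le_trans (ler_wpM2l _ y0); last first.
  by rewrite divr_ge0 ?mulr_ge0 // ltW.
rewrite [leRHS]mulrAC ler_pdivlMr // expr2.
have GN : nrm g * Dn <= nrm S * (1 - 4 * eps).
  have [->|G1] := eqVneq (nrm g) 0; first by rewrite mul0r mulr_ge0 // ltW.
  have Gp : 0 < nrm g by rewrite lt_neqAle eq_sym G1.
  rewrite -(ler_pM2l Gp) mulrA -expr2; apply: le_trans gS _.
  rewrite mulrA ler_wpM2r ?(ltW f0) //.
  exact: le_trans (ler_norm _) (cauchy_schwarz _ _).
have c0 : 0 <= 4 * eps * p * nrm S by rewrite !mulr_ge0 // ltW.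
have := ler_wpM2l c0 GN; lra.
Qed.

End SearchDirection.

(** * Linear convergence *)

Section Convergence.
Context {R : realType}.

(* The recursion [c' <= A c + d], [d' <= (2 + A) E c + E d] is contracted by
   the weighted sum [c + t d] as soon as the companion polynomial
   [x^2 - (A + E) x - 2 E] is positive at 1. *)
Lemma lyapunov_weight (A E : R) : 0 <= A -> 0 <= E -> A + E + 2 * E < 1 ->
  exists t nu, [/\ 0 < t, 0 <= nu < 1 & forall c d, 0 <= c -> 0 <= d ->
    A * c + d + t * ((2 + A) * E * c + E * d) <= nu * (c + t * d)].
Proof.
move=> A0 E0 AE; have E1 : 0 < 1 - E by lra.
pose D := 1 - A - 3 * E; have D0 : 0 < D by rewrite /D; lra.
(* A [t] slightly above [1 / (1 - E)] makes the coefficient of [d] contract strictly, and the excess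
   [D / 2] uses up at most half of the margin [D] in the coefficient of [c]. *)
pose t := (1 + D / 2) / (1 - E).
have tE : t * (1 - E) = 1 + D / 2 by rewrite /t divfK // gt_eqF.
have t0 : 0 < t by rewrite divr_gt0 //; lra.
have B1 : (2 + A) * E <= 1 by nra.
have h1 : A + t * ((2 + A) * E) < 1.
  rewrite -(ltr_pM2r E1) mulrDl -mulrA [_ * (1 - E)]mulrC.
  have -> : t * ((2 + A) * E * (1 - E)) = (1 + D / 2) * ((2 + A) * E).
    by rewrite -tE; ring.
  have : D / 2 * ((2 + A) * E) <= D / 2 by rewrite ler_piMr //; lra.
  rewrite /D; nra.
have h2 : 1 + t * E < t by lra.
pose nu := Num.max (A + t * ((2 + A) * E)) ((1 + t * E) / t).
exists t, nu; split=> //.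
  rewrite /nu gt_max h1 ltr_pdivrMr // mul1r h2 !andbT le_max.
  have q : 0 <= t * ((2 + A) * E).
    by apply: mulr_ge0; [exact: ltW | apply: mulr_ge0 => //; rewrite addr_ge0].
  by rewrite addr_ge0.
move=> c d c0 d0.
have n1 : A + t * ((2 + A) * E) <= nu by rewrite /nu le_max lexx.
have n2 : 1 + t * E <= nu * t.
  by rewrite -ler_pdivrMr // /nu le_max lexx orbT.
have := ler_wpM2r c0 n1; have := ler_wpM2r d0 n2; lra.
Qed.

Lemma contraction_eq0 (c e : R) : 0 <= c -> e < 1 -> c <= e * c -> c = 0.
Proof. by move=> c0 e1 ce; apply/le_anti; rewrite c0 andbT; nra. Qed.

(** The contracted potential is the error plus [t * bc] times the norm of the previous direction,
    which is 0 at the start. The invariant also records that each iterate is a hard thresholding,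
    from which [hard_threshold_svd] extracts its reduced SVD. *)
Theorem rcg_rate n r m (X G : 'M[R]_n) (Om : sample n m) (Xs : nat -> 'M[R]_n)
    (p s L eps delta k1 k2 : R) :
  (0 < r <= n)%N -> \rank X = r -> is_pinv X G (sigma_min X) ->
  0 < sigma_min X -> \tr (G *m X) = r%:R ->
  0 < s -> s <= 1 -> p = s ^+ 2 -> 1 <= L -> 0 <= k1 -> 0 <= k2 ->
  admissible (RestartedRCG k1 k2) eps ->
  (forall Z, let W := tanp (X *m G) (G *m X) Z in
    `|ip W (P_Omega Om W) - p * nrm W ^+ 2| <= eps * p * nrm W ^+ 2) ->
  (forall Z, nrm (P_Omega Om Z) ^+ 2 <= L * ip Z (P_Omega Om Z)) ->
  0 <= delta -> delta * L <= s * eps / 20 ->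
  (exists Z, is_hard_threshold r Z (Xs 0%N)) ->
  nrm (X - Xs 0%N) <= delta * sigma_min X ->
  rcg_run r k1 k2 X Om Xs ->
  exists2 nu, 0 <= nu < 1 & forall l, nrm (X - Xs l) <= nu ^+ l * nrm (X - Xs 0%N).
Proof.
move=> /andP[r0 rn] rkX hX sig0 trX s0 s1 sp L1 k10 k20 [eps0 Dn0 tau] rip hL
  delta0 deltaL X0 close0 [Ps run].
have p0 : 0 < p by rewrite sp exprn_gt0.
set Dn := _ - _ * _ in Dn0.
have kk : 0 <= k1 * (1 + 4 * eps) by rewrite mulr_ge0 //; lra.
have f0 : 0 < 1 - 4 * eps by rewrite /Dn in Dn0; lra.
pose E := (4 * k2 * eps + k1 * k2) / (1 - 4 * eps).
pose ea := 4 * eps / Dn.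
pose a := 2 * (ea + 5 * eps * (1 + ea)).
have E0 : 0 <= E.
  by rewrite /E divr_ge0 ?(ltW f0) // addr_ge0 ?mulr_ge0 // ltW.
have ea0 : 0 <= ea by rewrite /ea divr_ge0 ?mulr_ge0 // ltW.
have a10 : 10 * eps <= a.
  have h : 0 <= eps * ea by rewrite mulr_ge0 // ltW.
  by rewrite /a; lra.
have a0 : 0 <= a by lra.
have tau' : a + E + 2 * E < 1.
  apply: le_lt_trans tau; rewrite /tau1 /tau2 -/Dn -/E.
  have -> : (8 * k2 * eps + 2 * k1 * k2) / (1 - 4 * eps) = 2 * E.
    by rewrite /E; field; rewrite gt_eqF.
  rewrite lerD2r lerD2r le_eqVlt; apply/orP; left; apply/eqP.
  rewrite /a /ea /Dn; field; rewrite gt_eqF //.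
have eps1 : eps <= 1 / 8 by lra.
have [t [nu [t0 nu01 hnu]]] := lyapunov_weight a0 E0 tau'.
have /andP[nu0 nu1] := nu01.
exists nu => // .
(* [a], [E] are the coefficients of the recursion: [tau1 = a + E] and
   [tau2 = 2 E]. *)
pose prev l := if l is l'.+1 then nrm (Ps l') else 0.
(* The factor with which the previous direction enters the error after thresholding; in this scaling
   the recursion for directions has coefficients exactly [(2 + a) * E] and [E]. *)
pose bc := 2 * (1 + ea) * E / p.
have ea1 : 0 <= 1 + ea by rewrite addr_ge0.
have bc0 : 0 <= bc.
  rewrite /bc; apply: divr_ge0; last exact: ltW.
  by apply: mulr_ge0 => //; apply: mulr_ge0.
have prev0 l : 0 <= prev l by case: l => //= l; exact: nrm_ge0.
have tb l : 0 <= t * (bc * prev l).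
  by apply: mulr_ge0; [exact: ltW | exact: mulr_ge0].
set c0 := nrm (X - Xs 0%N).
have c00 : 0 <= c0 by exact: nrm_ge0.
have [Q [d [OO XX]]] : exists (Q : 'M[R]_n) (d : 'rV[R]_n),
    Q *m Q^T = 1%:M /\ X^T *m X = Q^T *m diag_mx d *m Q.
  by apply: sym_spectral; rewrite trmx_mul trmxK.
suff inv l : (exists Z, is_hard_threshold r Z (Xs l)) /\
    nrm (X - Xs l) + t * (bc * prev l) <= nu ^+ l * c0.
  move=> l; have [_] := inv l; apply: le_trans.
  by rewrite lerDl tb.
elim: l => [|l [[Z hZ] hl]].
  by split=> //; rewrite /= !mulr0 addr0 expr0 mul1r.
set Y := Xs l in hZ hl.
have eY : nrm (X - Y) <= c0.
  have h1 : nrm (X - Y) <= nrm (X - Y) + t * (bc * prev l).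
    by rewrite lerDl tb.
  apply: le_trans h1 _; apply: le_trans hl _.
  by rewrite ler_piMl // exprn_ile1 // ltW.
have close : nrm (X - Y) <= delta * sigma_min X by apply: le_trans close0.
have d1 : delta <= 1 / 2.
  have h1 : delta <= delta * L by rewrite ler_peMr.
  have h2 : s * eps <= eps by rewrite ler_piMl // ltW.
  lra.
have close2 : nrm (X - Y) <= sigma_min X / 2.
  by apply: le_trans close _; have := ler_wpM2r (ltW sig0) d1; lra.
have lt1 : nrm (X - Y) < sigma_min X by lra.
have [U [V [sv [hsvd hsv]]]] := hard_threshold_svd rn OO XX r0 rkX hZ lt1.
have [[UU VV _ _ YE] _] := hsvd.
have sig2 : 0 < sigma_min X / 2 by lra.
have hsv2 i : sigma_min X / 2 <= sv 0 i by apply: le_trans (hsv i); lra.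
have [H [hY YH HY]] := svd_pinv UU VV YE sig2 hsv2.
have sig3 : sigma_min X <= 2 * (sigma_min X / 2) by lra.
have TlE W : proj_tangent r Y W = tanp (Y *m H) (H *m Y) W.
  by rewrite (proj_tangentE _ hsvd) YH HY.
have hPl := pinv_left hY; have hQl := pinv_right hY.
have := run l; cbv zeta; rewrite -/Y; set g := proj_tangent r Y _.
have gE : g = tanp (Y *m H) (H *m Y) (P_Omega Om (X - Y)) by rewrite /g TlE.
set q := (if l is l'.+1 then proj_tangent r Y (Ps l') else 0).
have qn : nrm q <= prev l.
  rewrite /q /prev; case: (l) => [|l']; first by rewrite nrm0.
  by rewrite TlE nrm_tanp.
have Tg : tanp (Y *m H) (H *m Y) g = g by rewrite gE tanpK.
have Tq : tanp (Y *m H) (H *m Y) q = q.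
  rewrite /q; case: (l) => [|l']; last by rewrite TlE tanpK.
  by rewrite -(scale0r 0) tanpZ !scale0r.
(* At the first step the previous direction is 0, for which [restart_beta] already returns 0. *)
have betaE : (if l is _.+1 then restart_beta k1 k2 Om g q else 0) =
    restart_beta k1 k2 Om g q.
  rewrite /q; case: (l) => // ; rewrite /restart_beta eqxx andbF //.
rewrite /= betaE => -[PsE].
set S := g + _ in PsE.
have TS : proj_tangent r Y S = S by rewrite TlE tanpD tanpZ Tg Tq.
rewrite PsE TS => step.
have rip2 := tangent_rip2 hX hY sig0 sig3 s0 s1 sp eps0 eps1 L1 rip hL delta0
  deltaL close.
have [bE S0 SN] := search_direction p0 eps0 eps1 k10 k20 Dn0 rip2 Tg Tq.
have gle := gradient_le hX hY sig0 sig3 s0 s1 sp eps0 eps1 L1 rip hL delta0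
  deltaL close.
have gstep := gradient_step hX hY sig0 sig3 s0 s1 sp eps0 eps1 L1 rip hL delta0
  deltaL close.
rewrite -gE in gle gstep.
set c := nrm (X - Y) in hl eY gle gstep *.
have c1 : 0 <= c by exact: nrm_ge0.
have nS : nrm S <= p * (1 + 5 * eps) * c + E * prev l.
  apply: le_trans (nrmD _ _) _; rewrite nrmZ; apply: lerD => //.
  by apply: ler_pM; rewrite ?nrm_ge0.
have dS : bc * nrm S <= (2 + a) * E * c + E * (bc * prev l).
  apply: le_trans (ler_wpM2l bc0 nS) _; rewrite le_eqVlt; apply/orP; left.
  by apply/eqP; rewrite /bc /a; field; rewrite gt_eqF.
suff [hthr cS] : (exists Z, is_hard_threshold r Z (Xs l.+1)) /\
    nrm (X - Xs l.+1) <= a * c + bc * prev l.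
  split=> //; rewrite exprS -[leRHS]mulrA.
  apply: le_trans (_ : nu * (c + t * (bc * prev l)) <= _); last by rewrite ler_wpM2l.
  apply: le_trans (hnu c (bc * prev l) c1 _); last by rewrite mulr_ge0.
  by apply: lerD => //; rewrite ler_wpM2l // ltW.
move: step; have [Sz|Sz] := eqVneq S 0.
  (* The iteration stops only at [X]: here [g = 0], and [gradient_step] with the ideal length [p^-1]
     bounds the error by [5 * eps] times itself. *)
  move=> ->; split; first by exists Z.
  have := gstep p^-1 0; rewrite mulfV ?gt_eqF // subrr normr0 S0 // scaler0 subr0.
  move=> /(_ (lexx 0)); rewrite -/Y -/c => h.
  have -> : c = 0 by apply: contraction_eq0 h => //; rewrite add0r addr0 mulr1; lra.
  by rewrite mulr0 add0r mulr_ge0.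
set alpha := _ / _; move=> hthr; split; first by eexists; exact: hthr.
have ha : `|p * alpha - 1| <= ea by exact: SN.
(* [X] itself competes in the best approximation of [W], so truncation at most doubles the error. *)
have hEY := eckart_young rn hthr (pinv_right hX) _ trX.
have {}hEY := hEY X; have XGX : X *m (G *m X) = X by rewrite mulmxA; case: hX.
have {}hEY := hEY XGX.
set W := Y + alpha *: S in hthr hEY.
have hW : nrm (X - Xs l.+1) <= 2 * nrm (X - W).
  apply: le_trans (nrm_triB X W (Xs l.+1)) _.
  by rewrite mulr_natl mulr2n lerD2l [leRHS]nrmB.
apply: le_trans hW _.
have -> : X - W = (X - Y - alpha *: g) - (alpha * restart_beta k1 k2 Om g q) *: q.
  rewrite /W /S scalerDr scalerA.
  by apply/matrixP => i j; rewrite !mxE; ring.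
have h1 := gstep _ _ ha.
have h2 : nrm ((alpha * restart_beta k1 k2 Om g q) *: q) <= (1 + ea) / p * (E * prev l).
  rewrite nrmZ normrM -[leLHS]mulrA; apply: ler_pM; rewrite ?mulr_ge0 ?nrm_ge0 //.
    by rewrite ler_pdivlMr // mulrC; exact: (abs_scale_le s0 sp ha).
  by apply: ler_pM; rewrite ?nrm_ge0.
rewrite -nrmN in h2.
have := le_trans (nrmD _ _) (lerD h1 h2).
have -> : a * c + bc * prev l = 2 * ((ea + 5 * eps * (1 + ea)) * c +
    (1 + ea) / p * (E * prev l)) by rewrite /a /bc; ring.
by rewrite ler_pM2l.
Qed.

End Convergence.

(** * Assembling the probability bound *)

Section Reductions.
Context {R : realType}.

Lemma mx_norm_le_nrm n (A : 'M[R]_n) : `|A| <= nrm A.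
Proof.
rewrite /Num.norm /= mx_normrE; apply: bigmax_le => [|ij _]; first exact: nrm_ge0.
exact: entry_le_nrm.
Qed.

Lemma entry_le_mx_norm n (A : 'M[R]_n) i j : `|A i j| <= `|A|.
Proof.
rewrite [leRHS]/Num.norm /= mx_normrE.
exact: (le_bigmax _ (fun ij : 'I_n * 'I_n => `|A ij.1 ij.2|) (i, j)).
Qed.

Lemma geometric_cvg n (X : 'M[R]_n) (Xs : nat -> 'M[R]_n) (nu c : R) :
  0 <= nu < 1 -> (forall l, nrm (X - Xs l) <= nu ^+ l * c) ->
  (Xs l @[l --> \oo] --> X)%classic.
Proof.
move=> /andP[nu0 nu1] h.
have c0 : 0 <= c by have := h 0%N; rewrite expr0 mul1r; apply: le_trans; exact: nrm_ge0.
have hnu : (nu ^+ l * c @[l --> \oo] --> (0 : R))%classic.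
  rewrite -(mul0r c); apply: cvgMl; apply: cvg_expr; by rewrite ger0_norm.
apply/cvgrPdist_lt => e e0.
move/cvgrPdist_lt : hnu => /(_ e e0); apply: filterS => l.
rewrite sub0r normrN ger0_norm ?mulr_ge0 ?exprn_ge0 // => hl.
apply: le_lt_trans hl; apply: le_trans (h l); exact: mx_norm_le_nrm.
Qed.

(** With [kappa2 = 0] the second restart test would force the projected residual to vanish, so every
    weight is 0; [proj_tangentK] identifies the two formulas for the step length. *)
Lemma rgrad_run_rcg n r m (X : 'M[R]_n) (Om : sample n m) Xs :
  rgrad_run r X Om Xs -> rcg_run r 0 0 X Om Xs.
Proof.
move=> run.
exists (fun l => proj_tangent r (Xs l) (P_Omega Om (X - Xs l))) => l; cbv zeta.
set g := proj_tangent r (Xs l) _.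
have b0 q : restart_beta 0 0 Om g q = 0.
  rewrite /restart_beta; case: ifP => // /and4P[g0 _ _]; rewrite mul0r => g1.
  by have := nrm_gt0 g0; rewrite ltNge g1.
have -> : (match l with 0%N => 0 | l'.+1 => restart_beta 0 0 Om g _ end) = 0 :> R.
  by case: (l).
rewrite scale0r addr0; split=> //.
have := run l; cbv zeta; rewrite -/g /g proj_tangentK -/g.
by rewrite nrm_sq.
Qed.

Lemma admissible_rgrad (e : R) : admissible RGrad e -> admissible (RestartedRCG 0 0) e.
Proof.
move=> [e0 e1 h]; split=> //; first by lra.
rewrite /tau1 /tau2 !(mul0r, mulr0, subr0, addr0); exact: h.
Qed.

Lemma rcg_of_run (alg : algorithm R) n r m (X : 'M[R]_n) (Om : sample n m) Xs e :
  valid_parameters alg -> admissible alg e -> is_run alg r X Om Xs ->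
  exists k1 k2, [/\ 0 <= k1, 0 <= k2, admissible (RestartedRCG k1 k2) e &
    rcg_run r k1 k2 X Om Xs].
Proof.
case: alg => [_ he [_ run]|k1 k2 [k10 k20 _] he [_ run]]; last by exists k1, k2.
by exists 0, 0; split=> //; [exact: admissible_rgrad | exact: rgrad_run_rcg].
Qed.

Lemma admissible_bounds (alg : algorithm R) e :
  valid_parameters alg -> admissible alg e -> 0 < e <= 1.
Proof.
case: alg => [_ [e0 e1 _]|k1 k2 [k10 k20 _] [e0 e1 _]]; first by apply/andP; split; lra.
by apply/andP; split=> //; nra.
Qed.

Lemma sample_probE n m (E : set (sample n m)) : (0 < n)%N ->
  sample_prob E = prob E :> R.
Proof.
move=> n0; rewrite /prob /expect mulr_suml /sample_prob big_mkcond /=.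
apply: eq_bigr => w _; rewrite prodr_const card_ord card_pairs mulnn exprVn.
by case: asboolP => _; rewrite ?mul1r ?mul0r.
Qed.

Lemma prob_ge (I : finType) m (E : {ffun 'I_m -> I} -> Prop) (a : R) :
  (0 < #|I|)%N -> prob (fun w => ~ E w) <= a -> 1 - a <= prob E.
Proof.
move=> I0 h; rewrite lerBlDr; apply: le_trans (lerD (lexx _) h).
rewrite -expectD -[leLHS](@expect_cst R I m 1 I0); apply: expect_le => w.
rewrite -natrD ler1n; case: (asboolP (E w)) => // nE.
by rewrite (asboolT nE).
Qed.

End Reductions.

Section Incoherence.
Context {R : realType}.

Lemma ip_mxvec p q (A B : 'M[R]_(p, q)) : ip (mxvec A) (mxvec B) = ip A B.
Proof.
rewrite /frob_inner big_ord1 pair_big.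
rewrite (reindex _ (curry_mxvec_bij p q)) /=; apply: eq_bigr => -[i j] _ /=.
by rewrite !mxvecE.
Qed.

Lemma nrm_mxvec p q (A : 'M[R]_(p, q)) : nrm (mxvec A) = nrm A.
Proof. by rewrite /frob_norm ip_mxvec. Qed.

Lemma ip_delta p q (A : 'M[R]_(p, q)) i j : ip A (delta_mx i j) = A i j.
Proof.
rewrite /frob_inner (bigD1 i) //= [X in _ + X]big1 => [|k /negPf ki].
  rewrite (bigD1 j) //= big1 => [|k /negPf kj]; first by rewrite mxE !eqxx mulr1 !addr0.
  by rewrite mxE kj andbF mulr0.
by apply: big1 => l _; rewrite mxE ki mulr0.
Qed.

Lemma sum_nrm_proj n (P : 'M[R]_n) : orthoproj P ->
  \sum_i nrm (P *m delta_mx i 0 : 'cV_n) ^+ 2 = \tr P.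
Proof.
move=> [sP PP]; apply: eq_bigr => i _; rewrite nrm_sq ip_mull sP mulmxA PP.
by rewrite ipC ip_delta -colE mxE.
Qed.

(** The squared norms of the projected basis vectors add up to the trace [r], while each is at most
    [mu0 * r / n]; this forces [1 <= mu0]. *)
Lemma incoherence n r (X G : 'M[R]_n) sigma mu0 : (0 < r)%N -> (0 < n)%N ->
  is_pinv X G sigma -> \tr (X *m G) = r%:R -> assumption_A0 r mu0 X ->
  1 <= mu0 /\ forall i,
    nrm (X *m G *m delta_mx i 0 : 'cV_n) ^+ 2 <= mu0 * r%:R / n%:R /\
    nrm (G *m X *m delta_mx i 0 : 'cV_n) ^+ 2 <= mu0 * r%:R / n%:R.
Proof.
move=> r0 n0 hX trX [hU hV].
have r0' : 0 < r%:R :> R by rewrite ltr0n.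
have n0' : 0 < n%:R :> R by rewrite ltr0n.
set x := mu0 * r%:R / n%:R in hU hV *.
have sq (u : R) : 0 <= u -> u <= Num.sqrt x -> u ^+ 2 <= Num.sqrt x ^+ 2.
  by move=> u0 ux; rewrite lerXn2r ?nnegrE ?sqrtr_ge0.
have hU' i : nrm (X *m G *m delta_mx i 0 : 'cV_n) ^+ 2 <= Num.sqrt x ^+ 2.
  by apply: sq; rewrite ?nrm_ge0 // -(orth_proj_col_space _ hX).
have hV' i : nrm (G *m X *m delta_mx i 0 : 'cV_n) ^+ 2 <= Num.sqrt x ^+ 2.
  apply: sq; rewrite ?nrm_ge0 //; have := hV i.
  rewrite (orth_proj_col_space _ (is_pinv_tr hX)) -trmx_mul.
  by have [-> _] := pinv_right hX.
have rx : r%:R <= n%:R * Num.sqrt x ^+ 2.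
  rewrite -trX -(sum_nrm_proj (pinv_left hX)).
  have -> : n%:R * Num.sqrt x ^+ 2 = \sum_(i < n) Num.sqrt x ^+ 2.
    by rewrite sumr_const card_ord mulr_natl.
  by apply: ler_sum => i _; exact: hU'.
(* A negative radicand would make the square root 0 and contradict [0 < r]. *)
have x0 : 0 <= x.
  rewrite leNgt; apply/negP => xn; move: rx.
  by rewrite ler0_sqrtr ?(ltW xn) // expr0n mulr0 leNgt r0'.
rewrite sqr_sqrtr // in hU' hV' rx; split; last by move=> i; split.
rewrite -(ler_pM2r r0') mul1r; apply: le_trans rx _.
by rewrite /x mulrC divfK // gt_eqF.
Qed.

(** After vectorization each entry of [tanp P Q Z] is the inner product of [Z] with one [f ij], so
    [ip W (P_Omega Om W)] is a sum of sampled squares as in [rank1_concentration], in dimension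
    [n^2]. *)
Lemma rip_probability n m (P Q : 'M[R]_n) (rho eps : R) q :
  let c := (n * n)%:R / m%:R in
  let K := 2 * (n * n)%:R * (32 * q%:R * (c * rho)) ^+ q in
  (0 < n)%N -> (0 < m)%N -> (0 < q)%N -> 0 < eps ->
  orthoproj P -> orthoproj Q ->
  (forall i j, nrm (tanp P Q (delta_mx i j)) ^+ 2 <= rho) -> K <= 1 / 2 ->
  prob (fun Om : sample n m => exists Z, let W := tanp P Q Z in
    eps * c^-1 * nrm W ^+ 2 <
    `|ip W (P_Omega Om W) - c^-1 * nrm W ^+ 2|) <= 4 * K / eps ^+ q.*2.
Proof.
move=> c K n0 m0 q0 eps0 hP hQ hrho hK.
have cp : #|{: 'I_n * 'I_n}| = (n * n)%N := card_pairs n.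
have I0 : (0 < #|{: 'I_n * 'I_n}|)%N by rewrite cp muln_gt0 n0.
have c0 : 0 < c by rewrite divr_gt0 // ltr0n // muln_gt0 n0.
pose f (ij : 'I_n * 'I_n) : 'rV[R]_(n * n) := mxvec (tanp P Q (delta_mx ij.1 ij.2)).
have ipf Z ij : ip (mxvec Z) (f ij) = (tanp P Q Z) ij.1 ij.2.
  by rewrite ip_mxvec -ip_tanp // ip_delta.
have hf ij : nrm (f ij) ^+ 2 <= rho by rewrite nrm_mxvec.
have sumT (Z : 'M[R]_n) : \sum_(ij : 'I_n * 'I_n) Z ij.1 ij.2 ^+ 2 = nrm Z ^+ 2.
  by rewrite nrm_sqE pair_big.
have hsub (x : 'rV[R]_(n * n)) : \sum_ij ip x (f ij) ^+ 2 <= nrm x ^+ 2.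
  rewrite -(vec_mxK x); under eq_bigr do rewrite ipf.
  by rewrite sumT nrm_mxvec lerXn2r ?nnegrE ?nrm_ge0 // nrm_tanp.
have := @rank1_concentration R _ m (n * n) f rho eps q I0 m0 q0 eps0 hf hsub.
rewrite cp -/c -/K => /(_ hK); apply: le_trans.
apply: prob_le => Om [Z hZ]; set W := tanp P Q Z in hZ.
exists (mxvec W).
under [X in _ * X - _]eq_bigr do rewrite ipf tanpK //.
under [X in _ - X]eq_bigr do rewrite ipf tanpK //.
rewrite sumT nrm_mxvec -ip_P_OmegaE -/W.
have -> : c * ip W (P_Omega Om W) - nrm W ^+ 2 =
    c * (ip W (P_Omega Om W) - c^-1 * nrm W ^+ 2).
  by rewrite mulrBr mulrA divff ?gt_eqF // mul1r.
have {}hZ : eps / c * nrm W ^+ 2 < `|ip W (P_Omega Om W) - c^-1 * nrm W ^+ 2|.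
  exact: hZ.
rewrite normrM gtr0_norm // [ltRHS]mulrC -ltr_pdivrMr //.
by rewrite mulrAC.
Qed.

End Incoherence.

Section Numerics.
Context {R : realType}.

Lemma expR1_le4 : expR 1 <= 4 :> R.
Proof.
have h : expR (1 / 2 : R) <= 2.
  have := expR_ge1Dx (- (1 / 2) : R); have := expRxMexpNx_1 (1 / 2 : R).
  by have := expR_gt0 (1 / 2 : R) => *; nra.
have -> : (1 : R) = 1 / 2 + 1 / 2 by field.
by rewrite expRD; have := expR_gt0 (1 / 2 : R) => *; nra.
Qed.

Lemma expR_nat_le k : expR k%:R <= (4 ^ k)%:R :> R.
Proof.
rewrite -[k%:R]mul1r expRM_natr natrX lerXn2r ?nnegrE ?expR_ge0 //.
exact: expR1_le4.
Qed.

Lemma ln_ge1 (x : R) : 9 <= x -> 1 <= ln x.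
Proof.
move=> x9; rewrite -ler_expR lnK; last by rewrite posrE; lra.
by have := expR1_le4; lra.
Qed.

Lemma pow_expN4_le (A y : R) q : 0 <= A -> A <= expR (- 4) -> y <= q%:R ->
  A ^+ q <= expR (- 4 * y).
Proof.
move=> A0 hA yq; apply: le_trans (_ : expR (- 4) ^+ q <= _).
  by rewrite lerXn2r ?nnegrE ?expR_ge0.
by rewrite -expRM_natr ler_expR; lra.
Qed.

Lemma powR_exp (x y : R) : 0 < x -> x `^ y = expR (y * ln x).
Proof. by move=> x0; rewrite /powR gt_eqF. Qed.

End Numerics.

(** The deterministic half: the complements of the three bad events enter as hypotheses. [delta] is
    the largest radius that [rcg_rate] accepts, and the last hypothesis puts the initial guess
    inside it. *)
Lemma good_sample_converges (R : realType) (alg : algorithm R) n r m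
    (X G : 'M[R]_n) (Om : sample n m) (eps L t : R) :
  let c := (n * n)%:R / m%:R in
  (0 < r <= n)%N -> (0 < m <= n ^ 2)%N -> \rank X = r ->
  is_pinv X G (sigma_min X) -> 0 < sigma_min X -> \tr (G *m X) = r%:R ->
  valid_parameters alg -> admissible alg eps -> 1 <= L -> 0 <= t ->
  (forall i j : 'I_n, (\sum_k delta_mx (Om k).1 (Om k).2 : 'M[R]_n) i j <= L) ->
  (forall Z, let W := tanp (X *m G) (G *m X) Z in
    `|ip W (P_Omega Om W) - c^-1 * nrm W ^+ 2| <= eps * c^-1 * nrm W ^+ 2) ->
  (forall x : 'rV[R]_n, nrm (x *m (c *: P_Omega Om X - X)) <= t * nrm x) ->
  2 * (Num.sqrt (2 * r%:R) * t) <=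
    Num.sqrt c^-1 * eps / (20 * L) * sigma_min X ->
  iterates_converge alg n r m X Om.
Proof.
move=> c rn /andP[m0 mn] rkX hX sig0 trX hv ha L1 t0 hL hrip hop hinit Xs run.
have [k1 [k2 [k10 k20 ha' rcg]]] := rcg_of_run hv ha run.
have /andP[eps0 eps1] := admissible_bounds hv ha.
have /andP[r0 rn'] := rn.
have n0 : (0 < n)%N by exact: leq_trans rn'.
have c1 : 1 <= c.
  by rewrite ler_pdivlMr ?ltr0n // mul1r ler_nat mulnn.
have c0 : 0 < c by apply: lt_le_trans c1.
have L0 : 0 < L by apply: lt_le_trans L1.
set s := Num.sqrt c^-1 in hinit.
have s0 : 0 < s by rewrite sqrtr_gt0 invr_gt0.
have s1 : s <= 1 by rewrite -sqrtr1 ler_sqrt // invf_le1.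
have sp : c^-1 = s ^+ 2 by rewrite sqr_sqrtr // invr_ge0 ltW.
pose delta := s * eps / (20 * L).
have delta0 : 0 <= delta.
  by rewrite /delta divr_ge0 ?mulr_ge0 // ltW.
have deltaL : delta * L <= s * eps / 20.
  by rewrite le_eqVlt; apply/orP; left; apply/eqP; rewrite /delta; field; rewrite gt_eqF.
have ht0 : is_hard_threshold r (c *: P_Omega Om X) (Xs 0%N).
  by case: run; rewrite invf_div /c mulnn.
have XQ : X *m (G *m X) = X by rewrite mulmxA; case: hX.
have close0 : nrm (X - Xs 0%N) <= delta * sigma_min X.
  apply: le_trans hinit.
  by apply: (init_bound rn' t0 (pinv_right hX) XQ trX ht0) => //; rewrite rkX.
have hP2 Z : nrm (P_Omega Om Z) ^+ 2 <= L * ip Z (P_Omega Om Z).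
  exact: nrm_P_Omega_sq.
have X0 : exists Z, is_hard_threshold r Z (Xs 0%N) by eexists; exact: ht0.
have [nu nu01 hnu] := rcg_rate rn rkX hX sig0 trX s0 s1 sp L1 k10 k20 ha' hrip hP2
  delta0 deltaL X0 close0 rcg.
exact: geometric_cvg nu01 hnu.
Qed.

Section SampleSize.
Context {R : realType} (N M b lg rr mu0 mu1 kap eps : R).
Hypotheses (N9 : 9 <= N) (b1 : 1 < b) (lg1 : 1 <= lg) (rr1 : 1 <= rr).
Hypotheses (mu01 : 1 <= mu0) (kap1 : 1 <= kap) (eps0 : 0 < eps) (eps1 : eps <= 1).
Hypothesis size : 2 * 10 ^+ 5 * b `^ (3 / 2)
      * Num.max (mu0 / eps ^+ 2) (mu1 * (1 + eps) / eps)
      * kap * N `^ (3 / 2) * rr * lg `^ (3 / 2) <= M.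

Let powR32_sq (x : R) : 0 < x -> (x `^ (3 / 2)) ^+ 2 = x ^+ 3.
Proof.
move=> x0; rewrite !powR_exp // -expRM_natr.
have -> : 3 / 2 * ln x * 2%:R = ln x * 3%:R by field.
by rewrite expRM_natr lnK.
Qed.

Let powR32_ge (x : R) : 1 <= x -> x <= x `^ (3 / 2).
Proof.
move=> x1; have x0 : 0 < x by lra.
rewrite -[leLHS]powRr1 ?(ltW x0) // ler_powR //; lra.
Qed.

Let Y := b `^ (3 / 2) * N `^ (3 / 2) * lg `^ (3 / 2).

(** From the first entry of the maximum; [x <= x^(3/2)] for [x >= 1] and [1 <= kap] discard the
    surplus. *)
Lemma size_rip : 2 * 10 ^+ 5 * (b * lg) * N * mu0 * rr <= M * eps ^+ 2.
Proof.
have N1 : 1 <= N by move: N9; lra.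
have b0 : 1 <= b by move: b1; lra.
have hb := powR32_ge b0; have hN := powR32_ge N1; have hl := powR32_ge lg1.
have q0 : 0 <= mu0 / eps ^+ 2 by rewrite divr_ge0 ?sqr_ge0 //; move: mu01; lra.
have ge0 (x : R) : 1 <= x -> 0 <= x by lra.
have e2 : 0 < eps ^+ 2 by rewrite exprn_gt0.
rewrite -ler_pdivrMr //; apply: le_trans size.
have -> : 2 * 10 ^+ 5 * (b * lg) * N * mu0 * rr / eps ^+ 2 =
  2 * 10 ^+ 5 * b * (mu0 / eps ^+ 2) * 1 * N * rr * lg by field; rewrite gt_eqF.
have mx : mu0 / eps ^+ 2 <= Num.max (mu0 / eps ^+ 2) (mu1 * (1 + eps) / eps).
  by rewrite le_max lexx.
have rr0 := ge0 _ rr1; have b00 := ge0 _ b0; have N00 := ge0 _ N1.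
have l00 := ge0 _ lg1.
have C0 : 0 <= 2 * 10 ^+ 5 :> R by rewrite mulr_ge0 // exprn_ge0.
have t1 := ler_pM C0 b00 (lexx _) hb.
have t1' := mulr_ge0 C0 b00.
have t2 := ler_pM t1' q0 t1 mx; have t2' := mulr_ge0 t1' q0.
have t3 := ler_pM t2' ler01 t2 kap1; have t3' := mulr_ge0 t2' (@ler01 R).
have t4 := ler_pM t3' N00 t3 hN; have t4' := mulr_ge0 t3' N00.
have t5 := ler_pM t4' rr0 t4 (lexx _); have t5' := mulr_ge0 t4' rr0.
exact: ler_pM t5' l00 t5 hl.
Qed.

(** From the second entry of the maximum, squared so that the powers 3/2 become cubes. *)
Lemma size_init : 0 < mu1 ->
  4 * 10 ^+ 10 * (b * lg) ^+ 3 * N ^+ 3 * (mu1 * kap * rr) ^+ 2 <= (M * eps) ^+ 2.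
Proof.
move=> mu10.
have ge0 (x : R) : 1 <= x -> 0 <= x by lra.
have b0 : 0 < b by move: b1; lra.
have N0 : 0 < N by move: N9; lra.
have l0 : 0 < lg by move: lg1; lra.
have rr0 := ge0 _ rr1; have kap0 := ge0 _ kap1.
have -> : 4 * 10 ^+ 10 * (b * lg) ^+ 3 * N ^+ 3 * (mu1 * kap * rr) ^+ 2 =
    (2 * 10 ^+ 5 * Y * (mu1 * kap * rr)) ^+ 2.
  rewrite /Y !exprMn !powR32_sq //; ring.
have C0 : 0 <= 2 * 10 ^+ 5 :> R by rewrite mulr_ge0 // exprn_ge0.
have Y0 : 0 <= Y by rewrite /Y !mulr_ge0 ?powR_ge0.
have CY := mulr_ge0 C0 Y0.
have lhs0 : 0 <= 2 * 10 ^+ 5 * Y * (mu1 * kap * rr).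
  by apply: mulr_ge0 => //; rewrite !mulr_ge0 // ltW.
have key : 2 * 10 ^+ 5 * Y * (mu1 * kap * rr) <= M * eps.
  rewrite -ler_pdivrMr //; apply: le_trans size.
  have mx : mu1 / eps <= Num.max (mu0 / eps ^+ 2) (mu1 * (1 + eps) / eps).
    rewrite le_max; apply/orP; right; rewrite ler_wpM2r ?invr_ge0 ?(ltW eps0) //.
    by rewrite ler_peMr ?(ltW mu10) //; move: eps0; lra.
  have -> : 2 * 10 ^+ 5 * Y * (mu1 * kap * rr) / eps =
      2 * 10 ^+ 5 * Y * kap * rr * (mu1 / eps).
    by field; rewrite gt_eqF.
  set mxx := Num.max _ _ in mx *.
  have -> : 2 * 10 ^+ 5 * b `^ (3 / 2) * mxx * kap * N `^ (3 / 2) * rr * lg `^ (3 / 2) =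
    2 * 10 ^+ 5 * Y * kap * rr * mxx by rewrite /Y; ring.
  by rewrite ler_wpM2l //; apply: mulr_ge0 => //; apply: mulr_ge0.
by rewrite lerXn2r ?nnegrE //; apply: le_trans key.
Qed.

End SampleSize.

(** Here the exponent 3/2 is used up: the squared initial error is of order [q * N / M], the squared
    radius of order [M / (b * lg * N) ^+ 2], and [q] of order [b * lg], so the condition is cubic in
    [b * lg] and in [N]. *)
Lemma init_radius (R : realType) (N M b lg rr mu1 kap eps sig q xi t : R) :
  0 < N -> 0 < M -> 0 < b -> 0 < lg -> 0 < rr -> 0 < eps -> 0 < sig ->
  0 <= q -> q <= 2 * (b * lg) -> xi ^+ 2 = mu1 ^+ 2 * (rr / N ^+ 2) * (kap * sig) ^+ 2 ->
  0 <= t ->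
  t ^+ 2 = expR 4 * (16 * q * ((N * N / M * xi) ^+ 2 * (expR 2 * (M / N)))) ->
  4 * 10 ^+ 10 * (b * lg) ^+ 3 * N ^+ 3 * (mu1 * kap * rr) ^+ 2 <= (M * eps) ^+ 2 ->
  2 * (Num.sqrt (2 * rr) * t) <=
    Num.sqrt (N * N / M)^-1 * eps / (20 * (8 * (b * lg))) * sig.
Proof.
move=> N0 M0 b0 l0 r0 e0 s0 q0 hq hxi t0 ht hs.
have bl0 : 0 < b * lg by exact: mulr_gt0.
apply: le_of_sqr_le.
- by rewrite !mulr_ge0 ?sqrtr_ge0.
- by rewrite !mulr_ge0 ?sqrtr_ge0 ?invr_ge0 // ?mulr_ge0 // ltW.
have E4 := expR_nat_le 4 (R := R); have E2 := expR_nat_le 2 (R := R).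
pose E : R := expR 4 * expR 2.
have E0 : 0 <= E by rewrite mulr_ge0 ?expR_ge0.
have hE : E <= 2 ^+ 12.
  apply: le_trans (ler_pM (expR_ge0 _) (expR_ge0 _) E4 E2) _.
  by rewrite -natrM -natrX ler_nat.
have -> : (2 * (Num.sqrt (2 * rr) * t)) ^+ 2 =
    2 ^+ 7 * E * q * (mu1 * kap * rr) ^+ 2 * sig ^+ 2 * N / M.
  rewrite !exprMn sqr_sqrtr ?mulr_ge0 ?(ltW r0) // ht exprMn hxi /E.
  by field; rewrite !gt_eqF.
have -> : (Num.sqrt (N * N / M)^-1 * eps / (20 * (8 * (b * lg))) * sig) ^+ 2 =
    M * eps ^+ 2 * sig ^+ 2 / (2 ^+ 10 * 25 * (b * lg) ^+ 2 * N ^+ 2).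
  rewrite !exprMn sqr_sqrtr; last by rewrite invr_ge0 divr_ge0 ?mulr_ge0 // ltW.
  by field; rewrite !gt_eqF.
rewrite -subr_ge0.
set W := (mu1 * kap * rr) ^+ 2 in hs *.
have W0 : 0 <= W by exact: sqr_ge0.
have -> : M * eps ^+ 2 * sig ^+ 2 / (2 ^+ 10 * 25 * (b * lg) ^+ 2 * N ^+ 2) -
    2 ^+ 7 * E * q * W * sig ^+ 2 * N / M =
    sig ^+ 2 / (2 ^+ 10 * 25 * (b * lg) ^+ 2 * N ^+ 2 * M) *
    ((M * eps) ^+ 2 - 2 ^+ 17 * 25 * E * q * (b * lg) ^+ 2 * N ^+ 3 * W).
  by field; rewrite !gt_eqF.
apply: mulr_ge0.
  by rewrite divr_ge0 ?sqr_ge0 // !mulr_ge0 ?exprn_ge0 // ltW.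
rewrite subr_ge0; apply: le_trans hs.
have Eq : E * q <= 2 ^+ 12 * (2 * (b * lg)) by exact: ler_pM.
have V0 : 0 <= (b * lg) ^+ 2 * N ^+ 3 * W.
  by apply: mulr_ge0 => //; rewrite mulr_ge0 ?exprn_ge0 // ltW.
have h := ler_wpM2r V0 Eq.
have V1 : 0 <= (b * lg) * ((b * lg) ^+ 2 * N ^+ 3 * W).
  by apply: mulr_ge0 => //; exact: ltW.
lra.
Qed.

Section TailNumerics.
Context {R : realType} (b lg v : R).
Hypotheses (lg4 : 4 <= expR lg) (lg1 : 1 <= lg) (bl : lg <= b * lg).

(** The choice [L = 8 * (b * lg)] gives the decay [n^(-4 beta)], half of which absorbs the factor
    [expR 1]. *)
Lemma multiplicity_tail :
  expR (2 * lg) * expR (1 - 8 * (b * lg) / 2) <= expR ((2 - 2 * b) * lg).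
Proof. by rewrite -expRD ler_expR; move: lg1 bl; lra. Qed.

Hypothesis hv : v <= expR (- 4 * (b * lg)).

(** The constant 4 is paid by one power of [n], that is [expR lg], affordable because [v] decays
    like [n^(-4 beta)]. *)
Lemma tail_margin (y : R) : lg + (2 * lg + - 4 * (b * lg)) <= y ->
  4 * (expR (2 * lg) * v) <= expR y.
Proof.
move=> hy; apply: le_trans (_ : expR lg * expR (2 * lg + - 4 * (b * lg)) <= _).
  rewrite expRD; apply: le_trans (_ : 4 * (expR (2 * lg) * expR (- 4 * (b * lg))) <= _).
    by rewrite ler_wpM2l // ler_wpM2l ?expR_ge0.
  by rewrite ler_wpM2r // mulr_ge0 ?expR_ge0.
by rewrite -expRD ler_expR.
Qed.

Lemma rip_tail : 8 * (expR (2 * lg) * v) <= 2 * expR ((2 - 2 * b) * lg).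
Proof.
have := @tail_margin ((2 - 2 * b) * lg); move: lg1 bl => h1 h2 h.
by suff h3 : lg + (2 * lg + - 4 * (b * lg)) <= (2 - 2 * b) * lg;
  [have := h h3; lra | lra].
Qed.

Lemma sampling_tail : 8 * (expR (2 * lg) * v) <= 2 * expR ((1 - b) * lg).
Proof.
have := @tail_margin ((1 - b) * lg); move: lg1 bl => h1 h2 h.
by suff h3 : lg + (2 * lg + - 4 * (b * lg)) <= (1 - b) * lg;
  [have := h h3; lra | lra].
Qed.

Lemma half_tail : 2 * (expR (2 * lg) * v) <= 1 / 2.
Proof.
have := @tail_margin 0; rewrite expR0; move: lg1 bl => h1 h2 h.
by suff h3 : lg + (2 * lg + - 4 * (b * lg)) <= 0; [have := h h3; lra | lra].
Qed.

End TailNumerics.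

(** The factor [2 ^+ 15] is 64 from the moment bound, 2 from [q] and [4 ^ 4] for [expR 4]. *)
Lemma rip_ratio (R : realType) (N M b lg mu0 rr eps q : R) :
  0 < N -> 0 < M -> 0 < eps -> 0 <= mu0 -> 0 <= rr -> 0 <= q ->
  q <= 2 * (b * lg) -> 2 ^+ 15 * (b * lg * N * mu0 * rr) <= M * eps ^+ 2 ->
  32 * q * (N * N / M * (2 * (mu0 * rr / N))) / eps ^+ 2 <= expR (- 4).
Proof.
move=> N0 M0 e0 mu00 rr0 q0 hq hM.
have e2 : 0 < eps ^+ 2 by rewrite exprn_gt0.
have -> : 32 * q * (N * N / M * (2 * (mu0 * rr / N))) / eps ^+ 2 =
  64 * (q * N * mu0 * rr) / (M * eps ^+ 2) by field; rewrite !gt_eqF.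
rewrite ler_pdivrMr ?mulr_gt0 // expRN -ler_pdivrMl ?invr_gt0 ?expR_gt0 // invrK.
have E4 := expR_nat_le 4 (R := R).
have q3 : q * N * mu0 * rr <= 2 * (b * lg * N * mu0 * rr).
  have -> : 2 * (b * lg * N * mu0 * rr) = 2 * (b * lg) * N * mu0 * rr by ring.
  by rewrite !ler_wpM2r // ltW.
have q4 : 0 <= q * N * mu0 * rr by rewrite !mulr_ge0 // ltW.
have := ler_wpM2r q4 E4; lra.
Qed.

Theorem theorem2p5 (R : realType) :
  exists C : R, 0 < C /\
  forall (n r m : nat) (X : 'M[R]_n) (mu0 mu1 : R)
         (alg : algorithm R) (eps0 beta : R),
    (9 <= n)%N -> (1 <= r <= n)%N -> (m <= n ^ 2)%N ->
    \rank X = r ->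
    assumption_A0 r mu0 X ->
    assumption_A1 r mu1 X ->
    valid_parameters alg ->
    admissible alg eps0 ->
    1 < beta ->
    C * beta `^ (3 / 2)
      * Num.max (mu0 / eps0 ^+ 2) (mu1 * (1 + eps0) / eps0)
      * cond_number X * n%:R `^ (3 / 2) * r%:R * ln n%:R `^ (3 / 2)
      <= m%:R ->
    1 - 3 * n%:R `^ (2 - 2 * beta) - 2 * n%:R `^ (1 - beta)
      <= sample_prob (iterates_converge alg n r m X).
Proof.
(* Its square exceeds the [25 * 2 ^+ 30] that [init_radius] consumes, and it exceeds the [2 ^+ 15]
   of [rip_ratio]. *)
exists (2 * 10 ^+ 5); split; first by rewrite mulr_gt0 // exprn_gt0.
move=> n r m X mu0 mu1 alg eps b n9 rn mn rkX hA0 hA1 hv ha b1 size.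
have /andP[r0 rn'] := rn.
have n0 : (0 < n)%N by exact: leq_trans n9.
have /andP[e0 e1] := admissible_bounds hv ha.
have [K [d [OO XX]]] : exists (K : 'M[R]_n) (d : 'rV[R]_n),
    K *m K^T = 1%:M /\ X^T *m X = K^T *m diag_mx d *m K.
  by apply: sym_spectral; rewrite trmx_mul trmxK.
have rk0 : (0 < \rank X)%N by rewrite rkX.
have hX := gram_is_pinv OO XX rk0.
have sig0 := sigma_min_pos OO XX rk0.
have sigm := sigma_min_max OO XX rk0.
have trX : \tr (gram_pinv X K d *m X) = r%:R.
  by rewrite (trace_gram_right OO XX rk0) rkX.
set G := gram_pinv X K d in hX trX.
have trX' : \tr (X *m G) = r%:R by rewrite mxtrace_mulC.
have [mu01 hinc] := incoherence r0 n0 hX trX' hA0.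
set N : R := n%:R in size *; set M : R := m%:R in size.
set lg := ln N in size.
have N9 : 9 <= N by rewrite ler_nat.
have N0 : 0 < N by lra.
have lg1 : 1 <= lg := ln_ge1 N9.
have mu00 : 0 <= mu0 := le_trans ler01 mu01.
have lg0 : 0 < lg := lt_le_trans ltr01 lg1.
have b0 : 0 < b := lt_trans ltr01 b1.
have lg4 : 4 <= expR lg by rewrite lnK //; lra.
have rr1 : 1 <= r%:R :> R by rewrite ler1n.
have rr0 : 0 < r%:R :> R by rewrite ltr0n.
have kap1 : 1 <= cond_number X by rewrite /cond_number ler_pdivlMr // mul1r.
have e2 : 0 < eps ^+ 2 by rewrite exprn_gt0.
have e2' : eps ^+ 2 <= 1 by rewrite exprn_ile1 // ltW.
have bl1 : 1 <= b * lg by have := ler_pM ler01 ler01 (ltW b1) lg1; rewrite mulr1.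
have bl : lg <= b * lg by rewrite ler_peMl //; lra.
have h1 := size_rip N9 b1 lg1 rr1 mu01 kap1 e0 size.
have NB0 : 0 < b * lg * N by rewrite mulr_gt0 //; lra.
have NB : b * lg * N <= b * lg * N * mu0 * r%:R.
  have : b * lg * N <= b * lg * N * mu0 by rewrite ler_peMr // ltW.
  have hh : 0 <= b * lg * N * mu0 by rewrite mulr_ge0 ?(ltW NB0) //; lra.
  by move=> h; apply: le_trans h _; rewrite ler_peMr.
have C1 : 2 ^+ 15 * (b * lg * N * mu0 * r%:R) <= M * eps ^+ 2.
  by apply: le_trans h1; lra.
have Me : 0 < M * eps ^+ 2 by lra.
have M0 : 0 < M by rewrite -(pmulr_lgt0 _ e2).
have m0 : (0 < m)%N by rewrite -(ltr0n R).
have MeM : M * eps ^+ 2 <= M by rewrite ler_piMr // ltW.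
have X0 : X != 0 by rewrite -mxrank_eq0 -lt0n.
have sn0 := spectral_norm_ge0 OO XX rk0.
have snm := spectral_norm_le_sigma_max OO XX rk0.
have smax0 : 0 < sigma_max X by exact: lt_le_trans sigm.
have [w wE] : exists w : R, w = Num.sqrt (r%:R / (n ^ 2)%:R) by eexists.
have w0 : 0 < w by rewrite wE sqrtr_gt0 divr_gt0 // ltr0n expn_gt0 n0.
(* A nonpositive [mu1] would force [X = 0] through A1, against the rank. *)
have mu10 : 0 < mu1.
  rewrite ltNge; apply/negP => mu1n; move/eqP: X0; apply.
  apply/matrixP => i j; rewrite mxE; apply/eqP; rewrite -normr_le0.
  apply: le_trans (entry_le_mx_norm X i j) _; apply: le_trans hA1 _.
  by rewrite -wE -mulrA mulr_le0_ge0 // mulr_ge0 // ltW.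
have [xi xiE] : exists xi, xi = mu1 * w * sigma_max X by eexists.
have xi0 : 0 < xi by rewrite xiE !mulr_gt0.
have hxi i j : `|X i j| <= xi.
  apply: le_trans (entry_le_mx_norm X i j) _; apply: le_trans hA1 _.
  by rewrite xiE -wE ler_wpM2l // mulr_ge0 // ltW.
have bl0 : 0 <= b * lg := le_trans ler01 bl1.
(* The moments are taken of order [2 q] with [q] about [beta ln n], so that a
   ratio [exp (-4)] to the power [q] beats the dimension factors. *)
have [q [q0 hq1 hq2]] : exists q : nat,
    [/\ (0 < q)%N, b * lg <= q%:R & q%:R <= 2 * (b * lg)].
  have /andP[q1 q2] := truncn_itv bl0.
  by exists (Num.truncn (b * lg)).+1; split=> //; [exact: ltW | rewrite -natr1; lra].
have qp : 0 < q%:R :> R by rewrite ltr0n.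
have [c cE'] : exists c : R, c = (n * n)%:R / m%:R by eexists.
have cE : c = N * N / M by rewrite cE' natrM.
have c0 : 0 < c by rewrite cE !mulr_gt0 // invr_gt0.
have [B BE] : exists B, B = 16 * q%:R * ((c * xi) ^+ 2 * (expR 2 * (M / N))).
  by eexists.
have B0 : 0 < B.
  by rewrite BE !mulr_gt0 ?expR_gt0 ?exprn_gt0 ?mulr_gt0 ?invr_gt0.
(* The ratio [B / t ^+ 2] in the tail of [sampling_concentration] becomes [expR (- 4)], which is
   also the bound on the ratio for the isometry. *)
have [t tE] : exists t, t = Num.sqrt (expR 4 * B) by eexists.
have t0 : 0 < t by rewrite tE sqrtr_gt0 mulr_gt0 // expR_gt0.
have tt : t ^+ 2 = expR 4 * B by rewrite tE sqr_sqrtr // mulr_ge0 ?expR_ge0 // ltW.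
have [L LE] : exists L, L = 8 * (b * lg) by eexists.
have L1 : 1 <= L by rewrite LE; lra.
have N2 : N ^+ 2 = expR (2 * lg) by rewrite expRM_natl lnK.
have P1 := @multiplicity_bound R n m L n0 mn.
have P3 := sampling_concentration n0 m0 q0 t0 hxi.
have hqmn : 2 * q%:R <= m%:R / n%:R :> R.
  by rewrite ler_pdivlMr // -/N -/M; have := ler_wpM2r (ltW N0) hq2; lra.
have {}P3 := P3 hqmn; rewrite -cE' -BE in P3.
have [rho rhoE] : exists rho, rho = 2 * (mu0 * r%:R / N) by eexists.
have hrho i j : nrm (tanp (X *m G) (G *m X) (delta_mx i j)) ^+ 2 <= rho.
  by rewrite rhoE; apply: (nrm_tanp_delta (pinv_left hX) (pinv_right hX));
    [case: (hinc i) | case: (hinc j)].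
have [A AE] : exists A, A = 32 * q%:R * (c * rho) by eexists.
have A0 : 0 <= A.
  have h : 0 <= mu0 * r%:R by exact: mulr_ge0.
  by rewrite AE rhoE; apply: mulr_ge0; apply: mulr_ge0 => //;
    rewrite ?(ltW c0) // mulr_ge0 // divr_ge0 // ltW.
have hA : A / eps ^+ 2 <= expR (- 4).
  by rewrite AE rhoE cE; apply: rip_ratio C1 => //; exact: ltW.
have hAq : (A / eps ^+ 2) ^+ q <= expR (- 4 * (b * lg)).
  by apply: pow_expN4_le => //; rewrite divr_ge0 // ltW.
have hK : 2 * (n * n)%:R * A ^+ q <= 1 / 2 :> R.
  have h : A ^+ q <= expR (- 4 * (b * lg)).
    apply: le_trans hAq; rewrite lerXn2r ?nnegrE ?divr_ge0 ?(ltW e2) //.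
    by rewrite ler_pdivlMr // ler_piMr.
  by rewrite natrM -/N -mulrA -expr2 N2; exact: half_tail lg4 lg1 bl h.
have P2 := @rip_probability R n m (X *m G) (G *m X) rho eps q n0 m0 q0 e0
  (pinv_left hX) (pinv_right hX) hrho.
cbv zeta in P2.
rewrite -cE' -AE in P2; have {}P2 := P2 hK.
have I0 : (0 < #|{: 'I_n * 'I_n}|)%N by rewrite card_pairs muln_gt0 n0.
rewrite sample_probE // -addrA -opprD; apply: prob_ge => //.
(* Bad events: an entry sampled too often, a failed isometry, an inaccurate rescaled sample. They
   cost one [n^(2 - 2 beta)], two [n^(2 - 2 beta)] and two [n^(1 - beta)]. *)
pose B1 (Om : sample n m) := exists i j : 'I_n,
  L < (\sum_k delta_mx (Om k).1 (Om k).2 : 'M[R]_n) i j.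
pose T := tanp (X *m G) (G *m X).
pose B2 (Om : sample n m) := exists Z, eps * c^-1 * nrm (T Z) ^+ 2 <
  `|ip (T Z) (P_Omega Om (T Z)) - c^-1 * nrm (T Z) ^+ 2|.
pose B3 (Om : sample n m) := exists x : 'rV[R]_n,
  t * nrm x < nrm (x *m (c *: P_Omega Om X - X)).
apply: le_trans (_ : prob (fun Om => B1 Om \/ (B2 Om \/ B3 Om)) <= _).
  apply: prob_le => Om bad; apply: contrapT => nB; apply: bad.
  have [nB1 nB2 nB3] : [/\ ~ B1 Om, ~ B2 Om & ~ B3 Om].
    by split=> h; apply: nB; [left | right; left | right; right].
  apply: (good_sample_converges (G := G) (eps := eps) (L := L) (t := t)) => //.
  - by rewrite m0.
  - exact: ltW.
  - by move=> i j; rewrite leNgt; apply/negP => h; apply: nB1; exists i, j.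
  - move=> Z; cbv zeta; rewrite -cE'.
    by rewrite leNgt; apply/negP => h; apply: nB2; exists Z.
  - move=> x; rewrite -cE'.
    by rewrite leNgt; apply/negP => h; apply: nB3; exists x.
  rewrite natrM LE; apply: (@init_radius R N M b lg r%:R mu1 (cond_number X) eps
    (sigma_min X) q%:R xi t) => //.
  - have -> : cond_number X * sigma_min X = sigma_max X.
      by rewrite /cond_number divfK // gt_eqF.
    by rewrite xiE 2!exprMn wE sqr_sqrtr ?divr_ge0 // natrX.
  - exact: ltW.
  - by rewrite tt BE cE.
  exact: (size_init N9 b1 lg1 rr1 kap1 e0 size mu10).
have N1 := powR_exp (1 - b) N0; have N22 := powR_exp (2 - 2 * b) N0.
rewrite -/lg in N1 N22.
have p1 : prob B1 <= N `^ (2 - 2 * b).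
  by apply: le_trans P1 _; rewrite -/N N2 N22 LE; exact: multiplicity_tail lg1 bl.
have p2 : prob B2 <= 2 * N `^ (2 - 2 * b).
  apply: le_trans P2 _.
  have -> : 4 * (2 * (n * n)%:R * A ^+ q) / eps ^+ q.*2 =
      8 * N ^+ 2 * (A / eps ^+ 2) ^+ q.
    rewrite natrM -mul2n exprM expr_div_n -/N.
    by set u := _ ^+ q; set v := _ ^+ q; ring.
  by rewrite -mulrA N2 N22; exact: rip_tail lg4 lg1 bl hAq.
have p3 : prob B3 <= 2 * N `^ (1 - b).
  apply: le_trans P3 _.
  have -> : 8 * n%:R ^+ 2 * B ^+ q / t ^+ q.*2 = 8 * N ^+ 2 * (expR (- 4)) ^+ q.
    rewrite -mul2n exprM tt exprMn expRN exprVn -/N.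
    by field; rewrite !expf_neq0 // gt_eqF // expR_gt0.
  have h4 := pow_expN4_le (expR_ge0 (- 4)) (lexx _) hq1.
  by rewrite -mulrA N2 N1; exact: sampling_tail lg4 lg1 bl h4.
apply: le_trans (prob_or _ _) _.
apply: le_trans (lerD p1 (le_trans (prob_or B2 B3) (lerD p2 p3))) _.
by rewrite addrA lerD2r -[X in X + _]mul1r -mulrDl.
Qed.
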